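(* Let $\lambda>0$ and $p_\lambda = \frac{e^\lambda}{e^\lambda+e^{-\lambda}}$. Let $\xi_1,\xi_2,\ldots$ be i.i.d. with $\mathbf{P}(\xi_1=1)=1-\mathbf{P}(\xi_1=-1)=p_\lambda$, and let $Y_n=\sum_{k=1}^n\xi_k$, $n\in\mathbb{N}_0$. Let $(w_x)_{x\in\mathbb{Z}}$ be an ergodic (stationary, ergodic under the shift) sequence of positive random variables. Let $((\tau_{r,x,k})_{r\ge 0})_{x\in\mathbb{Z},k\in\mathbb{N}_0}$ be a family of i.i.d. stochastic processes with paths in the Skorohod space $D[0,\infty)$ of right-continuous functions with left limits, such that $\mathbf{E}[\tau_{r,x,k}]=r$ for all $r\ge0$, $x\in\mathbb{Z}$, $k\in\mathbb{N}_0$. Assume that $(\xi_k)_k$, $(w_x)_x$ and $(\tau_{\cdot,x,k})_{x,k}$ are mutually independent. Set $T_0=0$, $T_n=\sum_{k=0}^{n-1}\tau_{w_{Y_k},Y_k,k}$ for $n\in\mathbb{N}$, and $X_t=Y_k$ for $T_k\le t<T_{k+1}$. Let $p_{\mathrm{esc}}(\lambda)=\mathbf{P}(Y_n\neq0\text{ for all }n\in\mathbb{N})=2p_\lambda-1=\frac{e^\lambda-e^{-\lambda}}{e^\lambda+e^{-\lambda}}$. Then $\overline{\mathrm{v}}:=\lim_{t\to\infty}X_t/t$ exists almost surely and $$\overline{\mathrm{v}}=\frac{p_{\mathrm{esc}}(\lambda)}{\mathbf{E}[w_0]}\quad\text{almost surely.}$$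
   Context: $\mathbf{E}$ denotes expectation with respect to $\mathbf{P}$. The quantity $\mathbf{E}[w_0]$ may be infinite, in which case the right-hand side is interpreted as $0$. *)

(* Defs.v *)
From HB Require Import structures.
From mathcomp Require Import all_boot all_order all_algebra.
From mathcomp Require Import all_classical all_reals all_analysis.
Set Implicit Arguments. Unset Strict Implicit. Unset Printing Implicit Defensive.
Import Order.TTheory GRing.Theory Num.Theory.
Import numFieldNormedType.Exports.
Local Open Scope classical_set_scope.
Local Open Scope ring_scope.

Section Defs.
Context (R : realType) (d : measure_display) (T : measurableType d).

Definition gen_sigma (I : Type) (J : set I) (f : I -> T -> R) : set (set T) :=
  <<s [set A | exists i, exists B : set R, [/\ J i, measurable B & A = f i @^-1` B]] >>.

Definition gen_sigma_int (f : T -> int) : set (set T) :=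
  <<s [set A | exists z : int, A = f @^-1` [set z]] >>.

Definition cyl_sigma (I : Type) : set (set (I -> R)) :=
  <<s [set A | exists i, exists B : set R, measurable B /\ A = [set g | B (g i)]] >>.

Definition mutually_independent (P : probability T R) (I : eqType)
  (F : I -> set (set T)) : Prop :=
  forall (s : seq I) (A : I -> set T), uniq s -> (forall i, i \in s -> F i (A i)) ->
    P (\bigcap_(i in [set` s]) A i) = (\prod_(i <- s) P (A i))%E.

Definition same_law (P : probability T R) (I : Type) (f g : T -> I -> R) : Prop :=
  forall B, @cyl_sigma I B -> P (f @^-1` B) = P (g @^-1` B).

Definition shiftZ (g : int -> R) : int -> R := fun x => g (x + 1).

Definition stationary_ergodic (P : probability T R) (w : int -> T -> R) : Prop :=
  let ws := fun t x => w x t in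
  (forall B, @cyl_sigma int B -> P (ws @^-1` B) = P ((shiftZ \o ws) @^-1` B)) /\
  (forall B, @cyl_sigma int B -> shiftZ @^-1` B = B ->
     P (ws @^-1` B) = 0%E \/ P (ws @^-1` B) = 1%E).

End Defs.

Definition cadlag (R : realType) (f : R -> R) : Prop :=
  (forall r : R, 0 <= r -> f x @[x --> r^'+] --> f r) /\
  (forall r : R, 0 < r -> cvg (f x @[x --> r^'-])).

Definition p_lambda (R : realType) (lam : R) : R :=
  expR lam / (expR lam + expR (- lam)).

(* index type for the independent family: xi_k, the environment w, tau_{x,k} *)
Definition idx := (nat + unit + (int * nat))%type.

(* Main.v *)
Require Import Defs.
From HB Require Import structures.
From mathcomp Require Import all_boot all_order all_algebra.
From mathcomp Require Import all_classical all_reals all_analysis.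
From mathcomp Require Import measurable_realfun.
From mathcomp Require Import ring lra zify.
Import Order.TTheory GRing.Theory Num.Theory.
Import numFieldNormedType.Exports.
Local Open Scope classical_set_scope.
Local Open Scope ring_scope.

(** Put [Z_k := tau_(w_(Y_k), Y_k, k)], so that [T_n] is the [n]-th partial sum
    of [Z].  Conditioning on the steps and on the environment and integrating
    out the holding times shows that [E (prod_i chi_i (xi_i) phi_i (Z_i))] is a
    functional of the environment seen from the walk; hence the sequence of
    pairs [(Z_k, xi_k)] is stationary.  A walk with drift makes its Cesaro
    averaged transition operator almost shift-invariant, so the correlations of
    observables along a fixed path average out by the ergodic theorem for [w];
    this gives convergence in L2 of the empirical averages, and the maximal
    inequality for stationary sequences upgrades it to almost sure convergence.
    Applied to the steps this is [Y_n / n -> 2 p - 1]; applied to truncated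
    holding times, with the maximal inequality once more for the remainders, it
    is [T_n / n -> E w_0] when the holding times are nonnegative, and the
    velocity follows by inverting the clock.

    The holding times are not assumed nonnegative.  If they are negative with
    positive probability, a local pattern of positive density makes the clock
    run backwards over a time interval already used at another site, so almost
    surely no path [X] is compatible with the clock. *)

Set Implicit Arguments. Unset Strict Implicit. Unset Printing Implicit Defensive.

(** * Maximal inequality and almost sure convergence of averages *)

Section Covering.
Context (R : realType).
Implicit Types (D : nat -> R) (a : R).

(** Only [w] is known to be ergodic, so the pointwise ergodic theorem cannot be quoted for the pairs
    [(Z_k, xi_k)]. A second-moment computation takes its place, for observables that prescribe every
    step: after a prescribed stretch the displacement is deterministic, so the conditional
    expectation given the environment factorises into a value at the start and a value at the end,
    and a time gap in between acts on the latter as a power of the transition operator. The drift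
    enters through the constant [(2 * p - 1)^-1], a Lipschitz bound for the summed powers that is
    independent of their number. The maximal inequality asks for stationarity but not for
    ergodicity, hence it is usable before ergodic averages are known, and also for the unbounded
    remainders of truncated holding times. The conclusion quantifies over every [X] compatible with
    the clock; this is why a clock that runs backwards has to be shown incompatible with all of
    them. *)

Definition exceeds D a (n k : nat) : bool :=
  [exists j : 'I_n, a * j.+1%:R < \sum_(i < j.+1) D (k + i)%N].

Lemma eq_exceeds D D' a n k k' : (forall i, D (k + i)%N = D' (k' + i)%N) ->
  exceeds D a n k = exceeds D' a n k'.
Proof.
by move=> DD'; apply: eq_existsb => j; congr (_ < _); apply: eq_bigr => i _.
Qed.

(* Greedy covering: when [k] is bad, jump over a block starting at [k] whose
   average exceeds [a]. *)
Lemma covering D a n L : (forall k, 0 <= D k) -> 0 <= a ->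
  a * \sum_(k < L) (exceeds D a n k)%:R <= \sum_(k < L + n) D k.
Proof.
move=> D0 a0; elim/ltn_ind: L D D0 => L IH D D0.
have sum0 m (F : nat -> R) : (forall k, 0 <= F k) -> 0 <= \sum_(k < m) F k.
  by move=> F0; apply: sumr_ge0.
case: L IH => [|L] IH; first by rewrite big_ord0 mulr0; exact: sum0.
have shiftE p k : exceeds D a n (p + k) = exceeds (fun i => D (p + i)%N) a n k.
  by apply: eq_existsb => j; under eq_bigr do rewrite -addnA.
have [/existsP[j hj]|Nb] := boolP (exceeds D a n 0).
  have le1 m p : \sum_(k < m) (exceeds D a n (p + k))%:R <= m%:R :> R.
    rewrite -[m in leRHS]card_ord -sum1_card natr_sum.
    by apply: ler_sum => i _; rewrite lern1 leq_b1.
  (* Either the bad block at [0] already contains all starting points, or the induction hypothesis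
     applies behind it. The slack [n] on the right leaves room for a last block that overruns
     [L]. *)
  have [Lj|jL] := leqP L.+1 j.+1.
    have -> : (L.+1 + n = j.+1 + (L.+1 + n - j.+1))%N.
      by have := ltn_ord j; lia.
    rewrite big_split_ord /=.
    apply: le_trans (_ : a * j.+1%:R <= _).
      by apply: ler_wpM2l => //; apply: le_trans (le1 L.+1 0%N) _; rewrite ler_nat.
    by apply: le_trans (ltW hj) _; rewrite lerDl; apply: sumr_ge0.
  have -> : (L.+1 = j.+1 + (L.+1 - j.+1))%N by lia.
  rewrite -addnA [in leLHS]big_split_ord (@big_split_ord _ _ _ j.+1 (_ + n)) /= mulrDr lerD//.
    apply: le_trans (_ : a * j.+1%:R <= _); last exact: ltW.
    by apply: ler_wpM2l => //; exact: (le1 j.+1 0%N).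
  under eq_bigr do rewrite shiftE.
  by apply: (IH _ _ (fun i => D (j.+1 + i)%N)) => //; lia.
rewrite addSn !big_ord_recl (negbTE Nb) mulrDr mulr0 lerD//.
under eq_bigr => i _ do rewrite lift0 -[i.+1]/(1 + i)%N shiftE.
by apply: (IH _ _ (fun i => D (1 + i)%N)) => //; lia.
Qed.
End Covering.

(** * Expectation calculus *)

Section Expectation.
Context (R : realType) (d : measure_display) (T : measurableType d).
Variable P : probability T R.
Implicit Types f g : T -> R.

Definition Ex f : R := (\int[P]_t f t)%R.
Definition intg f := P.-integrable setT (EFin \o f).
(** Bounded measurable functions, unlike integrable ones, are closed under products; most
    integrability below comes from [bmf_intg]. *)
Definition bmf f := measurable_fun setT f /\ exists C, forall t, `|f t| <= C.

Lemma bmf_intg f : bmf f -> intg f.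
Proof.
move=> [mf [C fC]]; apply: (@le_integrable _ _ _ P setT measurableT _ (cst C%:E)).
- exact/measurable_EFinP.
- by move=> t _ /=; rewrite lee_fin (le_trans (fC t))// ler_norm.
- by apply: finite_measure_integrable_cst.
Qed.

Lemma bmf_cst c : bmf (fun=> c).
Proof. by split; [exact: measurable_cst|exists `|c|]. Qed.

Lemma bmfD f g : bmf f -> bmf g -> bmf (fun t => f t + g t).
Proof.
move=> [mf [C hC]] [mg [C' hC']]; split; first exact: measurable_funD.
by exists (C + C') => t; rewrite (le_trans (ler_normD _ _))// lerD.
Qed.

Lemma bmfN f : bmf f -> bmf (fun t => - f t).
Proof.
move=> [mf [C hC]]; split; first exact: measurableT_comp.
by exists C => t; rewrite normrN.
Qed.

Lemma bmfB f g : bmf f -> bmf g -> bmf (fun t => f t - g t).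
Proof. by move=> bf bg; exact/bmfD/bmfN. Qed.

Lemma bmfM f g : bmf f -> bmf g -> bmf (fun t => f t * g t).
Proof.
move=> [mf [C hC]] [mg [C' hC']]; split; first exact: measurable_funM.
by exists (C * C') => t; rewrite normrM ler_pM.
Qed.

Lemma bmf_norm f : bmf f -> bmf (fun t => `|f t|).
Proof.
move=> [mf [C hC]]; split; first exact: measurableT_comp.
by exists C => t; rewrite normr_id.
Qed.

Lemma bmf_sum n (F : nat -> T -> R) : (forall i, bmf (F i)) ->
  bmf (fun t => \sum_(i < n) F i t).
Proof.
move=> bF; elim: n => [|n IH].
  by under eq_fun do rewrite big_ord0; exact: bmf_cst.
by under eq_fun do rewrite big_ord_recr; exact: bmfD.
Qed.

Lemma bmf_indic (A : set T) : measurable A -> bmf (\1_A : T -> R).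
Proof.
move=> mA; split; first exact: measurable_indic.
by exists 1 => t; rewrite indicE normr_nat lern1 leq_b1.
Qed.

Lemma bmf01 f : measurable_fun setT f -> (forall t, 0 <= f t <= 1) -> bmf f.
Proof.
move=> mf f01; split => //; exists 1 => t.
by have /andP[f0 f1] := f01 t; rewrite ger0_norm.
Qed.

Lemma intgD f g : intg f -> intg g -> intg (fun t => f t + g t).
Proof. by move=> fi gi; exact: (integrableD measurableT fi gi). Qed.

Lemma intgB f g : intg f -> intg g -> intg (fun t => f t - g t).
Proof. by move=> fi gi; exact: (integrableB measurableT fi gi). Qed.

Lemma intgZ c f : intg f -> intg (fun t => c * f t).
Proof. by move=> fi; exact: (integrableZl measurableT c fi). Qed.

Lemma intg_cst c : intg (fun=> c).
Proof. by apply/bmf_intg/bmf_cst. Qed.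

Lemma intg_sum n (F : nat -> T -> R) : (forall i, intg (F i)) ->
  intg (fun t => \sum_(i < n) F i t).
Proof.
move=> bF; elim: n => [|n IH].
  by under eq_fun do rewrite big_ord0; exact: intg_cst.
by under eq_fun do rewrite big_ord_recr; exact: intgD.
Qed.

Lemma ExD f g : intg f -> intg g -> Ex (fun t => f t + g t) = Ex f + Ex g.
Proof. by move=> fi gi; rewrite /Ex RintegralD. Qed.

Lemma ExB f g : intg f -> intg g -> Ex (fun t => f t - g t) = Ex f - Ex g.
Proof. by move=> fi gi; rewrite /Ex RintegralB. Qed.

Lemma ExZ c f : intg f -> Ex (fun t => c * f t) = c * Ex f.
Proof. by move=> fi; rewrite /Ex RintegralZl. Qed.

Lemma Ex_cst c : Ex (fun=> c) = c.
Proof. by rewrite /Ex Rintegral_cst//= probability_setT mulr1. Qed.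

Lemma Ex_sum n (F : nat -> T -> R) : (forall i, intg (F i)) ->
  Ex (fun t => \sum_(i < n) F i t) = \sum_(i < n) Ex (F i).
Proof.
move=> bF; elim: n => [|n IH].
  by under eq_fun do rewrite big_ord0; rewrite Ex_cst big_ord0.
under eq_fun do rewrite big_ord_recr.
by rewrite ExD//; [rewrite IH big_ord_recr | exact: intg_sum].
Qed.

Lemma Ex_le f g : intg f -> intg g -> (forall t, f t <= g t) -> Ex f <= Ex g.
Proof. by move=> fi gi fg; apply: le_Rintegral => // t _. Qed.

Lemma Ex_ge0 f : (forall t, 0 <= f t) -> 0 <= Ex f.
Proof. by move=> f0; apply: Rintegral_ge0. Qed.

Lemma Ex_norm f : intg f -> `|Ex f| <= Ex (fun t => `|f t|).
Proof. by move=> fi; apply: le_normr_Rintegral. Qed.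

Lemma Ex_fin f : intg f -> (Ex f)%:E = (\int[P]_t (f t)%:E)%E.
Proof. by move=> fi; rewrite /Ex fineK//; exact: integrable_fin_num. Qed.

Lemma Ex_indic (A : set T) : measurable A -> (Ex \1_A)%:E = P A.
Proof.
move=> mA; rewrite Ex_fin; last exact/bmf_intg/bmf_indic.
by rewrite integral_indic// setIT.
Qed.

Lemma eq_Ex f g : f =1 g -> Ex f = Ex g.
Proof. by move=> /funext ->. Qed.

Lemma Ex_ae f g : measurable_fun setT f -> measurable_fun setT g ->
  {ae P, forall t, f t = g t} -> Ex f = Ex g.
Proof.
move=> mf mg fg; rewrite /Ex /Rintegral; congr fine.
apply: ae_eq_integral => //; [exact/measurable_EFinP|exact/measurable_EFinP|].
by apply: filterS fg => t -> _.
Qed.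

End Expectation.

(** * From the maximal inequality to almost sure convergence *)

Section AlmostSure.
Context (R : realType) (d : measure_display) (T : measurableType d).
Variable P : probability T R.
Implicit Types D F H : nat -> T -> R.

(** The null set is the intersection of exceptional sets of measure at most [1/(k+1)], which avoids
    any measurability of [Q]. *)
Lemma ae_small (Q : T -> Prop) :
  (forall e : R, 0 < e -> exists B : set T,
     [/\ measurable B, (P B <= e%:E)%E & forall t, ~ B t -> Q t]) ->
  {ae P, forall t, Q t}.
Proof.
move=> h.
have e0 (k : nat) : 0 < k.+1%:R^-1 :> R by rewrite invr_gt0.
pose B k := projT1 (cid (h _ (e0 k))).
have hB k : [/\ measurable (B k), (P (B k) <= (k.+1%:R^-1)%:E)%E &
   forall t, ~ B k t -> Q t] by rewrite /B; case: cid.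
exists (\bigcap_k B k); split.
- by apply: bigcapT_measurable => k; have [] := hB k.
- apply/eqP; rewrite eq_le measure_ge0 andbT.
  apply/lee_addgt0Pr => e e_gt0; rewrite add0e.
  have [k ke] : exists k : nat, k.+1%:R^-1 < e.
    exists (Num.truncn e^-1); rewrite -[ltRHS]invrK ltf_pV2 ?posrE ?invr_gt0//.
    by rewrite truncnS_gt.
  apply: le_trans (_ : P (B k) <= _)%E.
    apply: le_measure; rewrite ?inE.
    + by apply: bigcapT_measurable => i; have [] := hB i.
    + by have [] := hB k.
    + by move=> t; apply.
  by have [_ Pk _] := hB k; apply: le_trans Pk _; rewrite lee_fin ltW.
- move=> t nQ k _; apply: contrapT => nB; apply: nQ.
  by have [_ _] := hB k; apply.
Qed.

Lemma average_cvg (s : nat -> R) (c : R) :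
  (forall e, 0 < e -> exists N, forall n, (N <= n)%N ->
     `|s n - c * n%:R| <= e * n%:R) ->
  (fun n => s n / n%:R) @ \oo --> c.
Proof.
move=> h; apply/cvgrPdist_le => e e0; have [N hN] := h e e0.
exists N.+1 => // n /= Nn.
have n0 : 0 < n%:R :> R by rewrite ltr0n (leq_trans _ Nn).
rewrite distrC -[X in `|_ - X|](@mulfK _ n%:R) ?gt_eqF// -mulrBl normrM.
rewrite (ger0_norm (_ : 0 <= n%:R^-1)); last by rewrite invr_ge0.
by rewrite ler_pdivrMr//; apply: hN; exact: ltnW.
Qed.

Lemma exceedsP (D : nat -> R) a n :
  reflect (exists j, [/\ (0 < j)%N, (j <= n)%N & a * j%:R < \sum_(i < j) D i])
          (exceeds D a n 0).
Proof.
apply: (iffP existsP) => [[j hj]|[[|j] []// _ jn hj]].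
  by exists j.+1; split => //; exact: ltn_ord.
by exists (Ordinal jn).
Qed.

Lemma measurable_exceeds D a n k : (forall k, measurable_fun setT (D k)) ->
  measurable [set t | exceeds (D ^~ t) a n k].
Proof.
move=> mD.
rewrite (_ : [set _ | _] = \bigcup_(j in [set j | (j < n)%N])
   [set t | a * j.+1%:R < \sum_(i < j.+1) D (k + i)%N t]).
  apply: bigcup_measurable => j _.
  rewrite -[X in measurable X]setTI; apply: measurable_fun_ltr => //.
  exact: (measurable_sum _ (fun i : 'I_j.+1 => mD (k + i)%N)).
apply/seteqP; split => t /=.
  by move=> /existsP[j hj]; exists j => //=; exact: ltn_ord.
by move=> [j /= jn hj]; apply/existsP; exists (Ordinal jn).
Qed.

(** The trace of stationarity that the covering argument uses besides equal means: a bad start is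
    equally likely at every time. *)
Definition exceeds_stationary D := forall a n k,
  P [set t | exceeds (D ^~ t) a n k] = P [set t | exceeds (D ^~ t) a n 0].

(** Integrating [covering] over [L] starting points gives [a * L * p <= (L + n) * e], with [p] the
    probability of a bad start and [e] the common mean. Large [L] removes [n], and continuity from
    below lets the window bound tend to infinity. *)
Theorem maximal_inequality D a : (forall k t, 0 <= D k t) ->
  (forall k, intg P (D k)) -> (forall k, Ex P (D k) = Ex P (D 0%N)) ->
  exceeds_stationary D -> 0 < a ->
  measurable [set t | exists n, exceeds (D ^~ t) a n 0] /\
  (P [set t | exists n, exceeds (D ^~ t) a n 0] <= (Ex P (D 0%N) / a)%:E)%E.
Proof.
move=> D0 iD eD sD a0.
have mD k : measurable_fun setT (D k) by apply/measurable_EFinP/measurable_int/iD.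
pose E n k := [set t | exceeds (D ^~ t) a n k].
have mE n k : measurable (E n k) by exact: measurable_exceeds.
have -> : [set t | exists n, exceeds (D ^~ t) a n 0] = \bigcup_n E n 0%N.
  by apply/seteqP; split => t [n] h; exists n.
have ndE : nondecreasing_seq (E^~ 0%N).
  move=> m n mn; apply/subsetPset => t /exceedsP[j [j0 jm hj]].
  by apply/exceedsP; exists j; rewrite (leq_trans jm).
split; first exact: bigcup_measurable.
have cE := @nondecreasing_cvg_mu _ _ _ P _ (mE^~ 0%N) (bigcup_measurable (fun k _ => mE k 0%N)) ndE.
apply: (cvge_le _ cE); apply: nearW => n /=; rewrite -Ex_indic// lee_fin.
set p := Ex _ _; set e := Ex _ _; rewrite leNgt; apply/negP; rewrite ltr_pdivrMr// => ep.
have ic k : intg P (\1_(E n k) : T -> R) by exact/bmf_intg/bmf_indic.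
have pE k : Ex P \1_(E n k) = p.
  by apply: EFin_inj; rewrite !Ex_indic//; exact: sD.
have key (L : nat) : a * (L%:R * p) <= (L + n)%:R * e.
  have cov := fun t => covering n L (fun k => D0 k t) (ltW a0).
  have isum := intg_sum L ic; have dsum := intg_sum (L + n) iD.
  have -> : a * (L%:R * p) = Ex P (fun t => a * \sum_(k < L) \1_(E n k) t).
    rewrite ExZ// (Ex_sum L ic) (eq_bigr (fun=> p)) => [|i _]; last exact: pE.
    by rewrite sumr_const card_ord mulr_natl.
  have -> : (L + n)%:R * e = Ex P (fun t => \sum_(k < L + n) D k t).
    rewrite (Ex_sum (L + n) iD) (eq_bigr (fun=> e)) => [|i _]; last exact: eD.
    by rewrite sumr_const card_ord mulr_natl.
  apply: Ex_le => //; first exact: intgZ.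
  move=> t.
  apply: le_trans (cov t); apply: ler_wpM2l; first exact: ltW.
  apply: ler_sum => i _; rewrite indicE ler_nat.
  by case: (boolP (t \in E n i)); rewrite ?inE// => ->.
have n0 : 0 <= n%:R * e by rewrite mulr_ge0// Ex_ge0.
have pe0 : 0 < p * a - e by rewrite subr_gt0.
(* [key] reads [L * (p * a - e) <= n * e], which fails for [L] beyond [n * e / (p * a - e)]. *)
have := key (Num.truncn (n%:R * e / (p * a - e))).+1.
set L := _.+1 => kL.
have : n%:R * e / (p * a - e) < L%:R by rewrite truncnS_gt.
rewrite ltr_pdivrMr// natrD in kL * => h; nra.
Qed.

(** The event that the limsup of the averages is strictly above [a]. The margin [1/(j+1)] makes it
    insensitive to dropping the first term. *)
Definition limsup_gt D (a : R) : set T := [set t | exists j : nat, forall N,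
  exists2 n, (N <= n)%N & (a + j.+1%:R^-1) * n%:R < \sum_(i < n) D i t].

(** On this event some average exceeds [a], so by the maximal inequality its probability is at most
    the mean over [a], which is below one; the zero-one alternative leaves only zero. *)
Lemma limsup_gt0 D a : (forall k t, 0 <= D k t) ->
  (forall k, intg P (D k)) -> (forall k, Ex P (D k) = Ex P (D 0%N)) ->
  exceeds_stationary D ->
  P (limsup_gt D a) = 0%E \/ P (limsup_gt D a) = 1%E ->
  measurable (limsup_gt D a) -> Ex P (D 0%N) < a -> P (limsup_gt D a) = 0%E.
Proof.
move=> D0 iD eD sD [//|P1] mL Da.
have a0 : 0 < a by apply: le_lt_trans Da; rewrite Ex_ge0.
have [mM hM] := maximal_inequality D0 iD eD sD a0.
suff : (1 <= (Ex P (D 0%N) / a)%:E :> \bar R)%E.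
  by rewrite lee_fin ler_pdivlMr// mul1r leNgt Da.
rewrite -P1; apply: le_trans hM; apply: le_measure; rewrite ?inE//.
move=> t [j /(_ 1%N) [n n0 hn]]; exists n; apply/exceedsP; exists n; split => //.
apply: le_lt_trans hn; apply: ler_wpM2r => //.
by rewrite lerDl invr_ge0.
Qed.

Lemma limsup_gtNP D a t : ~ limsup_gt D a t -> forall e, 0 < e ->
  exists N, forall n, (N <= n)%N -> \sum_(i < n) D i t <= (a + e) * n%:R.
Proof.
move=> nl e e0; apply: contrapT => /forallNP h; apply: nl.
exists (Num.truncn e^-1) => N; have /existsNP[n /not_implyP[Nn hn]] := h N.
exists n => //; move/negP : hn; rewrite -ltNge; apply: le_lt_trans.
apply: ler_wpM2r => //; rewrite lerD2l ltW// -[ltRHS]invrK ltf_pV2 ?posrE ?invr_gt0//.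
by rewrite truncnS_gt.
Qed.

(** [limsup_gt0] at levels [1/(m+1)] above the mean bounds the averages of [H] from above; the same
    applied to [1 - H] bounds them from below. *)
Theorem ergodic_average H :
  (forall k, measurable_fun setT (H k)) -> (forall k t, 0 <= H k t <= 1) ->
  (forall k, Ex P (H k) = Ex P (H 0%N)) ->
  exceeds_stationary H -> exceeds_stationary (fun k t => 1 - H k t) ->
  (forall a, measurable (limsup_gt H a) /\
     (P (limsup_gt H a) = 0%E \/ P (limsup_gt H a) = 1%E)) ->
  (forall a, measurable (limsup_gt (fun k t => 1 - H k t) a) /\
     (P (limsup_gt (fun k t => 1 - H k t) a) = 0%E \/
      P (limsup_gt (fun k t => 1 - H k t) a) = 1%E)) ->
  {ae P, forall t, (fun n => (\sum_(i < n) H i t) / n%:R) @ \oo --> Ex P (H 0%N)}.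
Proof.
move=> mH H01 eH sH sH' zH zH'; set c := Ex _ _.
have bH k : bmf (H k) by exact: bmf01.
have bH' k : bmf (fun t => 1 - H k t) by apply/bmfB; [exact: bmf_cst|].
have i1 : intg P (fun=> 1 : R) by exact: intg_cst.
have cH' k : Ex P (fun t => 1 - H k t) = 1 - c.
  by rewrite ExB// ?Ex_cst ?eH//; exact: bmf_intg.
have neg D a : measurable (limsup_gt D a) -> P (limsup_gt D a) = 0%E ->
    {ae P, forall t, ~ limsup_gt D a t}.
  by move=> mL L0; exists (limsup_gt D a); split => // t /contrapT.
have up (m : nat) : {ae P, forall t, ~ limsup_gt H (c + m.+1%:R^-1) t}.
  have [mL zL] := zH (c + m.+1%:R^-1); apply: neg => //.
  apply: limsup_gt0 => //.
  - by move=> k t; have /andP[] := H01 k t.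
  - by move=> k; exact: bmf_intg.
  - by rewrite ltrDl invr_gt0.
have dn (m : nat) : {ae P, forall t,
    ~ limsup_gt (fun k t => 1 - H k t) (1 - c + m.+1%:R^-1) t}.
  have [mL zL] := zH' (1 - c + m.+1%:R^-1); apply: neg => //.
  apply: limsup_gt0 => //.
  - by move=> k t; rewrite subr_ge0; have /andP[] := H01 k t.
  - by move=> k; exact: bmf_intg.
  - by move=> k; rewrite !cH'.
  - by rewrite cH' ltrDl invr_gt0.
have {up dn} : {ae P, forall t, forall m, ~ limsup_gt H (c + m.+1%:R^-1) t /\
    ~ limsup_gt (fun k t => 1 - H k t) (1 - c + m.+1%:R^-1) t}.
  by apply: ae_foralln => m; near=> t; split; near: t.
apply: filterS => t ht; apply: average_cvg => e e0.
have e20 : 0 < e / 2 by rewrite divr_gt0.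
have [m me] : exists m : nat, m.+1%:R^-1 < e / 2.
  exists (Num.truncn (e / 2)^-1); rewrite -[ltRHS]invrK ltf_pV2 ?posrE ?invr_gt0//.
  by rewrite truncnS_gt.
have [/limsup_gtNP/(_ _ e20)[N1 h1] /limsup_gtNP/(_ _ e20)[N2 h2]] := ht m.
exists (maxn N1 N2) => n; rewrite geq_max => /andP[n1 n2].
have := h2 n n2; rewrite sumrB sumr_const card_ord; have := h1 n n1.
have n0 : 0 <= n%:R :> R by [].
have hm : m.+1%:R^-1 * n%:R <= e / 2 * n%:R by apply: ler_wpM2r => //; exact: ltW.
move: hm; rewrite ler_norml; set s := \sum_(_ < _) _; set x := m.+1%:R^-1.
by move=> hm q1 q2; apply/andP; split; lra.
Unshelve. all: end_near. Qed.

(** [G m k] is the deviation of the block average of length [m] starting at [k]. Replacing [F] by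
    its block averages changes a sum over [n] times by at most [m], so where all averages of [G m]
    stay below [a], the sum of [F] is within [a * n + m] of [c * n]. The maximal inequality makes
    the complement rare as soon as [G m] has a small mean. *)
Theorem average_upgrade F :
  (forall k, measurable_fun setT (F k)) -> (forall k t, 0 <= F k t <= 1) ->
  let c := Ex P (F 0%N) in
  let G m k t := `|(\sum_(i < m) F (k + i)%N t) / m%:R - c| in
  (forall m k, Ex P (G m k) = Ex P (G m 0%N)) ->
  (forall m, exceeds_stationary (G m)) ->
  (forall e, 0 < e -> exists2 m, (0 < m)%N & Ex P (G m 0%N) <= e) ->
  {ae P, forall t, (fun n => (\sum_(i < n) F i t) / n%:R) @ \oo --> c}.
Proof.
move=> mF F01 c G eG sG sm.
have bF k : bmf (F k) by exact: bmf01.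
have bG m k : bmf (G m k).
  apply/bmf_norm/bmfB; last exact: bmf_cst.
  apply: bmfM; last exact: bmf_cst.
  by apply: (bmf_sum _ (fun i => bF (k + i)%N)).
have G0 m k t : 0 <= G m k t by exact: normr_ge0.
have key m t a : (0 < m)%N -> ~ (exists n, exceeds (G m ^~ t) a n 0) ->
    forall n, `|\sum_(i < n) F i t - c * n%:R| <= a * n%:R + m%:R.
  move=> m0 ne [|n]; first by rewrite big_ord0 !mulr0 subr0 normr0 add0r.
  have S1 : \sum_(k < n.+1) G m k t <= a * n.+1%:R.
    rewrite leNgt; apply/negP => h; apply: ne; exists n.+1.
    by apply/exceedsP; exists n.+1.
  set S := \sum_(i < n.+1) F i t.
  have m0' : 0 < m%:R :> R by rewrite ltr0n.
  (* Shifting the window by [i] trades [i] terms at one end for [i] terms at the other. *)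
  have sh i : (i < m)%N -> `|\sum_(k < n.+1) F (k + i)%N t - S| <= m%:R.
    move=> im.
    have e1 : \sum_(k < n.+1) F (k + i)%N t =
        \sum_(k < i + n.+1) F k t - \sum_(k < i) F k t.
      rewrite big_split_ord /= addrAC subrr add0r.
      by apply: eq_bigr => k _; rewrite addnC.
    have e2 : \sum_(k < i + n.+1) F k t = S + \sum_(k < i) F (n.+1 + k)%N t.
      by rewrite addnC big_split_ord.
    rewrite e1 e2; set u := \sum_(k < i) F (n.+1 + k)%N t; set v := \sum_(k < i) F k t.
    have -> : S + u - v - S = u - v by ring.
    have b j : 0 <= \sum_(k < i) F (j + k)%N t <= i%:R.
      apply/andP; split.
        by apply: sumr_ge0 => k _; have /andP[] := F01 (j + k)%N t.
      rewrite -[X in _ <= X%:R]card_ord -sum1_card natr_sum.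
      by apply: ler_sum => k _; have /andP[] := F01 (j + k)%N t.
    have im' : i%:R <= m%:R :> R by rewrite ler_nat ltnW.
    have /andP[? ?] : 0 <= v <= i%:R := b 0%N.
    have /andP[? ?] : 0 <= u <= i%:R := b n.+1.
    by rewrite ler_norml; apply/andP; split; lra.
  have e3 : \sum_(k < n.+1) ((\sum_(i < m) F (k + i)%N t) / m%:R - c) =
     (\sum_(i < m) (\sum_(k < n.+1) F (k + i)%N t)) / m%:R - c * n.+1%:R.
    rewrite sumrB sumr_const card_ord mulr_natr; congr (_ - _).
    by rewrite -mulr_suml exchange_big.
  have e4 : `|(\sum_(i < m) (\sum_(k < n.+1) F (k + i)%N t)) / m%:R - S| <= m%:R.
    rewrite -[X in _ - X](@mulfK _ m%:R) ?gt_eqF// -mulrBl normrM.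
    rewrite (ger0_norm (_ : 0 <= m%:R^-1)); last by rewrite invr_ge0.
    rewrite ler_pdivrMr// -{1}[m in S * m%:R]card_ord mulr_natr -sumr_const -sumrB.
    apply: le_trans (ler_norm_sum _ _ _) _.
    apply: le_trans (_ : \sum_(i < m) m%:R <= _).
      by apply: ler_sum => i _; exact: sh.
    by rewrite sumr_const card_ord mulr_natr.
  have e5 : `|\sum_(k < n.+1) ((\sum_(i < m) F (k + i)%N t) / m%:R - c)|
      <= a * n.+1%:R.
    by apply: le_trans (ler_norm_sum _ _ _) S1.
  move: e4 e5; rewrite e3; set u := _ / _.
  rewrite !ler_norml => /andP[? ?] /andP[? ?]; apply/andP; split; lra.
have neg (a : R) : 0 < a -> {ae P, forall t, exists M, forall n,
    `|\sum_(i < n) F i t - c * n%:R| <= a * n%:R + M}.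
  move=> a0; apply: ae_small => e e0.
  (* A mean of at most [e * a] makes the maximal event at level [a] have probability at most [e]. *)
  have [m m0 hm] := sm (e * a) (mulr_gt0 e0 a0).
  have [mM hM] := maximal_inequality (G0 m) (fun k => bmf_intg P (bG m k)) (eG m) (sG m) a0.
  exists [set t | exists n, exceeds (G m ^~ t) a n 0]; split => //.
    by apply: le_trans hM _; rewrite lee_fin ler_pdivrMr.
  by move=> t nt; exists m%:R => n; exact: key.
have {neg} : {ae P, forall t, forall j : nat, exists M, forall n,
    `|\sum_(i < n) F i t - c * n%:R| <= j.+1%:R^-1 * n%:R + M}.
  by apply: ae_foralln => j; apply: neg; rewrite invr_gt0.
apply: filterS => t ht; apply: average_cvg => e e0.
have e20 : 0 < e / 2 by rewrite divr_gt0.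
have [j je] : exists m : nat, m.+1%:R^-1 < e / 2.
  exists (Num.truncn (e / 2)^-1); rewrite -[ltRHS]invrK ltf_pV2 ?posrE ?invr_gt0//.
  by rewrite truncnS_gt.
have [M hM] := ht j.
exists (Num.truncn (M / (e / 2))).+1 => n Nn.
apply: le_trans (hM n) _.
have : M / (e / 2) < n%:R.
  by apply: lt_le_trans (truncnS_gt _) _; rewrite ler_nat.
rewrite ltr_pdivrMr// => h; have n0 : 0 <= n%:R :> R by [].
have hm : j.+1%:R^-1 * n%:R <= e / 2 * n%:R by apply: ler_wpM2r => //; exact: ltW.
move: hm; set x := j.+1%:R^-1 => hm; lra.
Qed.

End AlmostSure.

(** * Laws and independence *)

Section Transfer.
Context (R : realType) (d : measure_display) (T : measurableType d).
Variable P : probability T R.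

Lemma ge0_integral_eq_law d' (S : measurableType d') (f g : T -> S)
    (h : S -> \bar R) : measurable_fun setT f -> measurable_fun setT g ->
  (forall B, measurable B -> P (f @^-1` B) = P (g @^-1` B)) ->
  measurable_fun setT h -> (forall x, 0 <= h x)%E ->
  (\int[P]_t h (f t) = \int[P]_t h (g t))%E.
Proof.
move=> mf mg fg mh h0.
have := ge0_integral_pushforward mf P measurableT mh (fun y _ => h0 y).
have := ge0_integral_pushforward mg P measurableT mh (fun y _ => h0 y).
rewrite !preimage_setT => <- <-.
pose X : {mfun T >-> S} := HB.pack f (isMeasurableFun.Build _ _ _ _ f mf).
pose Y : {mfun T >-> S} := HB.pack g (isMeasurableFun.Build _ _ _ _ g mg).
apply: (eq_measure_integral (distribution P Y) (m1 := distribution P X)).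
by move=> B mB _; exact: fg.
Qed.

Lemma Ex_eq_law d' (S : measurableType d') (f g : T -> S) (h : S -> R) :
  measurable_fun setT f -> measurable_fun setT g ->
  (forall B, measurable B -> P (f @^-1` B) = P (g @^-1` B)) ->
  measurable_fun setT h -> Ex P (fun t => h (f t)) = Ex P (fun t => h (g t)).
Proof.
move=> mf mg fg mh; congr fine; rewrite [LHS]integralE [RHS]integralE.
have mh' : measurable_fun setT (EFin \o h) by exact/measurable_EFinP.
rewrite -[fun x => (h (f x))%:E]/((EFin \o h) \o f).
rewrite -[fun x => (h (g x))%:E]/((EFin \o h) \o g).
rewrite (funepos_comp (EFin \o h) f) (funepos_comp (EFin \o h) g).
rewrite (funeneg_comp (EFin \o h) f) (funeneg_comp (EFin \o h) g); congr (_ - _)%E.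
- exact: (ge0_integral_eq_law mf mg fg (measurable_funepos mh') (funepos_ge0 _)).
- exact: (ge0_integral_eq_law mf mg fg (measurable_funeneg mh') (funeneg_ge0 _)).
Qed.

(** Tonelli for the joint law, which independence identifies with the product of the marginals.
    Taking for [T1] and [T2] the sample space with smaller sigma-algebras turns this into
    integration of one factor with the others frozen. *)
Lemma integral_indep d1 d2 (T1 : measurableType d1) (T2 : measurableType d2)
    (X : T -> T1) (Y : T -> T2) (F : T1 * T2 -> \bar R) :
  measurable_fun setT X -> measurable_fun setT Y ->
  (forall A B, measurable A -> measurable B ->
    P (X @^-1` A `&` Y @^-1` B) = (P (X @^-1` A) * P (Y @^-1` B))%E) ->
  measurable_fun setT F -> (forall z, 0 <= F z)%E ->
  (\int[P]_t F (X t, Y t) = \int[P]_s \int[P]_t F (X s, Y t))%E /\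
  measurable_fun setT (fun x => \int[P]_t F (x, Y t))%E.
Proof.
move=> mX mY indep mF F0.
pose X' : {mfun T >-> T1} := HB.pack X (isMeasurableFun.Build _ _ _ _ X mX).
pose Y' : {mfun T >-> T2} := HB.pack Y (isMeasurableFun.Build _ _ _ _ Y mY).
have mXY : measurable_fun setT (fun t => (X t, Y t)) by exact: measurable_fun_pair.
pose XY : {mfun T >-> (T1 * T2)%type} :=
  HB.pack (fun t => (X t, Y t)) (isMeasurableFun.Build _ _ _ _ _ mXY).
have FY x : (\int[distribution P Y']_y F (x, y) = \int[P]_t F (x, Y t))%E.
  rewrite ge0_integral_distribution//.
  exact: measurableT_comp.
have FE : fubini_F (distribution P Y') F = (fun x => \int[P]_t F (x, Y t))%E.
  by apply/funext => x; rewrite /fubini_F FY.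
have mFY := @measurable_fun_fubini_tonelli_F _ _ _ _ R (distribution P Y') F mF F0.
rewrite FE in mFY; split => //.
have := @fubini_tonelli1 _ _ _ _ R (distribution P X') (distribution P Y') F mF F0.
rewrite FE ge0_integral_distribution//; last by move=> x; apply: integral_ge0.
move=> <-.
have <- := @ge0_integral_distribution _ _ _ _ _ P XY F mF F0.
apply: eq_measure_integral => B mB _; apply/esym.
by apply: product_measure_unique => // A C mA mC; exact: indep.
Qed.

(** The generators are those of [cyl_sigma], so the measurable sets of this type are the events that
    [same_law] and [stationary_ergodic] speak about. *)
Definition cylT (I : Type) := g_sigma_algebraType
  [set A : set (I -> R) | exists i B, measurable B /\ A = [set g | B (g i)]].

Lemma measurable_coord (I : Type) (i : I) :
  measurable_fun setT (fun g : cylT I => g i).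
Proof.
move=> _ B mB; rewrite setTI; apply: sub_sigma_algebra.
by exists i, B.
Qed.

Lemma measurable_cyl d' (S : measurableType d') (I : Type) (f : S -> I -> R) :
  (forall i, measurable_fun setT (fun s => f s i)) ->
  measurable_fun setT (f : S -> cylT I).
Proof.
move=> mf.
apply: (@measurability _ _ S (cylT I) setT f _ erefl).
by move=> _ [_ [i [B [mB ->]]] <-]; exact: mf.
Qed.

(** Finite-dimensional rectangles form a pi-system that generates the cylinder sigma-algebra. The
    index lists may overlap, hence the implications in the intersection of two rectangles. *)
Lemma cyl_law_unique (I : eqType) (f g : T -> I -> R) :
  (forall i, measurable_fun setT (fun s => f s i)) ->
  (forall i, measurable_fun setT (fun s => g s i)) ->
  (forall (s : seq I) (B : I -> set R), (forall i, measurable (B i)) ->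
     P [set t | forall i, i \in s -> B i (f t i)] =
     P [set t | forall i, i \in s -> B i (g t i)]) ->
  forall B : set (cylT I), measurable B -> P (f @^-1` B) = P (g @^-1` B).
Proof.
move=> mf mg fg.
have mf' := measurable_cyl mf; have mg' := measurable_cyl mg.
pose X : {mfun T >-> cylT I} := HB.pack (f : T -> cylT I) (isMeasurableFun.Build _ _ _ _ _ mf').
pose Y : {mfun T >-> cylT I} := HB.pack (g : T -> cylT I) (isMeasurableFun.Build _ _ _ _ _ mg').
pose C := [set A : set (cylT I) | exists (s : seq I) (B : I -> set R),
  (forall i, measurable (B i)) /\ A = [set v | forall i, i \in s -> B i (v i)]].
have CT : C setT.
  exists [::], (fun=> setT); split; first by [].
  by apply/esym/seteqP; split => // v _ i; rewrite in_nil.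
have mC A : C A -> measurable A.
  move=> [s [B [mB ->]]].
  rewrite (_ : [set _ | _] = \bigcap_(i in [set` s]) [set v : cylT I | B i (v i)]).
    apply: fin_bigcap_measurable => [|i _]; first exact: finite_seq.
    have := @measurable_coord I i measurableT (B i) (mB i).
    by rewrite setTI.
  by apply/seteqP; split => v h i /h.
apply: (measure_unique C (fun=> setT) _ _ _ _ (distribution P X) (distribution P Y)) => //.
- apply/seteqP; split => [A|A].
  + apply: smallest_sub; first exact: smallest_sigma_algebra.
    move=> _ [i [B [mB ->]]]; apply: sub_sigma_algebra.
    exists [:: i], (fun=> B); split=> //.
    apply/seteqP; split => v /=; first by move=> h j; rewrite inE => /eqP ->.
    by move=> /(_ i); apply; rewrite inE.
  + by apply: smallest_sub; [exact: sigma_algebra_measurable|exact: mC].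
- move=> _ _ [s [A [mA ->]]] [s' [A' [mA' ->]]].
  exists (s ++ s'), (fun i => [set x | (i \in s -> A i x) /\ (i \in s' -> A' i x)]).
  split.
    move=> i; case: (i \in s); case: (i \in s').
    + rewrite (_ : [set _ | _] = A i `&` A' i); first exact: measurableI.
      by apply/seteqP; split => x /=; [move=> [h1 h2]; split; auto|move=> [h1 h2]; split].
    + rewrite (_ : [set _ | _] = A i) //.
      by apply/seteqP; split => x /=; [move=> [h1 h2]; auto|move=> h1; split].
    + rewrite (_ : [set _ | _] = A' i) //.
      by apply/seteqP; split => x /=; [move=> [h1 h2]; auto|move=> h1; split].
    + rewrite (_ : [set _ | _] = setT) //.
      by apply/seteqP; split => x.
  apply/seteqP; split => v /=.
    by move=> [h1 h2] i _; split; auto.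
  move=> h; split => i si; first by apply (h i); rewrite // mem_cat si.
  by apply (h i); rewrite // mem_cat si orbT.
- by apply/seteqP; split => // v _; exists 0%N.
- by move=> A [s [B [mB ->]]]; exact: fg.
- by move=> _; apply: le_lt_trans (ltry 1); exact: (@probability_le1 _ _ _ (distribution P X)).
Qed.

(** For fixed [B], both [P (A & B)] and [P B * P A] are finite measures in [A]. They agree on finite
    intersections of sets from the factors in [J], a pi-system, hence on the generated
    sigma-algebra. *)
Lemma indep_group (I : eqType) (F : I -> set (set T)) (J : set I) (i0 : I) :
  mutually_independent P F -> (forall i, F i `<=` measurable) ->
  (forall i, F i setT) -> (forall i, setI_closed (F i)) -> ~ J i0 ->
  forall A B, <<s \bigcup_(j in J) F j >> A -> F i0 B ->
    P (A `&` B) = (P A * P B)%E.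
Proof.
move=> indep mF FT FI nJ A B sA FB.
have mB := mF _ _ FB.
pose C := [set A : set T | exists (s : seq I) (D : I -> set T), [/\ uniq s,
   forall i, i \in s -> J i, forall i, F i (D i) &
   A = \bigcap_(i in [set` s]) D i]].
have CT : C setT.
  exists [::], (fun=> setT); split => //.
  by apply/esym/seteqP; split => // v _ i; rewrite in_nil.
have mC A' : C A' -> measurable A'.
  move=> [s [D [_ _ FD ->]]]; apply: fin_bigcap_measurable => [|i _].
    exact: finite_seq.
  exact: mF (FD i).
have sC : <<s \bigcup_(j in J) F j >> `<=` <<s C >>.
  apply: sub_sigma_algebra2 => D [j Jj FD].
  exists [:: j], (fun i => if i == j then D else setT); split => //.
  - by move=> i; rewrite inE => /eqP ->.
  - by move=> i; case: eqP => [->|].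
  - apply/seteqP; split => v /=; first by move=> h i; rewrite /= inE => ->.
    by move=> /(_ j); rewrite /= inE eqxx; apply.
have PB0 : 0 <= fine (P B) by rewrite fine_ge0.
have PBE : (fine (P B))%:E = P B by rewrite fineK// fin_num_measure.
pose m1 : {measure set T -> \bar R} := mrestr P mB.
pose m2 : {measure set T -> \bar R} := mscale (NngNum PB0) P.
have : m1 A = m2 A.
  apply: (g_sigma_algebra_measure_unique C mC (fun=> setT)) => //.
  - by apply/seteqP; split => // v _; exists 0%N.
  - move=> _ _ [s [D [us sJ FD ->]]] [s' [D' [us' sJ' FD' ->]]].
    exists (undup (s ++ s')), (fun i => (if i \in s then D i else setT) `&`
      (if i \in s' then D' i else setT)); split.
    + exact: undup_uniq.
    + by move=> i; rewrite mem_undup mem_cat => /orP[/sJ|/sJ'].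
    + by move=> i; apply: FI; case: ifP.
    + apply/seteqP; split => v /=.
        move=> [h1 h2] i _; split.
          by case: ifP => // si; exact: h1.
        by case: ifP => // si; exact: h2.
      move=> h; split => i si.
        have /= := h i; rewrite mem_undup mem_cat si => /(_ isT) [] //.
      have /= := h i; rewrite mem_undup mem_cat si orbT => /(_ isT) [] //.
  - move=> _ [s [D [us sJ FD ->]]].
    rewrite /m1 /m2 /= /mrestr /mscale /= PBE.
    pose D' i := if i == i0 then B else D i.
    have i0s : i0 \notin s by apply/negP => /sJ.
    have DD' i : i \in s -> D' i = D i.
      by move=> si; rewrite /D' ifN//; apply: contraNneq i0s => <-.
    have -> : \bigcap_(i in [set` s]) D i `&` B = \bigcap_(i in [set` i0 :: s]) D' i.
      apply/seteqP; split => v /=.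
        move=> [h1 h2] i; rewrite /= inE /D'; case: eqP => //= _ si; exact: h1.
      move=> h; split; last by have := h i0; rewrite /= inE /D' eqxx; apply.
      by move=> i si; rewrite -DD'//; apply: h; rewrite /= inE si orbT.
    rewrite !indep//.
    + by rewrite big_cons {1}/D' eqxx; congr (_ * _)%E; apply: eq_big_seq => i /DD' ->.
    + by rewrite /= i0s.
    + by move=> i _; rewrite /D'; case: eqP => [->|].
  - by move=> _; rewrite /m1 /= /mrestr setTI ltey_eq fin_num_measure.
  - exact: sC.
by rewrite /m1 /m2 /= /mrestr /mscale /= PBE muleC.
Qed.

End Transfer.

(** * Measurability of a process at a random time *)

Section Measurability.
Context (R : realType) (d : measure_display) (S : measurableType d).

Lemma measurable_preimage_count (C : countType) (f : S -> C) (B : set C) :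
  (forall z, measurable (f @^-1` [set z])) -> measurable (f @^-1` B).
Proof.
move=> mf.
rewrite (_ : f @^-1` B = \bigcup_n
   (if unpickle n is Some z then [set s | f s = z /\ B z] else set0)); last first.
  apply/seteqP; split => s /=.
    by move=> Bs; exists (pickle (f s)) => //; rewrite pickleK.
  by move=> [n _]; case: unpickle => // z [-> ].
apply: bigcupT_measurable => n; case: unpickle => [z|]; last exact: measurable0.
have [Bz|Bz] := pselect (B z).
  rewrite (_ : [set _ | _] = f @^-1` [set z]); first exact: mf.
  by apply/seteqP; split => s //= [].
rewrite (_ : [set _ | _] = set0); first exact: measurable0.
by apply/seteqP; split => s //= [].
Qed.

Lemma measurable_count_case (C : countType) (f : S -> C) (g : C -> S -> R) :
  (forall z, measurable (f @^-1` [set z])) ->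
  (forall z, measurable_fun setT (g z)) -> measurable_fun setT (fun s => g (f s) s).
Proof.
move=> mf mg _ B mB; rewrite setTI.
rewrite (_ : _ @^-1` B = \bigcup_n
   (if unpickle n is Some z then f @^-1` [set z] `&` (g z) @^-1` B else set0)).
  apply: bigcupT_measurable => n; case: unpickle => [z|]; last exact: measurable0.
  by apply: measurableI => //; rewrite -[X in measurable X]setTI; exact: mg.
apply/seteqP; split => s /=.
  by move=> Bs; exists (pickle (f s)) => //; rewrite pickleK.
by move=> [n _]; case: unpickle => // z [/= -> ].
Qed.

(** The random time is approximated from the right by grid times, each taking countably many values;
    right continuity gives pointwise convergence of the path. *)
Lemma measurable_cadlag (path : S -> R -> R) (r : S -> R) :
  (forall s, cadlag (path s)) ->
  (forall u, 0 <= u -> measurable_fun setT (fun s => path s u)) ->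
  measurable_fun setT r -> (forall s, 0 <= r s) ->
  measurable_fun setT (fun s => path s (r s)).
Proof.
move=> cad mpath mr r0.
pose N (m : nat) s := Num.truncn (r s * m.+1%:R).
(* The successor keeps [rm m s] strictly above [r s], as the punctured limit at [r^'+] demands. *)
pose rm (m : nat) s : R := (N m s).+1%:R / m.+1%:R.
have m0 (m : nat) : 0 < m.+1%:R :> R by [].
have NP m s : (N m s)%:R <= r s * m.+1%:R < (N m s).+1%:R.
  by rewrite /N truncn_itv// mulr_ge0.
refine (@measurable_fun_cvg _ _ _ setT (fun m s => path s (rm m s)) (fun s => path s (r s)) _ _).
- move=> m.
  apply: (measurable_count_case (f := N m) (g := fun n s => path s (n.+1%:R / m.+1%:R))).
    move=> n.
    rewrite (_ : _ @^-1` _ = [set s | n%:R <= r s * m.+1%:R] `&`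
                             [set s | r s * m.+1%:R < n.+1%:R]).
      apply: measurableI; rewrite -[X in measurable X]setTI.
        by apply: measurable_fun_ler => //; exact: measurable_funM.
      by apply: measurable_fun_ltr => //; exact: measurable_funM.
    apply/seteqP; split => s /=; first by move=> <-; apply/andP; exact: NP.
    by move=> [h1 h2]; apply: truncn_def; rewrite h1 h2.
  by move=> n; apply: mpath; rewrite divr_ge0.
- move=> s _ /=.
  have [/(_ _ (r0 s))/cvg_at_rightP rc _] := cad s.
  have rmP m : r s < rm m s <= r s + m.+1%:R^-1.
    have /andP[h1 h2] := NP m s.
    rewrite /rm ltr_pdivlMr// h2 ler_pdivrMr// mulrDl mulVf ?gt_eqF//.
    by rewrite -natr1 lerD2r.
  apply: (rc (fun m => rm m s)); split.
    by move=> m; have /andP[] := rmP m.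
  apply: (@squeeze_cvgr _ _ _ _ (fun=> r s) (fun m => r s + m.+1%:R^-1)).
  - by apply: nearW => m; have /andP[/ltW -> ->] := rmP m.
  - exact: cvg_cst.
  - rewrite -[X in _ --> X]addr0; apply: cvgD; first exact: cvg_cst.
    exact: cvg_harmonic.
Qed.

End Measurability.

(** * The model *)

Section Model.
Context (R : realType) (d : measure_display) (T : measurableType d).
Variable P : probability T R.
Variables (xi : nat -> T -> int) (w : int -> T -> R) (tau : int -> nat -> T -> R -> R).

Definition factor (i : idx) : set (set T) := match i with
  | inl (inl k) => gen_sigma_int (xi k)
  | inl (inr _) => gen_sigma setT w
  | inr (x, k) => gen_sigma [set r | 0 <= r] (fun r t => tau x k t r)
  end.

(** The hypotheses of the theorem with [p_lambda lam] abstracted to [p]; positivity of [lam]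
    survives in the bounds [p01]. *)
Record rw_model (p : R) : Prop := RWModel {
  p01 : 2^-1 < p < 1;
  mxi : forall k (z : int), measurable (xi k @^-1` [set z]);
  Pxi1 : forall k, P (xi k @^-1` [set 1%Z]) = p%:E;
  PxiN1 : forall k, P (xi k @^-1` [set (-1)%Z]) = (1 - p)%:E;
  mw : forall x, measurable_fun setT (w x);
  w_gt0 : forall x t, 0 < w x t;
  w_erg : stationary_ergodic P w;
  mtau : forall x k r, 0 <= r -> measurable_fun setT (fun t => tau x k t r);
  tau_cadlag : forall x k t, cadlag (tau x k t);
  tau_law : forall x k x' k',
    same_law P (fun t (r : {r : R | 0 <= r}) => tau x k t (sval r))
               (fun t (r : {r : R | 0 <= r}) => tau x' k' t (sval r));
  tau_mean : forall x k r, 0 <= r -> P.-integrable setT (fun t => (tau x k t r)%:E) /\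
    (\int[P]_t (tau x k t r)%:E = r%:E)%E;
  indep : mutually_independent P factor
}.

Variable p : R.
Hypothesis M : rw_model p.

Lemma factor_sigma i : sigma_algebra setT (factor i).
Proof. by move: i => [[k|u]|[x k]]; exact: smallest_sigma_algebra. Qed.

Lemma factor_measurable i : factor i `<=` measurable.
Proof.
move: i => [[k|u]|[x k]]; apply: smallest_sub; try exact: sigma_algebra_measurable.
- by move=> _ [z ->]; exact: (mxi M).
- by move=> _ [x [B [_ mB ->]]]; rewrite -[X in measurable X]setTI; exact: (mw M).
- by move=> _ [r [B [r0 mB ->]]]; rewrite -[X in measurable X]setTI; exact: (mtau M).
Qed.

Lemma factorT i : factor i setT.
Proof.
by have [h0 hD _] := factor_sigma i; rewrite -(setD0 setT); exact: hD.
Qed.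

Lemma factorI i : setI_closed (factor i).
Proof.
have := sigma_algebra_id (factor_sigma i) => E A B FA FB; rewrite -E.
apply: (@measurableI _ (g_sigma_algebraType (factor i))); exact: sub_sigma_algebra.
Qed.

(** The sample space with the sigma-algebra of the factors in [J]; the identity into it is the
    random variable that carries their information. *)
Definition TJ (J : set idx) := g_sigma_algebraType (\bigcup_(j in J) factor j).

Definition Jmeas (J : set idx) (f : T -> R) : Prop :=
  measurable_fun [set: TJ J] (f : TJ J -> R).

Lemma measurable_TJ J (A : set T) :
  measurable (A : set (TJ J)) -> measurable (A : set T).
Proof.
apply: smallest_sub; first exact: sigma_algebra_measurable.
by move=> B [j _]; exact: factor_measurable.
Qed.

Lemma TJ_sub J J' (A : set T) : J `<=` J' ->
  measurable (A : set (TJ J)) -> measurable (A : set (TJ J')).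
Proof.
move=> JJ'; apply: sub_sigma_algebra2 => B [j Jj FB].
by exists j => //; exact: JJ'.
Qed.

Lemma Jmeas_sub J J' f : J `<=` J' -> Jmeas J f -> Jmeas J' f.
Proof. by move=> JJ' mf _ B mB; apply: (TJ_sub JJ'); exact: mf. Qed.

Lemma Jmeas_measurable J f : Jmeas J f -> measurable_fun setT f.
Proof. by move=> mf _ B mB; apply: (@measurable_TJ J); exact: mf. Qed.

Lemma factor_TJ J i (A : set T) : J i -> factor i A -> measurable (A : set (TJ J)).
Proof. by move=> Ji FA; apply: sub_sigma_algebra; exists i. Qed.

Lemma TJ1_factor i (A : set T) : measurable (A : set (TJ [set i])) -> factor i A.
Proof.
apply: smallest_sub; first exact: factor_sigma.
by move=> B [j ->].
Qed.

Lemma Jmeas_xi_eq J k (z : int) : J (inl (inl k)) ->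
  measurable (xi k @^-1` [set z] : set (TJ J)).
Proof.
by move=> Jk; apply: (factor_TJ Jk); apply: sub_sigma_algebra; exists z.
Qed.

Lemma Jmeas_xi J k (h : int -> R) : J (inl (inl k)) -> Jmeas J (fun t => h (xi k t)).
Proof.
move=> Jk _ B mB; rewrite setTI.
apply: (@measurable_preimage_count _ (TJ J) int (xi k) (h @^-1` B)).
by move=> z; exact: Jmeas_xi_eq.
Qed.

Lemma Jmeas_w J x : J (inl (inr tt)) -> Jmeas J (w x).
Proof.
move=> Jw _ B mB; rewrite setTI; apply: (factor_TJ Jw).
by apply: sub_sigma_algebra; exists x, B.
Qed.

Lemma Jmeas_tau J x k r : J (inr (x, k)) -> 0 <= r -> Jmeas J (fun t => tau x k t r).
Proof.
move=> Jt r0 _ B mB; rewrite setTI; apply: (factor_TJ Jt).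
by apply: sub_sigma_algebra; exists r, B.
Qed.

Lemma max0_ge0 (r : R) : 0 <= Num.max r 0.
Proof. by rewrite le_max lexx orbT. Qed.

Lemma Jmeas_tauW J x k (W : T -> R) : J (inr (x, k)) -> Jmeas J W ->
  Jmeas J (fun t => tau x k t (Num.max (W t) 0)).
Proof.
move=> Jt mW; apply: (@measurable_cadlag _ _ (TJ J) (tau x k) (fun t => Num.max (W t) 0)).
- by move=> t; exact: (tau_cadlag M).
- by move=> r r0; exact: Jmeas_tau.
- by apply: measurable_maxr => //; exact: measurable_cst.
- by move=> t; exact: max0_ge0.
Qed.

(* Nothing is known about [tau] at negative times, hence the truncation. *)
Definition psi (phi : R -> R) (r : R) : R :=
  Ex P (fun t => phi (tau 0 0%N t (Num.max r 0))).

Definition test (phi : R -> R) := measurable_fun setT phi /\ forall r, 0 <= phi r <= 1.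

Lemma psi_tau phi x k r : test phi ->
  Ex P (fun t => phi (tau x k t (Num.max r 0))) = psi phi r.
Proof.
move=> [mphi _]; have r0 := max0_ge0 r.
apply: (Ex_eq_law (mtau M x k r0) (mtau M 0 0%N r0)) => // B mB.
pose u : {r : R | 0 <= r} := exist (fun r : R => is_true (0 <= r)) _ r0.
have same : same_law P _ _ := tau_law M x k 0 0%N.
have := same [set g | B (g u)].
by apply; apply: sub_sigma_algebra; exists u, B.
Qed.

Lemma psi01 phi r : test phi -> 0 <= psi phi r <= 1.
Proof.
move=> [mphi phi01]; have r0 := max0_ge0 r.
have b : bmf (fun t => phi (tau 0 0%N t (Num.max r 0))).
  by apply: bmf01 => //; apply: (measurableT_comp mphi); exact: (mtau M).
rewrite /psi Ex_ge0/= => [|t]; last by have /andP[] := phi01 (tau 0 0%N t (Num.max r 0)).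
rewrite -[leRHS](Ex_cst P); apply: Ex_le; [exact: bmf_intg|exact: intg_cst|].
by move=> t; have /andP[] := phi01 (tau 0 0%N t (Num.max r 0)).
Qed.

Lemma id_TJ J : measurable_fun [set: T] (id : T -> TJ J).
Proof. by move=> _ B mB; rewrite setTI; exact: (measurable_TJ mB). Qed.

Lemma TJ_indep J i (A B : set T) : ~ J i ->
  measurable (A : set (TJ J)) -> measurable (B : set (TJ [set i])) ->
  P (A `&` B) = (P A * P B)%E.
Proof.
move=> nJ mA mB; apply: (indep_group (indep M) factor_measurable factorT factorI nJ) => //.
exact: TJ1_factor.
Qed.

(** The process keeps the sigma-algebra of its own factor, so that Tonelli can be applied against
    anything independent of that factor. *)
Lemma measurable_joint x k :
  measurable_fun [set: R * TJ [set inr (x, k)]]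
    (fun z => tau x k z.2 (Num.max z.1 0)).
Proof.
apply: (@measurable_cadlag _ _ _ (fun z : R * TJ [set inr (x, k)] => tau x k z.2)
   (fun z => Num.max z.1 0)).
- by move=> z; exact: (tau_cadlag M).
- move=> r r0.
  have mt : Jmeas [set inr (x, k)] (fun t => tau x k t r) by exact: Jmeas_tau.
  by have := measurableT_comp mt (@measurable_snd _ _ R (TJ [set inr (x, k)])).
- by apply: measurable_maxr => //; exact: measurable_cst.
- by move=> z; exact: max0_ge0.
Qed.

(** [psi] is a partial integral, so its measurability is the second half of [integral_indep], used
    with a constant first variable, which is independent of everything. *)
Lemma measurable_psi phi : test phi -> measurable_fun setT (psi phi).
Proof.
move=> [mphi phi01].
have mF : measurable_fun [set: R * TJ [set inr (0, 0%N)]]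
    (fun z => (phi (tau 0 0%N z.2 (Num.max z.1 0)))%:E).
  apply/measurable_EFinP; apply: (measurableT_comp mphi).
  exact: measurable_joint.
have [] := @integral_indep R _ T P _ _ R (TJ [set inr (0, 0%N)]) (fun=> 0) id _
  (@measurable_cst _ _ T R setT 0) (@id_TJ _) _ mF.
- move=> A B mA mB.
  have [A0|A0] := pselect (A 0).
    by rewrite preimage_cst mem_set// setTI probability_setT mul1e.
  by rewrite preimage_cst memNset// set0I measure0 mul0e.
- by move=> z; rewrite lee_fin; have /andP[] := phi01 (tau 0 0%N z.2 (Num.max z.1 0)).
move=> _ mI; have := measurableT_comp (@fine_measurable R setT measurableT) mI.
exact.
Qed.

(** With the factors in [J] frozen, [W] is a fixed time and the fresh process contributes its mean
    [psi phi (W t)], whatever its indices. *)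
Lemma peel_tau J x k phi (U W : T -> R) : ~ J (inr (x, k)) -> test phi ->
  Jmeas J U -> Jmeas J W -> (forall t, 0 <= U t) ->
  Ex P (fun t => U t * phi (tau x k t (Num.max (W t) 0))) =
  Ex P (fun t => U t * psi phi (W t)).
Proof.
move=> nJ tphi mU mW U0; have [mphi phi01] := tphi.
pose F (z : TJ J * TJ [set inr (x, k)]) : \bar R :=
  (U z.1 * phi (tau x k z.2 (Num.max (W z.1) 0)))%:E.
have mF : measurable_fun setT F.
  apply/measurable_EFinP; apply: measurable_funM.
    exact: (measurableT_comp mU (@measurable_fst _ _ (TJ J) (TJ [set inr (x, k)]))).
  apply: (measurableT_comp mphi).
  have mWz : measurable_fun setT (fun z : TJ J * TJ [set inr (x, k)] => (W z.1, z.2)).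
    apply: measurable_fun_pair => //.
    exact: (measurableT_comp mW (@measurable_fst _ _ (TJ J) (TJ [set inr (x, k)]))).
  exact: (measurableT_comp (@measurable_joint x k) mWz).
have F0 z : (0 <= F z)%E.
  by rewrite lee_fin mulr_ge0//; have /andP[] := phi01 (tau x k z.2 (Num.max (W z.1) 0)).
have [] := integral_indep (@id_TJ J) (@id_TJ [set inr (x, k)])
  (fun A B mA mB => TJ_indep nJ mA mB) mF F0.
move=> E _; congr fine; rewrite E; apply: eq_integral => s _.
have b : bmf (fun t => phi (tau x k t (Num.max (W s) 0))).
  by apply: bmf01 => //; apply: (measurableT_comp mphi); exact: (mtau M) (max0_ge0 _).
rewrite /F/= -(psi_tau x k _ tphi) -ExZ; last exact: bmf_intg.
by rewrite Ex_fin//; apply/intgZ/bmf_intg.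
Qed.

Lemma peel_xi J k (h : int -> R) (U : T -> R) : ~ J (inl (inl k)) ->
  Jmeas J U -> intg P U -> (forall t, 0 <= U t) -> (forall z, 0 <= h z <= 1) ->
  Ex P (fun t => U t * h (xi k t)) = Ex P (fun t => h (xi k t)) * Ex P U.
Proof.
move=> nJ mU iU U0 h01.
have mh : Jmeas [set inl (inl k)] (fun t => h (xi k t)) by exact: Jmeas_xi.
pose F (z : TJ J * TJ [set inl (inl k)]) : \bar R := (U z.1 * h (xi k z.2))%:E.
have mF : measurable_fun setT F.
  apply/measurable_EFinP; apply: measurable_funM.
    exact: (measurableT_comp mU (@measurable_fst _ _ (TJ J) (TJ [set inl (inl k)]))).
  exact: (measurableT_comp mh (@measurable_snd _ _ (TJ J) (TJ [set inl (inl k)]))).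
have F0 z : (0 <= F z)%E.
  by rewrite lee_fin mulr_ge0//; have /andP[] := h01 (xi k z.2).
have [] := integral_indep (@id_TJ J) (@id_TJ [set inl (inl k)])
  (fun A B mA mB => TJ_indep nJ mA mB) mF F0.
move=> E _; rewrite /Ex /Rintegral E.
have b : bmf (fun t => h (xi k t)).
  by apply: bmf01 => //; exact: (Jmeas_measurable mh).
have E2 s : (\int[P]_t F (s, t) = (Ex P (fun t => h (xi k t)))%:E * (U s)%:E)%E.
  rewrite /F/= -EFinM mulrC -ExZ; last exact: bmf_intg.
  by rewrite Ex_fin//; apply/intgZ/bmf_intg.
have -> : (\int[P]_s \int[P]_t F (s, t) =
    \int[P]_s ((Ex P (fun t => h (xi k t)))%:E * (U s)%:E))%E.
  by apply: eq_integral => s _; exact: E2.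
rewrite ge0_integralZl//.
- by rewrite fineM//; exact: integrable_fin_num.
- exact/measurable_EFinP/(Jmeas_measurable mU).
- by move=> t _; rewrite lee_fin.
- by rewrite lee_fin Ex_ge0// => t; have /andP[] := h01 (xi k t).
Qed.

End Model.

(** * The walk in its environment and the Markov property *)

Section Walk.
Context (R : realType) (d : measure_display) (T : measurableType d).
Variable P : probability T R.
Variables (xi : nat -> T -> int) (w : int -> T -> R) (tau : int -> nat -> T -> R -> R).
Variable p : R.
Hypothesis M : rw_model P xi w tau p.
Local Notation Jm := (Jmeas xi w tau).

Definition pos (n : nat) t : int := \sum_(k < n) xi k t.
Definition hold k t : R := tau (pos k t) k t (w (pos k t) t).
Definition env t : int -> R := fun x => w x t.

Fixpoint good (l : seq ((int -> R) * (R -> R))) : Prop :=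
  if l is c :: l' then [/\ forall z, 0 <= c.1 z <= 1, test c.2 & good l'] else True.

Fixpoint prod_tests (l : seq ((int -> R) * (R -> R))) k t : R :=
  if l is c :: l' then c.1 (xi k t) * c.2 (hold k t) * prod_tests l' k.+1 t else 1.

(* Conditional expectation of [prod_tests l 0], for the walk started at [x],
   given the environment [g]. *)
Fixpoint value (l : seq ((int -> R) * (R -> R))) (x : int) (g : int -> R) : R :=
  if l is c :: l' then psi P tau c.2 (g x) *
    (p * c.1 1 * value l' (x + 1) g + (1 - p) * c.1 (-1) * value l' (x - 1) g)
  else 1.

(** The whole environment belongs to the past, so only steps and holding processes are ever
    integrated out. The processes with time index below [k] are included at all sites, since the
    site visited is random. *)
Definition past (k : nat) : set idx := [set i | match i with
  | inl (inl j) => (j < k)%N | inl (inr _) => True | inr (_, j) => (j < k)%N end].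

Lemma p_ge0 : 0 <= p. Proof. by have := p01 M; lra. Qed.
Lemma q_ge0 : 0 <= 1 - p. Proof. by have := p01 M; lra. Qed.

Lemma posS n t : pos n.+1 t = pos n t + xi n t.
Proof. by rewrite /pos big_ord_recr. Qed.

Lemma measurable_pos n (z : int) : measurable (pos n @^-1` [set z]).
Proof.
elim: n z => [|n IH] z.
  rewrite (_ : _ @^-1` _ = if z == 0 then setT else set0).
    by case: ifP => _; [exact: measurableT|exact: measurable0].
  apply/seteqP; split => t /=; rewrite /pos big_ord0; first by move=> <-; rewrite eqxx.
  by case: eqP.
rewrite (_ : _ @^-1` _ =
    (fun t => (pos n t, xi n t)) @^-1` [set u | u.1 + u.2 = z]); last first.
  by apply/seteqP; split => t /=; rewrite posS.
apply: measurable_preimage_count => -[a b].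
rewrite (_ : _ @^-1` _ = pos n @^-1` [set a] `&` xi n @^-1` [set b]).
  by apply: measurableI; [exact: IH|exact: (mxi M)].
by apply/seteqP; split => t /= [-> ->].
Qed.

Lemma measurable_hold k : measurable_fun setT (hold k).
Proof.
apply: (measurable_count_case (f := pos k) (g := fun z t => tau z k t (w z t))).
  exact: measurable_pos.
move=> z; apply: (measurable_cadlag (path := tau z k)).
- by move=> t; exact: (tau_cadlag M).
- by move=> r r0; exact: (mtau M).
- exact: (mw M).
- by move=> t; exact/ltW/(w_gt0 M).
Qed.

Lemma measurable_fun_xi k (h : int -> R) : measurable_fun setT (fun t => h (xi k t)).
Proof.
apply: (measurable_count_case (f := xi k) (g := fun z _ => h z)); first exact: (mxi M).
by move=> z; exact: measurable_cst.
Qed.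

Lemma prod_tests01 l k t : good l -> 0 <= prod_tests l k t <= 1.
Proof.
elim: l k => [|c l IH] k /=; first by rewrite ler01 lexx.
move=> [c1 [_ c2] /(IH k.+1)/andP[l0 l1]].
have /andP[a0 a1] := c1 (xi k t); have /andP[b0 b1] := c2 (hold k t).
by rewrite !mulr_ge0//= -[leRHS]mulr1 ler_pM ?mulr_ge0 ?mulr_ile1.
Qed.

Lemma measurable_prod_tests l k : good l -> measurable_fun setT (prod_tests l k).
Proof.
elim: l k => [|c l IH] k /=; first by move=> _; exact: measurable_cst.
move=> [c1 [mc2 _] gl]; apply: measurable_funM; last exact: IH.
apply: measurable_funM; first exact: measurable_fun_xi.
by apply: (measurableT_comp mc2); exact: measurable_hold.
Qed.

Lemma bmf_prod_tests l k : good l -> bmf (prod_tests l k).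
Proof.
move=> gl; apply: bmf01 => [|t]; first exact: measurable_prod_tests.
exact: prod_tests01.
Qed.

Lemma value01 l x g : good l -> 0 <= value l x g <= 1.
Proof.
elim: l x => [|c l IH] x /=; first by rewrite ler01 lexx.
move=> [c1 tc2 gl]; have /andP[a0 a1] := psi01 M (g x) tc2.
have /andP[l0 l1] := IH (x + 1) gl; have /andP[l0' l1'] := IH (x - 1) gl.
have /andP[e0 e1] := c1 1; have /andP[e0' e1'] := c1 (-1).
have q0 := q_ge0; have p0 := p_ge0.
have h1 : c.1 1 * value l (x + 1) g <= 1 by rewrite mulr_ile1.
have h2 : c.1 (-1) * value l (x - 1) g <= 1 by rewrite mulr_ile1.
have h1' : 0 <= c.1 1 * value l (x + 1) g by rewrite mulr_ge0.
have h2' : 0 <= c.1 (-1) * value l (x - 1) g by rewrite mulr_ge0.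
rewrite -!mulrA; apply/andP; split.
  by rewrite mulr_ge0// addr_ge0 // mulr_ge0.
by rewrite mulr_ile1//; nra.
Qed.

Lemma measurable_value_cyl l x : good l ->
  measurable_fun [set: cylT R int] (value l x).
Proof.
elim: l x => [|c l IH] x /=; first by move=> _; exact: measurable_cst.
move=> [c1 tc2 gl]; apply: measurable_funM.
  apply: (measurableT_comp (measurable_psi M tc2)); exact: measurable_coord.
by apply: measurable_funD; apply: measurable_funM => //; exact: IH.
Qed.

Lemma Jmeas_value J l x : good l -> J (inl (inr tt)) ->
  Jm J (fun t => value l x (env t)).
Proof.
move=> gl Jw; apply: (measurableT_comp (measurable_value_cyl x gl)).
by apply: measurable_cyl => i; exact: Jmeas_w.
Qed.

Lemma value_shift l x y g : value l (x + y) g = value l x (fun z => g (z + y)).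
Proof.
elim: l x => [|c l IH] x //=.
by rewrite -!IH addrAC [x - 1 + y]addrAC.
Qed.

Lemma xi_pm k : {ae P, forall t, xi k t = 1 \/ xi k t = -1}.
Proof.
pose A z := xi k @^-1` [set z].
have mA z : measurable (A z) by exact: (mxi M).
exists (~` (A 1 `|` A (-1))); split.
- by apply: measurableC; exact: measurableU.
- rewrite probability_setC; last exact: measurableU.
  rewrite measureU//; last by apply/seteqP; split => t //; rewrite /A /= => -[->].
  rewrite [X in (_ - (X + _))%E](Pxi1 M k) [X in (_ - (_ + X))%E](PxiN1 M k).
  change ((1 - (p + (1 - p)))%:E = 0%:E); congr EFin; ring.
- by move=> t /= h1 h2; apply: h1.
Qed.

Lemma Ex_xi k (z : int) : Ex P (fun t => (xi k t == z)%:R) =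
  if z == 1 then p else if z == -1 then 1 - p else 0.
Proof.
have E : (fun t => (xi k t == z)%:R : R) = \1_(xi k @^-1` [set z]).
  apply/funext => t; rewrite indicE; congr (_%:R); congr nat_of_bool.
  by apply/eqP/idP => [h|]; [rewrite inE|rewrite inE].
case: eqP => [z1|nz1].
  by apply: EFin_inj; rewrite E Ex_indic ?z1; [exact: (Pxi1 M)|exact: (mxi M)].
case: eqP => [z1|nz2].
  by apply: EFin_inj; rewrite E Ex_indic ?z1; [exact: (PxiN1 M)|exact: (mxi M)].
rewrite -[RHS](Ex_cst P); apply: Ex_ae.
- exact: (measurable_fun_xi _ (fun y => (y == z)%:R)).
- exact: measurable_cst.
- by apply: filterS (xi_pm k) => t /= [e|e]; rewrite e; case: eqP => // h;
    [case: nz1|case: nz2].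
Qed.

Lemma past_sub j k : (j <= k)%N -> past j `<=` past k.
Proof. by move=> jk [[i|u]|[x i]] //= ij; exact: leq_trans jk. Qed.

(* Given the past and [pos k = x], the step [xi k] and the process [tau x k] are
   fresh, so both can be integrated out. *)
Lemma markov l k x (U : T -> R) : good l -> Jm (past k) U ->
  (forall t, 0 <= U t <= 1) -> (forall t, U t != 0 -> pos k t = x) ->
  Ex P (fun t => U t * prod_tests l k t) =
  Ex P (fun t => U t * value l x (env t)).
Proof.
elim: l k x U => [//|c l IH] k x U /= [c1 tc2 gl] mU U01 Ux.
have [mc2 c201] := tc2.
pose ph t := c.2 (tau x k t (Num.max (w x t) 0)).
have phE t : ph t = c.2 (tau x k t (w x t)).
  by rewrite /ph max_l//; exact/ltW/(w_gt0 M).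
have ph01 t : 0 <= ph t <= 1 by exact: c201.
(* The weight for the induction hypothesis: it is measurable for [past k.+1] and pins the next
   position to [x + e]. *)
pose Ue (e : int) t := U t * ph t * (xi k t == e)%:R.
have sub : past k `<=` past k.+1 by exact: past_sub.
have mph : Jm (past k.+1) ph.
  apply: (measurableT_comp mc2); apply: (Jmeas_tauW M) => //=.
  exact: Jmeas_w.
have mUe e : Jm (past k.+1) (Ue e).
  apply: measurable_funM; first (apply: measurable_funM => //; exact: (Jmeas_sub sub)).
  by apply: (@Jmeas_xi R d T xi w tau (past k.+1) k (fun z => (z == e)%:R)) => /=.
have Ue01 e t : 0 <= Ue e t <= 1.
  have /andP[u0 u1] := U01 t; have /andP[v0 v1] := ph01 t; rewrite /Ue.
  by case: (xi k t == e); rewrite ?mulr1 ?mulr0 ?ler01 ?lexx// mulr_ge0// mulr_ile1.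
have Uex e t : Ue e t != 0 -> pos k.+1 t = x + e.
  rewrite /Ue !mulf_eq0 !negb_or => /andP[/andP[/Ux <- _]].
  by case: (xi k t =P e) => [<-|]; rewrite ?posS// eqxx.
have bJ J f : Jm J f -> (forall t, 0 <= f t <= 1) -> bmf f.
  by move=> mf f01; apply: bmf01 => //; exact: (Jmeas_measurable M mf).
have bUe e : bmf (Ue e) by exact: bJ (mUe e) (Ue01 e).
have iP e : intg P (fun t => Ue e t * prod_tests l k.+1 t).
  by apply/bmf_intg/bmfM => //; exact: bmf_prod_tests.
have bU : bmf U by exact: bJ mU U01.
have bV y l' : good l' -> bmf (fun t => value l' y (env t)).
  move=> gl'; apply: (bJ (past k)); first exact: Jmeas_value.
  by move=> t; exact: value01.
have step e : Ex P (fun t => Ue e t * value l (x + e) (env t)) =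
    Ex P (fun t => (xi k t == e)%:R) *
    Ex P (fun t => U t * value l (x + e) (env t) * psi P tau c.2 (w x t)).
  pose V t := value l (x + e) (env t).
  have V01 t : 0 <= V t <= 1 by exact: value01.
  have mV J : J (inl (inr tt)) -> Jm J V by exact: Jmeas_value.
  (* [J1] leaves out only the step [xi k] and [J2] only the process [tau x k]; they are integrated
     out in this order. *)
  pose J1 := [set i : idx | i <> inl (inl k)].
  pose J2 := [set i : idx | i <> inr (x, k)].
  have UV0 t : 0 <= U t * V t.
    by rewrite mulr_ge0//; [have /andP[] := U01 t|have /andP[] := V01 t].
  have UV1 t : U t * V t <= 1.
    by have /andP[? ?] := U01 t; have /andP[? ?] := V01 t; rewrite mulr_ile1.
  have s1 : past k `<=` J1.
    by move=> [[i|u]|[y i]] //= ik [E]; rewrite E ltnn in ik.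
  have s2 : past k `<=` J2.
    by move=> [[i|u]|[y i]] //= ik [_ E]; rewrite E ltnn in ik.
  have mA : Jm J1 (fun t => U t * V t * ph t).
    apply: measurable_funM.
      by apply: measurable_funM; [exact: (Jmeas_sub s1)|exact: mV].
    apply: (measurableT_comp mc2); apply: (Jmeas_tauW M) => //=.
    exact: Jmeas_w.
  have A01 t : 0 <= U t * V t * ph t <= 1.
    have /andP[? ?] := ph01 t.
    by rewrite mulr_ge0//= mulr_ile1.
  transitivity (Ex P (fun t => U t * V t * ph t * (xi k t == e)%:R)).
    by apply: eq_Ex => t; rewrite /Ue -/(V t); ring.
  rewrite (peel_xi M (J := J1) (h := fun z => (z == e)%:R) _ mA) //.
  + congr (_ * _).
    apply: (peel_tau M (J := J2) _ tc2 _ _ UV0) => //.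
      by apply: measurable_funM; [exact: (Jmeas_sub s2)|exact: mV].
    exact: Jmeas_w.
  + by apply: bmf_intg; exact: (bJ _ _ mA).
  + by move=> t; have /andP[] := A01 t.
  + by move=> z; case: eqP; rewrite ?ler01 ?lexx.
(* The split over the two steps holds only almost surely, because [xi k] is an arbitrary integer on
   a null set. *)
transitivity (Ex P (fun t => c.1 1 * (Ue 1 t * prod_tests l k.+1 t) +
    c.1 (-1) * (Ue (-1) t * prod_tests l k.+1 t))).
  apply: Ex_ae.
  - apply: measurable_funM; first exact: (Jmeas_measurable M mU).
    by apply: (measurable_prod_tests (l := c :: l)).
  - apply: measurable_funD; apply: measurable_funM => //;
      by apply/measurable_EFinP/measurable_int/iP.
  - apply: filterS (xi_pm k) => t xit.
    have [U0|/Ux ykx] := eqVneq (U t) 0; first by rewrite /Ue U0; ring.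
    rewrite /Ue phE {1}/hold ykx.
    by case: xit => -> /=; ring.
rewrite ExD ?ExZ//; try exact: intgZ.
rewrite !(IH k.+1 _ _ gl (mUe _) (Ue01 _) (Uex _)) !step !Ex_xi /=.
have iS y : intg P (fun t => U t * value l y (env t) * psi P tau c.2 (w x t)).
  apply: bmf_intg; apply: bmfM; first by apply: bmfM; [exact: bU|exact: bV].
  apply: (bJ setT) => [|t]; last exact: (psi01 M).
  by apply: (measurableT_comp (measurable_psi M tc2)); exact: Jmeas_w.
rewrite [RHS](_ : _ = Ex P (fun t =>
    (c.1 1 * p) * (U t * value l (x + 1) (env t) * psi P tau c.2 (w x t)) +
    (c.1 (-1) * (1 - p)) * (U t * value l (x - 1) (env t) * psi P tau c.2 (w x t)))).
  by rewrite ExD ?ExZ//; [ring|exact: intgZ|exact: intgZ].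
by apply: eq_Ex => t; rewrite /env; ring.
Qed.

End Walk.

(** * Shift invariance of the limsup event *)

Section LimsupShift.
Context (R : realType).
Implicit Types (u : nat -> R) (a : R).

Definition limsup_above u a := exists j : nat, forall N,
  exists2 n, (N <= n)%N & (a + j.+1%:R^-1) * n%:R < \sum_(i < n) u i.

(** Dropping the first term changes the sum by at most one and the threshold by one multiple of the
    level; half of the margin absorbs both for large [n]. The equivalence holds for every sequence,
    since the zero-one law is assumed for strictly invariant sets. *)
Lemma limsup_above_shift u a : (forall i, 0 <= u i <= 1) ->
  limsup_above (fun i => u i.+1) a <-> limsup_above u a.
Proof.
move=> u01.
(* The index [(2 * j).+1] stands for half the margin: [(2 * j).+2 = 2 * j.+1]. *)
have half j : (2 * j).+1.+1%:R^-1 = j.+1%:R^-1 / 2 :> R.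
  by rewrite -invfM -natrM; congr (_^-1); congr (_%:R); lia.
have e0 j : 0 < j.+1%:R^-1 :> R by rewrite invr_gt0.
have big (b e : R) : 0 < e -> exists N0 : nat, forall n, (N0 <= n)%N -> b <= e * n%:R.
  move=> e_gt0; exists (Num.truncn (b / e)).+1 => n Nn.
  rewrite mulrC -ler_pdivrMr// ltW//; apply: lt_le_trans (truncnS_gt _) _.
  by rewrite ler_nat.
split=> -[j hj].
- exists (2 * j).+1 => N.
  have [N0 hN0] := big (a + j.+1%:R^-1 / 2) (j.+1%:R^-1 / 2) (divr_gt0 (e0 j) (ltr0Sn _ _)).
  have [n nN hn] := hj (maxn N N0); move: nN; rewrite geq_max => /andP[nN nN0].
  exists n.+1; first exact: leqW.
  rewrite big_ord_recl half -[n.+1%:R]natr1; under eq_bigr do rewrite lift0.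
  have /andP[u0 _] := u01 0%N; have := hN0 n nN0; move: hn.
  set s := \sum_(_ < _) _; set e := j.+1%:R^-1 => h1 h2.
  change (u ord0) with (u 0%N). lra.
- exists (2 * j).+1 => N.
  have [N0 hN0] := big (1 - a) (j.+1%:R^-1 / 2) (divr_gt0 (e0 j) (ltr0Sn _ _)).
  have [[//|n] nN hn] := hj (maxn N N0).+1; move: nN; rewrite ltnS geq_max => /andP[nN nN0].
  exists n => //; move: hn.
  rewrite big_ord_recl half -[n.+1%:R]natr1; under eq_bigr do rewrite lift0.
  have /andP[_ u1] := u01 0%N; have := hN0 n nN0; have := e0 j.
  set s := \sum_(_ < _) _; set e := j.+1%:R^-1 => h0 h1 h2.
  change (u ord0) with (u 0%N) in h2; lra.
Qed.

Lemma measurable_limsup_above d (S : measurableType d) (u : nat -> S -> R) a :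
  (forall i, measurable_fun setT (u i)) -> measurable [set s | limsup_above (u ^~ s) a].
Proof.
move=> mu.
rewrite (_ : [set _ | _] = \bigcup_j \bigcap_N \bigcup_(n in [set n | (N <= n)%N])
   [set s | (a + j.+1%:R^-1) * n%:R < \sum_(i < n) u i s]).
  apply: bigcupT_measurable => j; apply: bigcapT_measurable => N.
  apply: bigcup_measurable => n _.
  rewrite -[X in measurable X]setTI; apply: measurable_fun_ltr => //.
  exact: (measurable_sum _ (fun i : 'I_n => mu i)).
apply/seteqP; split => s /=.
  by move=> [j hj]; exists j => // N _; have [n nN hn] := hj N; exists n.
by move=> [j _ hj]; exists j => N; have [n nN hn] := hj N I; exists n.
Qed.

End LimsupShift.

(** * Stationarity of the environment and of the observed pairs *)

Section Stationarity.
Context (R : realType) (d : measure_display) (T : measurableType d).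
Variable P : probability T R.
Variables (xi : nat -> T -> int) (w : int -> T -> R) (tau : int -> nat -> T -> R -> R).
Variable p : R.
Hypothesis M : rw_model P xi w tau p.
Local Notation hold := (hold xi w tau).
Local Notation env := (env w).
Local Notation prod_tests := (prod_tests xi w tau).
Local Notation value := (value P tau p).

Definition shift_env (y : int) (g : int -> R) : int -> R := fun z => g (z + y).

Lemma measurable_shift_env y :
  measurable_fun [set: cylT R int] (shift_env y : cylT R int -> cylT R int).
Proof. by apply: measurable_cyl => i; exact: measurable_coord. Qed.

Lemma measurable_env : measurable_fun setT (env : T -> cylT R int).
Proof. by apply: measurable_cyl => i; exact: (mw M). Qed.

(** Nonnegative shifts follow by iterating the one-step invariance; a negative shift is undone by
    applying the positive case to the shifted event. *)
Lemma env_law y (B : set (cylT R int)) : measurable B ->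
  P [set t | B (shift_env y (env t))] = P [set t | B (env t)].
Proof.
have shift_nat (n : nat) (C : set (cylT R int)) : measurable C ->
    P [set t | C (shift_env n%:Z (env t))] = P [set t | C (env t)].
  elim: n C => [|n IH] C mC.
    congr (P _); apply/seteqP; split => t /=;
      by rewrite (_ : shift_env _ _ = env t)//; apply/funext => z; rewrite /shift_env addr0.
  rewrite -IH//; pose C' := [set g : cylT R int | C (shift_env n%:Z g)].
  have mC' : measurable C'.
    by have := @measurable_shift_env n%:Z measurableT C mC; rewrite setTI.
  have [/(_ C' mC') E _] := w_erg M.
  transitivity (P ((@shiftZ R \o (fun t x => w x t)) @^-1` C')); last exact: (esym E).
  congr (P _); apply/seteqP; split => t; rewrite /C' /=;
    rewrite (_ : shift_env n.+1%:Z _ = shift_env n%:Z (shiftZ (env t)))//;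
    by apply/funext => z; rewrite /shift_env /shiftZ -addrA -PoszD addn1.
move=> mB; case: (intP y) => [|n|n]; [exact: (shift_nat 0%N)|exact: (shift_nat n.+1)|].
have mB' : measurable [set g : cylT R int | B (shift_env (- n.+1%:Z) g)].
  by have := @measurable_shift_env (- n.+1%:Z) measurableT B mB; rewrite setTI.
rewrite -(shift_nat n.+1 _ mB'); congr (P _); apply/seteqP; split => t /=;
  by rewrite (_ : shift_env _ (shift_env _ _) = env t)//;
     apply/funext => z; rewrite /shift_env addrNK.
Qed.

Lemma Ex_shift_env y (h : cylT R int -> R) : measurable_fun setT h ->
  Ex P (fun t => h (shift_env y (env t))) = Ex P (fun t => h (env t)).
Proof.
move=> mh; apply: (@Ex_eq_law _ _ _ P _ (cylT R int) (fun t => shift_env y (env t)) env h) => //.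
- exact: (measurableT_comp (@measurable_shift_env y) measurable_env).
- exact: measurable_env.
- by move=> B mB; exact: env_law.
Qed.

(** The pointwise ergodic theorem for [w]. Its limsup events are preimages of strictly
    shift-invariant sets of environments, to which the zero-one property applies. *)
Theorem env_average (h : cylT R int -> R) : measurable_fun setT h ->
  (forall g, 0 <= h g <= 1) ->
  {ae P, forall t, (fun n => (\sum_(i < n) h (shift_env i%:Z (env t))) / n%:R) @ \oo -->
     Ex P (fun t => h (env t))}.
Proof.
move=> mh h01.
have mH (f : cylT R int -> R) k : measurable_fun setT f ->
    measurable_fun setT (fun g : cylT R int => f (shift_env k g)).
  by move=> mf; exact: (measurableT_comp mf (@measurable_shift_env k)).
have shiftD (a b : int) g : shift_env a (shift_env b g) = shift_env (a + b) g.
  by apply/funext => z; rewrite /shift_env addrA.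
have stat (f : cylT R int -> R) : measurable_fun setT f ->
    exceeds_stationary P (fun k t => f (shift_env k%:Z (env t))).
  move=> mf a n k.
  pose B := [set g : cylT R int | exceeds (fun i : nat => f (shift_env i%:Z g)) a n 0].
  have mB : measurable B by apply: measurable_exceeds => i; exact: mH.
  rewrite -[RHS](env_law k mB); congr (P _).
  have E t : exceeds (fun k => f (shift_env k%:Z (env t))) a n k =
      exceeds (fun i : nat => f (shift_env i%:Z (shift_env k%:Z (env t)))) a n 0.
    by apply: eq_exceeds => i; rewrite shiftD addrC.
  by apply/seteqP; split => t /=; rewrite /B/= E.
have zero_one (f : cylT R int -> R) a : measurable_fun setT f -> (forall g, 0 <= f g <= 1) ->
    measurable (limsup_gt (fun (k : nat) t => f (shift_env k%:Z (env t))) a) /\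
    (P (limsup_gt (fun (k : nat) t => f (shift_env k%:Z (env t))) a) = 0%E \/
     P (limsup_gt (fun (k : nat) t => f (shift_env k%:Z (env t))) a) = 1%E).
  move=> mf f01.
  pose B := [set g : cylT R int | limsup_above (fun i : nat => f (shift_env i%:Z g)) a].
  have mB : measurable B by apply: measurable_limsup_above => i; exact: mH.
  split.
    have := @measurable_env measurableT B mB; rewrite setTI; exact.
  have [_ +] := w_erg M; move=> /(_ B mB); apply.
  apply/seteqP; split => g; rewrite /B/= => hg.
    apply/(limsup_above_shift a (fun i => f01 (shift_env i%:Z g))).
    have E i : shift_env i.+1%:Z g = shift_env i%:Z (shiftZ g).
      by apply/funext => z; rewrite /shift_env /shiftZ -addrA -PoszD addn1.
    by under eq_fun do rewrite E.
  have E i : shift_env i%:Z (shiftZ g) = shift_env i.+1%:Z g.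
    by apply/funext => z; rewrite /shift_env /shiftZ -addrA -PoszD addn1.
  under eq_fun do rewrite E.
  by apply/(limsup_above_shift a (fun i => f01 (shift_env i%:Z g))).
have mh' : measurable_fun setT (fun g : cylT R int => 1 - h g) by exact: measurable_funB.
have h01' g : 0 <= 1 - h g <= 1 by have := h01 g; lra.
have := @ergodic_average R d T P (fun k t => h (shift_env k%:Z (env t))).
rewrite Ex_shift_env//; apply.
- by move=> k; exact: (measurableT_comp (mH h k mh) measurable_env).
- by move=> k t; exact: h01.
- by move=> k; rewrite !Ex_shift_env.
- exact: stat.
- exact: (stat _ mh').
- by move=> a; exact: zero_one.
- by move=> a; exact: (zero_one _ a mh' h01').
Qed.

Lemma Ex_prod_tests0 l : good l ->
  Ex P (prod_tests l 0%N) = Ex P (fun t => value l 0 (env t)).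
Proof.
move=> gl; transitivity (Ex P (fun t => 1 * prod_tests l 0%N t)).
  by apply: eq_Ex => t; rewrite mul1r.
transitivity (Ex P (fun t => 1 * value l 0 (env t))); last first.
  by apply: eq_Ex => t; rewrite mul1r.
apply: (markov M gl) => [|t|t _]; first exact: measurable_cst.
- by rewrite ler01 lexx.
- by rewrite /pos big_ord0.
Qed.

(** Prepending this pair lets one time unit pass without constraint; on [value] it acts as the
    transition operator of the walk. *)
Definition free : (int -> R) * (R -> R) := (fun=> 1, fun=> 1).

Lemma good_free l : good l -> good (free :: l).
Proof.
by move=> gl /=; split => // [z|]; [rewrite ler01 lexx|
  split => [|r]; [exact: measurable_cst|rewrite ler01 lexx]].
Qed.

Lemma value_free l x g :
  value (free :: l) x g = p * value l (x + 1) g + (1 - p) * value l (x - 1) g.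
Proof. by rewrite /= /psi Ex_cst mul1r !mulr1. Qed.

Lemma Ex_value_shift l x : good l ->
  Ex P (fun t => value l x (env t)) = Ex P (fun t => value l 0 (env t)).
Proof.
move=> gl; rewrite -(Ex_shift_env x (measurable_value_cyl M 0 gl)).
by apply: eq_Ex => t; rewrite -[x in LHS]add0r value_shift.
Qed.

Lemma bmf_value l x : good l -> bmf (fun t => value l x (env t)).
Proof.
move=> gl; apply: bmf01 => [|t]; last exact: (value01 M).
exact: (measurableT_comp (measurable_value_cyl M x gl) measurable_env).
Qed.

(** Starting one unit later amounts to prepending [free]. Its value is the mean of the values at the
    two neighbouring sites, and these have equal expectations by stationarity of the environment. *)
Lemma Ex_prod_tests l k : good l -> Ex P (prod_tests l k) = Ex P (prod_tests l 0%N).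
Proof.
have freeE l' k' t : prod_tests l' k'.+1 t = prod_tests (free :: l') k' t.
  by rewrite /= !mul1r.
elim: k l => [//|k IH] l gl.
rewrite (eq_Ex _ (freeE l k)) IH; last exact: good_free.
rewrite !Ex_prod_tests0//; last exact: good_free.
have iv x : intg P (fun t => value l x (env t)) by exact/bmf_intg/bmf_value.
rewrite (eq_Ex _ (fun t => value_free l 0 (env t))) ExD ?ExZ//; try exact: intgZ.
by rewrite !Ex_value_shift//; ring.
Qed.

(** Steps and holding times from time [k] on, packed into one real family so that the cylinder
    machinery applies; the flag [true] selects holding times. *)
Definition obs (k : nat) (t : T) : nat * bool -> R := fun i =>
  if i.2 then hold (k + i.1) t else (xi (k + i.1) t)%:~R.

Definition shift_obs (n : nat) (g : nat * bool -> R) : nat * bool -> R :=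
  fun i => g ((n + i.1)%N, i.2).

Lemma obsD k n t : obs (k + n) t = shift_obs n (obs k t).
Proof. by apply/funext => -[i b]; rewrite /obs /shift_obs/= addnA. Qed.

Lemma measurable_obs k : measurable_fun setT (obs k : T -> cylT R (nat * bool)%type).
Proof.
apply: measurable_cyl => -[i b]; rewrite /obs/=; case: b.
  exact: (measurable_hold M).
exact: (measurable_fun_xi M (k + i) (fun z => z%:~R)).
Qed.

Lemma measurable_shift_obs n : measurable_fun [set: cylT R (nat * bool)%type]
  (shift_obs n : cylT R (nat * bool)%type -> cylT R (nat * bool)%type).
Proof. by apply: measurable_cyl => i; exact: measurable_coord. Qed.

(** The link between test products and the rectangles of [cyl_law_unique]. *)
Lemma prod_tests_rect (A : nat -> set int) (B : nat -> set R) k n t :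
  prod_tests [seq (fun z => `[< A i z >]%:R, fun r => `[< B i r >]%:R) | i <- iota 0 n] k t =
  `[< forall i, (i < n)%N -> A i (xi (k + i) t) /\ B i (hold (k + i) t) >]%:R.
Proof.
have gen a : prod_tests
    [seq (fun z => `[< A i z >]%:R, fun r => `[< B i r >]%:R) | i <- iota a n] (k + a) t =
    `[< forall i, (a <= i < a + n)%N -> A i (xi (k + i) t) /\ B i (hold (k + i) t) >]%:R.
  elim: n a => [|n IH] a /=.
    by rewrite asboolT// => i; rewrite addn0 ltnNge => /andP[->].
  rewrite -addnS IH -!natrM !mulnb; congr (_%:R); congr nat_of_bool.
  apply/idP/asboolP => [/andP[/andP[/asboolP h1 /asboolP h2] /asboolP h3] i|h].
    rewrite leq_eqVlt => /andP[/orP[/eqP <- //|ai] ian].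
    by apply: h3; rewrite ai addSnnS.
  apply/andP; split; [apply/andP; split|]; apply/asboolP.
  - by have [] := h a _; rewrite ?leqnn// addnS ltnS leq_addr.
  - by have [] := h a _; rewrite ?leqnn// addnS ltnS leq_addr.
  - by move=> i /andP[ai ian]; apply: h; rewrite -addSnnS ian ltnW.
by have := gen 0%N; rewrite addn0.
Qed.

Lemma obs_law k (B : set (cylT R (nat * bool)%type)) : measurable B ->
  P (obs k @^-1` B) = P (obs 0 @^-1` B).
Proof.
have mo k' i : measurable_fun setT (fun t => obs k' t i).
  have mo := @measurable_obs k'.
  exact: (measurableT_comp (@measurable_coord R _ i) mo).
apply: (cyl_law_unique (mo k) (mo 0%N)) => s C mC.
(* [n] exceeds all times constrained by [s]; [A] and [B'] are the full sets wherever [s] imposes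
   nothing. *)
pose n := (\max_(i <- s) i.1).+1.
pose A i : set int := [set z | (i, false) \in s -> C (i, false) z%:~R].
pose B' i : set R := [set r | (i, true) \in s -> C (i, true) r].
pose l := [seq ((fun z => `[< A i z >]%:R : R), (fun r => `[< B' i r >]%:R : R)) | i <- iota 0 n].
have mB' i : measurable (B' i).
  rewrite /B'; case: (_ \in s); first by rewrite (_ : [set _ | _] = C (i, true))//;
    apply/seteqP; split => r /=; [apply|].
  by rewrite (_ : [set _ | _] = setT)//; apply/seteqP; split.
have gl : good l.
  rewrite /l; elim: (iota 0 n) => //= i r IH; split => //.
    by move=> z; case: asboolP; rewrite ?ler01 ?lexx.
  split; last by move=> z; case: asboolP; rewrite ?ler01 ?lexx.
  rewrite (_ : (fun r0 => _) = \1_(B' i)); first exact: measurable_indic.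
  by apply/funext => z; rewrite indicE; congr (_%:R); congr nat_of_bool;
    apply/asboolP/idP => [h|]; rewrite inE.
suff H k' : P [set t | forall i, i \in s -> C i (obs k' t i)] = (Ex P (prod_tests l k'))%:E.
  by rewrite !H Ex_prod_tests.
set E := [set _ | _].
have EE t : prod_tests l k' t = \1_E t.
  rewrite /l prod_tests_rect indicE; congr (_%:R); congr nat_of_bool.
  apply/asboolP/idP => [h|].
    rewrite inE /E/= => -[i b] ib.
    have [h1 h2] : A i (xi (k' + i) t) /\ B' i (hold (k' + i) t).
      by apply: h; rewrite ltnS; exact: (leq_bigmax_seq _ ib).
    by rewrite /obs/=; case: b ib => ib; [exact: h2|exact: h1].
  rewrite inE /E/= => h i _; split => ib; first exact: (h (i, false)).
  exact: (h (i, true)).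
have mE : measurable E.
  rewrite (_ : E = prod_tests l k' @^-1` [set 1]).
    have := measurable_prod_tests M k' gl.
    by move=> /(_ measurableT [set 1] (measurable_set1 1)); rewrite setTI.
  apply/seteqP; split => t.
    by move=> Et; rewrite /preimage /mkset EE indicE mem_set.
  rewrite /preimage /mkset EE indicE.
  by have [|] := boolP (t \in E); [rewrite inE|move=> _ /eqP; rewrite eq_sym oner_eq0].
by rewrite (eq_Ex _ EE) Ex_indic.
Qed.

Lemma obs_exceeds (h : cylT R (nat * bool)%type -> R) : measurable_fun setT h ->
  exceeds_stationary P (fun k t => h (obs k t)).
Proof.
move=> mh a n k.
pose B := [set g : cylT R (nat * bool)%type | exceeds (fun i : nat => h (shift_obs i g)) a n 0].
have mB : measurable B.
  apply: measurable_exceeds => i; exact: (measurableT_comp mh (@measurable_shift_obs i)).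
have E k' : [set t | exceeds (fun i => h (obs i t)) a n k'] = obs k' @^-1` B.
  have E t : exceeds (fun i => h (obs i t)) a n k' =
      exceeds (fun i : nat => h (shift_obs i (obs k' t))) a n 0.
    by apply: eq_exceeds => i; rewrite -obsD.
  by apply/seteqP; split => t /=; rewrite /B/= E.
by rewrite !E; exact: obs_law.
Qed.

Lemma Ex_obs (h : cylT R (nat * bool)%type -> R) k : measurable_fun setT h ->
  Ex P (fun t => h (obs k t)) = Ex P (fun t => h (obs 0 t)).
Proof.
move=> mh; apply: (@Ex_eq_law _ _ _ P _ (cylT R (nat * bool)%type) (obs k) (obs 0) h) => //; [exact: measurable_obs|exact: measurable_obs|].
by move=> B; exact: obs_law.
Qed.

End Stationarity.

(** * Cesaro averages of a walk with drift *)

Section WalkOperator.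
Context (R : realType) (p : R).
Hypotheses (p_half : 2^-1 < p) (p_lt1 : p < 1).
Implicit Types (r : int -> R) (x y : int).

Fixpoint iter_walk (j : nat) r x : R :=
  if j is j'.+1 then p * iter_walk j' r (x + 1) + (1 - p) * iter_walk j' r (x - 1)
  else r x.

Lemma iter_walk_shift j r x y :
  iter_walk j r (x + y) = iter_walk j (fun z => r (z + y)) x.
Proof.
by elim: j x => [|j IH] x //=; rewrite -!IH addrAC [x - 1 + y]addrAC.
Qed.

Lemma iter_walk_sum j m (f : nat -> int -> R) x :
  \sum_(i < m) iter_walk j (f i) x = iter_walk j (fun z => \sum_(i < m) f i z) x.
Proof.
by elim: j x => [|j IH] x //=; rewrite big_split/= -!mulr_sumr !IH.
Qed.

Lemma iter_walk_near j r x (a b : R) : (forall y, `|r y - a| <= b) ->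
  `|iter_walk j r x - a| <= b.
Proof.
move: p_half p_lt1 => pl pr.
move=> rab; elim: j x => [|j IH] x //=.
have p0 : 0 <= p by lra.
have q0 : 0 <= 1 - p by lra.
have -> : p * iter_walk j r (x + 1) + (1 - p) * iter_walk j r (x - 1) - a =
  p * (iter_walk j r (x + 1) - a) + (1 - p) * (iter_walk j r (x - 1) - a) by ring.
have -> : b = p * b + (1 - p) * b by ring.
apply: le_trans (ler_normD _ _) _.
by rewrite !normrM (ger0_norm p0) (ger0_norm q0) lerD// ler_wpM2l.
Qed.

Definition sum_walk n r x : R := \sum_(j < n) iter_walk j r x.

(** The telescoped Poisson equation: [sum_walk n r] is harmonic up to a defect
    [r x - iter_walk n r x]. *)
Lemma sum_walkS n r x : sum_walk n r x =
  p * sum_walk n r (x + 1) + (1 - p) * sum_walk n r (x - 1) + r x - iter_walk n r x.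
Proof.
move: p_half p_lt1 => pl pr.
have E : sum_walk n.+1 r x =
    r x + (p * sum_walk n r (x + 1) + (1 - p) * sum_walk n r (x - 1)).
  by rewrite /sum_walk big_ord_recl/= !mulr_sumr -big_split.
by move: E; rewrite {1}/sum_walk big_ord_recr/= -/(sum_walk n r x) => E; lra.
Qed.

(** By [sum_walkS], an increment is [rho = (1 - p) / p] times the increment one site to the left,
    plus a defect of size at most [1 / p]. The fixed point of [b = rho * b + 1 / p] is
    [(2 * p - 1)^-1], and the crude initial bound [n] is contracted away. *)
Lemma sum_walk_lipschitz1 n r x : (forall y, 0 <= r y <= 1) ->
  `|sum_walk n r (x + 1) - sum_walk n r x| <= (2 * p - 1)^-1.
Proof.
move: p_half p_lt1 => pl pr.
move=> r01.
have it01 j y : 0 <= iter_walk j r y <= 1.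
  (* The unit interval is the ball of radius one half about one half. *)
  have h z : `|r z - 2^-1| <= 2^-1 by rewrite ler_norml; have := r01 z; lra.
  by have := iter_walk_near j y h; rewrite ler_norml; lra.
have s0n y : 0 <= sum_walk n r y <= n%:R.
  apply/andP; split; first by apply: sumr_ge0 => j _; have /andP[] := it01 j y.
  rewrite -[X in _ <= X%:R]card_ord -sum1_card natr_sum.
  by apply: ler_sum => k _; have /andP[] := it01 k y.
have [rho rhoE] : {rho : R | rho = (1 - p) / p} by exists ((1 - p) / p).
have rho01 : 0 < rho < 1.
  by rewrite rhoE; apply/andP; split; [rewrite divr_gt0|rewrite ltr_pdivrMr]; lra.
have bound k : forall y, `|sum_walk n r (y + 1) - sum_walk n r y| <=
    (2 * p - 1)^-1 + rho ^+ k * n%:R.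
  elim: k => [|k IH] y.
    have v0 : 0 < (2 * p - 1)^-1 by rewrite invr_gt0; lra.
    have := s0n y; have := s0n (y + 1); rewrite expr0 mul1r ler_norml.
    by move=> /andP[? ?] /andP[? ?]; apply/andP; split; lra.
  have := sum_walkS n r y; have := IH (y - 1); rewrite subrK.
  have := it01 n y; have := r01 y.
  set u := sum_walk n r (y + 1); set v := sum_walk n r y.
  set v' := sum_walk n r (y - 1); set e1 := r y; set e2 := iter_walk n r y.
  move=> h1 h2 h3 h4.
  have E : u - v = rho * (v - v') + (e2 - e1) / p.
    have p0 : p != 0 by lra.
    apply: (mulfI p0); rewrite [RHS](_ : _ = (1 - p) * (v - v') + (e2 - e1)); first by lra.
    by rewrite rhoE; field.
  rewrite E; apply: le_trans (ler_normD _ _) _; rewrite !normrM.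
  rewrite (ger0_norm (_ : 0 <= rho)); last by lra.
  rewrite (ger0_norm (_ : 0 <= p^-1)); last by rewrite invr_ge0; lra.
  have e12 : `|e2 - e1| <= 1 by rewrite ler_norml; lra.
  apply: le_trans (_ : rho * ((2 * p - 1)^-1 + rho ^+ k * n%:R) + 1 / p <= _).
    apply: lerD; first by apply: ler_wpM2l => //; lra.
    by apply: ler_wpM2r => //; rewrite invr_ge0; lra.
  rewrite mulrDr mulrA -exprS -addrA [_ * n%:R + _]addrC addrA lerD2r rhoE.
  rewrite le_eqVlt; apply/orP; left; apply/eqP; field.
  by apply/andP; split; lra.
apply/ler_addgt0Pr => e e0.
have rc : (fun k => rho ^+ k * n%:R) @ \oo --> (0 : R).
  rewrite -[X in _ --> X](mul0r n%:R); apply: cvgM; last exact: cvg_cst.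
  by apply: cvg_expr; rewrite ger0_norm; lra.
have /cvgrPdist_le /(_ e e0) [k _ /(_ k (leqnn k))] := rc.
rewrite sub0r normrN ger0_norm => [hk|]; last by rewrite mulr_ge0// exprn_ge0//; lra.
by apply: le_trans (bound k x) _; rewrite lerD2l.
Qed.

Lemma sum_walk_lipschitz n r x (i : nat) : (forall y, 0 <= r y <= 1) ->
  `|sum_walk n r (x + i%:Z) - sum_walk n r x| <= i%:R / (2 * p - 1).
Proof.
move: p_half p_lt1 => pl pr.
move=> r01; elim: i => [|i IH]; first by rewrite addr0 subrr normr0 mul0r.
rewrite -addn1 PoszD addrA -(subrKA (sum_walk n r (x + i%:Z))) natrD mulrDl mul1r addrC.
rewrite [leRHS]addrC; apply: le_trans (ler_normD _ _) _.
by rewrite addrC; apply: lerD => //; exact: sum_walk_lipschitz1.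
Qed.

(* [sum_walk n r] is almost harmonic for a walk with drift, hence almost
   constant, so it can be averaged over a block of [m] consecutive sites. *)
Lemma cesaro_walk n r x m (c e : R) : (forall y, 0 <= r y <= 1) -> (0 < m)%N ->
  (forall y, `|\sum_(i < m) r (y + i%:Z) - m%:R * c| <= m%:R * e) ->
  `|sum_walk n r x - n%:R * c| <= m%:R / (2 * p - 1) + n%:R * e.
Proof.
move: p_half p_lt1 => pl pr.
move=> r01 m0 blk; have m0' : 0 < m%:R :> R by rewrite ltr0n.
have cst (k : nat) (a : R) : k%:R * a = \sum_(i < k) a.
  by rewrite sumr_const card_ord mulr_natl.
have h1 : `|m%:R * sum_walk n r x - \sum_(i < m) sum_walk n r (x + i%:Z)| <=
    m%:R * (m%:R / (2 * p - 1)).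
  rewrite (cst m (sum_walk n r x)) (cst m (_ / _)) -sumrB.
  apply: le_trans (ler_norm_sum _ _ _) _; apply: ler_sum => i _.
  rewrite distrC; apply: le_trans (sum_walk_lipschitz _ _ _ r01) _.
  by apply: ler_wpM2r; [rewrite invr_ge0; lra|rewrite ler_nat ltnW].
have h2 : `|\sum_(i < m) sum_walk n r (x + i%:Z) - n%:R * (m%:R * c)| <= n%:R * (m%:R * e).
  rewrite exchange_big/= (cst n (m%:R * c)) (cst n (m%:R * e)) -sumrB.
  apply: le_trans (ler_norm_sum _ _ _) _; apply: ler_sum => j _.
  rewrite (eq_bigr (fun i : 'I_m => iter_walk j (fun z => r (z + i%:Z)) x)); last first.
    by move=> i _; rewrite iter_walk_shift.
  rewrite (iter_walk_sum j m (fun i z => r (z + i%:Z))).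
  exact: iter_walk_near.
rewrite -(ler_pM2l m0') -[X in X * `|_|](ger0_norm (ltW m0')) -normrM mulrBr.
rewrite -(subrKA (\sum_(i < m) sum_walk n r (x + i%:Z))).
apply: le_trans (ler_normD _ _) _; rewrite mulrDr; apply: lerD => //.
by rewrite mulrCA [leRHS]mulrCA.
Qed.

End WalkOperator.

(** * Averages of observables along a fixed path *)

Section BoundedConvergence.
Context (R : realType) (d : measure_display) (T : measurableType d).
Variable P : probability T R.

Lemma Ex_bounded_cvg (f : nat -> T -> R) (c C : R) :
  (forall n, measurable_fun setT (f n)) -> (forall n t, `|f n t| <= C) ->
  {ae P, forall t, f ^~ t @ \oo --> c} ->
  forall e, 0 < e -> exists N, forall n, (N <= n)%N -> Ex P (fun t => `|f n t - c|) <= e.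
Proof.
move=> mf fC fc e e0.
have bf n : bmf (f n) by split => //; exists C.
have iD n : intg P (fun t => `|f n t - c|) by exact/bmf_intg/bmf_norm/bmfB/bmf_cst.
have [] := @dominated_convergence _ _ _ P setT measurableT
  (fun n t => (f n t)%:E) (fun=> c%:E) (fun=> C%:E).
- by move=> n; exact/measurable_EFinP.
- exact: measurable_cst.
- by apply: filterS fc => t h _; apply: cvg_EFin; [exact: nearW|exact: h].
- exact: finite_measure_integrable_cst.
- by apply: aeW => t n _; rewrite lee_fin.
move=> _ /fine_cvgP[_ /cvgrPdist_le /(_ e e0)[N _ hN]] _.
exists N => n /hN /=; rewrite sub0r normrN; apply: le_trans.
by apply: le_trans (ler_norm _).
Qed.

End BoundedConvergence.

Section PathAverage.
Context (R : realType) (d : measure_display) (T : measurableType d).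
Variable P : probability T R.
Variables (xi : nat -> T -> int) (w : int -> T -> R) (tau : int -> nat -> T -> R -> R).
Variable p : R.
Hypothesis M : rw_model P xi w tau p.
Local Notation hold := (hold xi w tau).
Local Notation env := (env w).
Local Notation prod_tests := (prod_tests xi w tau).
Local Notation value := (value P tau p).
Local Notation free := (@free R).
Local Notation obs := (obs xi w tau).
Implicit Types (l : seq ((int -> R) * (R -> R))) (s : seq (int * (R -> R))).

(** Every step is prescribed, so the displacement after the tests is deterministic. *)
Definition path_tests s : seq ((int -> R) * (R -> R)) :=
  [seq ((fun z : int => (z == c.1)%:R), c.2) | c <- s].

Lemma prod_tests_cat l l' k t : prod_tests (l ++ l') k t =
  prod_tests l k t * prod_tests l' (k + size l) t.
Proof.
elim: l k => [|c l IH] k /=; first by rewrite mul1r addn0.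
by rewrite IH addSnnS mulrA.
Qed.

Lemma prod_tests_free j l k t :
  prod_tests (nseq j free ++ l) k t = prod_tests l (k + j) t.
Proof.
elim: j k => [|j IH] k /=; first by rewrite addn0.
by rewrite IH !mul1r addSnnS.
Qed.

Lemma good_cat l l' : good l -> good l' -> good (l ++ l').
Proof. by elim: l => //= c l IH [c1 c2 gl] gl'; split => //; exact: IH. Qed.

Lemma good_nseq j l : good l -> good (nseq j free ++ l).
Proof. by move=> gl; elim: j => //= j IH; exact: good_free. Qed.

Lemma value_nseq j l x g :
  value (nseq j free ++ l) x g = iter_walk p j (fun y => value l y g) x.
Proof. by elim: j x => [//|j IH] x; rewrite value_free !IH. Qed.

(** At each time only the prescribed branch of [value] survives, so [l] is always evaluated at the
    same end point. A prescribed step other than [1] or [-1] makes both sides vanish. *)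
Lemma value_path_cat s l x g : value (path_tests s ++ l) x g =
  value (path_tests s) x g * value l (x + \sum_(c <- s) c.1) g.
Proof.
elim: s x => [|[e phi] s IH] x /=; first by rewrite big_nil addr0 mul1r.
rewrite !IH big_cons/= !addrA.
have [<-|e1] := eqVneq 1 e.
  by rewrite (_ : (-1 == 1 :> int) = false)//= !mulr0 !mul0r !addr0 mulr1; ring.
have [<-|e2] := eqVneq (-1) e; first by rewrite !mulr0 !mul0r !add0r mulr1; ring.
by rewrite !mulr0 !mul0r addr0 mulr0 mul0r.
Qed.

(** The same path observable as a function of the observed sequence, to which equality of laws
    applies. *)
Fixpoint obs_val s (g : nat * bool -> R) : R :=
  if s is c :: s' then (g (0%N, false) == c.1%:~R)%:R * c.2 (g (0%N, true)) *
     obs_val s' (shift_obs 1 g)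
  else 1.

Lemma obs_valE s k t : prod_tests (path_tests s) k t = obs_val s (obs k t).
Proof.
elim: s k => [//|c s IH] k /=; rewrite IH -obsD addn1.
by rewrite /obs/= addn0 eqr_int.
Qed.

Lemma measurable_obs_val s : good (path_tests s) ->
  measurable_fun [set: cylT R (nat * bool)%type] (obs_val s).
Proof.
elim: s => [|c s IH] /=; first by move=> _; exact: measurable_cst.
move=> [_ [mc _] gs]; apply: measurable_funM; last first.
  exact: (measurableT_comp (IH gs) (@measurable_shift_obs R 1)).
apply: measurable_funM; last first.
  exact: (measurableT_comp mc (@measurable_coord R _ (0%N, true))).
have E : (fun g : cylT R (nat * bool)%type => (g (0%N, false) == c.1%:~R)%:R : R) =
    \1_((fun g : cylT R (nat * bool)%type => g (0%N, false)) @^-1` [set c.1%:~R]).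
  apply/funext => g; rewrite indicE; congr (_%:R); congr nat_of_bool.
  by apply/eqP/idP => [h|]; rewrite inE.
rewrite E; apply: measurable_indic; rewrite -[X in measurable X]setTI.
exact: (@measurable_coord R _ (0%N, false) measurableT).
Qed.

Section FixedPath.
Variable s : seq (int * (R -> R)).
Hypothesis gs : good (path_tests s).
Let l := path_tests s.
Let mean : R := Ex P (fun t => value l 0 (env t)).
Let corr (y : int) : R := Ex P (fun t => value l 0 (env t) * value l y (env t)).

(** Filling the gap with [j] copies of [free] turns the product into one test product; the second
    value is then read [j] free steps after the end of the first path. *)
Lemma path_corr k j :
  Ex P (fun t => prod_tests l k t * prod_tests l (k + (size s + j)) t) =
  iter_walk p j corr (\sum_(c <- s) c.1).
Proof.
have gl : good (l ++ nseq j free ++ l) by apply: good_cat => //; exact: good_nseq.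
transitivity (Ex P (prod_tests (l ++ nseq j free ++ l) k)).
  apply: eq_Ex => t.
  by rewrite prod_tests_cat prod_tests_free size_map addnA.
rewrite (Ex_prod_tests M k gl) (Ex_prod_tests0 M gl).
transitivity (Ex P (fun t => value l 0 (env t) *
   iter_walk p j (fun y => value l y (env t)) (\sum_(c <- s) c.1))).
  by apply: eq_Ex => t; rewrite value_path_cat value_nseq add0r.
have bv y : bmf (fun t => value l y (env t)) by exact: (bmf_value M).
have bi i y : bmf (fun t => iter_walk p i (fun y => value l y (env t)) y).
  elim: i y => [//|i IH] y; apply: bmfD; (apply: bmfM; first exact: bmf_cst); exact: IH.
elim: j (\sum_(c <- s) c.1) {gl} => [//|j IH] y /=.
rewrite -!IH -!ExZ -?ExD; try (by apply/bmf_intg/bmfM); last 2 first.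
- by apply/intgZ/bmf_intg/bmfM.
- by apply/intgZ/bmf_intg/bmfM.
by apply: eq_Ex => t; ring.
Qed.

Lemma corr01 y : 0 <= corr y <= 1.
Proof.
have bv z : bmf (fun t => value l z (env t)) by exact: (bmf_value M).
have v01 z t : 0 <= value l z (env t) <= 1 by exact: (value01 M).
apply/andP; split.
  apply: Ex_ge0 => t; apply: mulr_ge0; [have /andP[] := v01 0 t|have /andP[] := v01 y t] => //.
rewrite -[leRHS](Ex_cst P); apply: Ex_le; [exact/bmf_intg/bmfM|exact: intg_cst|].
move=> t; have /andP[? ?] := v01 0 t; have /andP[? ?] := v01 y t.
exact: mulr_ile1.
Qed.

(** The block average of the values is close to [mean] in L1 by [env_average] and bounded
    convergence. Stationarity makes this distance independent of the first site of the block, so one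
    [m] serves all [y]. *)
Lemma corr_block e : 0 < e -> exists2 m, (0 < m)%N & forall y,
  `|\sum_(i < m) corr (y + i%:Z) - m%:R * (mean * mean)| <= m%:R * e.
Proof.
move=> e0.
have bv z : bmf (fun t => value l z (env t)) by exact: (bmf_value M).
have v01 z t : 0 <= value l z (env t) <= 1 by exact: (value01 M).
have vE z g : value l 0 (shift_env z g) = value l z g.
  by rewrite -[z in RHS]add0r value_shift.
have avg := env_average M (measurable_value_cyl M 0 gs) (fun g => value01 M 0 g gs).
have bavg n : bmf (fun t => (\sum_(i < n) value l 0 (shift_env i%:Z (env t))) / n%:R).
  apply: bmfM; last exact: bmf_cst.
  apply: (bmf_sum n (F := fun i t => value l 0 (shift_env i%:Z (env t)))) => i.
  by under eq_fun do rewrite vE.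
have avg1 n t : `|(\sum_(i < n) value l 0 (shift_env i%:Z (env t))) / n%:R| <= 1.
  case: n => [|n]; first by rewrite big_ord0 mul0r normr0.
  have s0 : 0 <= \sum_(i < n.+1) value l 0 (shift_env i%:Z (env t)) <= n.+1%:R.
    apply/andP; split; first by apply: sumr_ge0 => i _; rewrite vE; have /andP[] := v01 i%:Z t.
    rewrite -[X in _ <= X%:R]card_ord -sum1_card natr_sum.
    by apply: ler_sum => i _; rewrite vE; have /andP[] := v01 i%:Z t.
  have /andP[s1 s2] := s0.
  by rewrite ger0_norm ?divr_ge0// ler_pdivrMr// mul1r.
have [N hN] := Ex_bounded_cvg (fun n => proj1 (bavg n)) avg1 avg e0.
exists N.+1 => // y; have {hN} := hN N.+1 (leqnSn _).
set m := N.+1; have m0 : 0 < m%:R :> R by [].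
rewrite -/mean => hm.
have E : \sum_(i < m) corr (y + i%:Z) - m%:R * (mean * mean) =
    Ex P (fun t => value l 0 (env t) *
      (\sum_(i < m) value l (y + i%:Z) (env t) - m%:R * mean)).
  have bS : bmf (fun t => \sum_(i < m) (value l 0 (env t) * value l (y + i%:Z) (env t))).
    by apply: (bmf_sum m (F := fun i t => value l 0 (env t) * value l (y + i%:Z) (env t)))
      => i; exact: bmfM.
  transitivity (Ex P (fun t => \sum_(i < m) (value l 0 (env t) * value l (y + i%:Z) (env t))
     - (m%:R * mean) * value l 0 (env t))); last first.
    by apply: eq_Ex => t; rewrite -mulr_sumr; ring.
  rewrite ExB ?ExZ -/mean; [|exact: bmf_intg|exact: bmf_intg|exact/intgZ/bmf_intg].
  rewrite (Ex_sum m (F := fun i t => value l 0 (env t) * value l (y + i%:Z) (env t)))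
    => [|i]; last by apply/bmf_intg/bmfM.
  by rewrite mulrA.
have bD z : bmf (fun t => \sum_(i < m) value l (z + i%:Z) (env t) - m%:R * mean).
  apply: bmfB; last exact: bmf_cst.
  by apply: (bmf_sum m (F := fun i t => value l (z + i%:Z) (env t))).
rewrite E; apply: le_trans (Ex_norm _) _; first exact/bmf_intg/bmfM.
apply: le_trans (_ : Ex P (fun t => `|\sum_(i < m) value l (y + i%:Z) (env t) - m%:R * mean|) <= _).
  apply: Ex_le; [exact/bmf_intg/bmf_norm/bmfM|exact/bmf_intg/bmf_norm|].
  move=> t; rewrite normrM ler_piMl//; have /andP[v0 v1] := v01 0 t.
  by rewrite ger0_norm.
pose h (g : cylT R int) := `|\sum_(i < m) value l 0 (shift_env i%:Z g) - m%:R * mean|.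
have mh : measurable_fun setT h.
  apply: measurableT_comp => //; apply: measurable_funB => //.
  apply: measurable_sum => i.
  exact: (measurableT_comp (measurable_value_cyl M 0 gs) (@measurable_shift_env R i%:Z)).
have -> : Ex P (fun t => `|\sum_(i < m) value l (y + i%:Z) (env t) - m%:R * mean|) =
    Ex P (fun t => h (shift_env y (env t))).
  apply: eq_Ex => t; rewrite /h; congr (`|_ - _|); apply: eq_bigr => i _.
  rewrite -vE; congr (value l 0 _); apply/funext => z.
  by rewrite /shift_env -addrA [i%:Z + y]addrC.
(* Here the dependence on [y] disappears. *)
rewrite (Ex_shift_env M y mh).
have -> : Ex P (fun t => h (env t)) = m%:R *
    Ex P (fun t => `|(\sum_(i < m) value l 0 (shift_env i%:Z (env t))) / m%:R - mean|).
  rewrite -ExZ; last by apply/bmf_intg/bmf_norm/bmfB/bmf_cst.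
  apply: eq_Ex => t; rewrite /h -[X in X * `|_|](ger0_norm (ltW m0)) -normrM mulrBr.
  by rewrite mulrCA mulfV ?gt_eqF// mulr1.
by rewrite ler_pM2l.
Qed.

Lemma Ex_path k : Ex P (prod_tests l k) = mean.
Proof. by rewrite (Ex_prod_tests M k gs) (Ex_prod_tests0 M gs). Qed.

(** Passing from [n] to [n + 1] terms adds twice the sum of the covariances up to lag [n], minus the
    one at lag zero. [cesaro_walk] bounds that sum by a constant plus a small multiple of the number
    of terms. *)
Lemma path_variance e : 0 < e -> exists C, 0 <= C /\ forall n,
  Ex P (fun t => (\sum_(k < n) (prod_tests l k t - mean)) ^+ 2) <=
  n%:R * (C + e * n%:R).
Proof.
move=> e0; have [m m0 blk] := corr_block (divr_gt0 e0 (ltr0Sn R 1)).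
have pt := p01 M; have /andP[pl pr] := pt.
pose y0 := \sum_(c <- s) c.1; pose N := size s.
pose b j := Ex P (fun t => prod_tests l 0 t * prod_tests l j t) - mean * mean.
have bF k : bmf (prod_tests l k) by exact: (bmf_prod_tests M).
have F01 k t : 0 <= prod_tests l k t <= 1 by exact: prod_tests01.
have cov k j : Ex P (fun t => prod_tests l k t * prod_tests l (k + j) t) - mean * mean = b j.
  rewrite /b; congr (_ - _).
  pose h (g : cylT R (nat * bool)%type) := obs_val s g * obs_val s (shift_obs j g).
  have mh : measurable_fun setT h.
    apply: measurable_funM; first exact: measurable_obs_val.
    exact: (measurableT_comp (measurable_obs_val gs) (@measurable_shift_obs R j)).
  have E k' : Ex P (fun t => prod_tests l k' t * prod_tests l (k' + j) t) =
      Ex P (fun t => h (obs k' t)).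
    by apply: eq_Ex => t; rewrite !obs_valE obsD.
  by rewrite E (Ex_obs M k mh) -E.
have mean01 : 0 <= mean <= 1.
  rewrite -(Ex_path 0) Ex_ge0/= => [|t]; last by have /andP[] := F01 0%N t.
  rewrite -[leRHS](Ex_cst P); apply: Ex_le; [exact: bmf_intg|exact: intg_cst|].
  by move=> t; have /andP[] := F01 0%N t.
have b1 j : `|b j| <= 1.
  have : 0 <= Ex P (fun t => prod_tests l 0 t * prod_tests l j t) <= 1.
    apply/andP; split.
      by apply: Ex_ge0 => t; apply: mulr_ge0;
        [have /andP[] := F01 0%N t|have /andP[] := F01 j t].
    rewrite -[leRHS](Ex_cst P); apply: Ex_le; [exact/bmf_intg/bmfM|exact: intg_cst|].
    move=> t; have /andP[? ?] := F01 0%N t; have /andP[? ?] := F01 j t.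
    exact: mulr_ile1.
  by rewrite /b ler_norml => /andP[? ?]; have /andP[? ?] := mean01; apply/andP; split; nra.
(* [N] pays for the lags at which the two paths overlap, the other term is the boundary cost in
   [cesaro_walk]. *)
pose C0 := N%:R + m%:R / (2 * p - 1).
have v0 : 0 < (2 * p - 1)^-1 by rewrite invr_gt0; lra.
have sumb n : `|\sum_(j < n) b j| <= C0 + n%:R * (e / 2).
  have first_terms k : `|\sum_(j < k) b j| <= k%:R.
    apply: le_trans (ler_norm_sum _ _ _) _.
    rewrite -[X in _ <= X%:R]card_ord -sum1_card natr_sum.
    by apply: ler_sum => j _.
  have me0 : 0 <= m%:R / (2 * p - 1) by rewrite mulr_ge0// ltW.
  have e20 : 0 <= e / 2 by rewrite divr_ge0// ltW.
  have [nN|Nn] := leqP n N.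
    apply: le_trans (first_terms n) _; rewrite /C0 -addrA.
    apply: le_trans (_ : N%:R <= _); first by rewrite ler_nat.
    by rewrite lerDl addr_ge0// mulr_ge0.
  have [n' ->] : {n' | n = (N + n')%N} by exists (n - N)%N; rewrite subnKC// ltnW.
  rewrite big_split_ord/=.
  apply: le_trans (ler_normD _ _) _; rewrite /C0 -addrA; apply: lerD; first exact: first_terms.
  (* From lag [N] on the two paths are disjoint in time and [path_corr] applies. *)
  have -> : \sum_(j < n') b (N + j)%N = sum_walk p n' corr y0 - n'%:R * (mean * mean).
    rewrite /sum_walk mulr_natl -[X in _ *+ X]card_ord -sumr_const -sumrB.
    by apply: eq_bigr => j _; rewrite -(path_corr 0 j).
  apply: le_trans (cesaro_walk pl pr n' y0 corr01 m0 blk) _.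
  by rewrite lerD2l; apply: ler_wpM2r => //; rewrite ler_nat leq_addl.
(* [2 * C0 + 1] bounds the constant part of one increment, the [1] being for the covariance at lag
   zero; [2 * e] is slack. *)
pose C := 2 * C0 + 2 * e + 1.
have C00 : 0 <= C0 by rewrite addr_ge0// mulr_ge0// ltW.
exists C; split; first by rewrite /C; lra.
have bS n : bmf (fun t => \sum_(k < n) (prod_tests l k t - mean)).
  by apply: (bmf_sum n (F := fun k t => prod_tests l k t - mean)) => k; exact/bmfB/bmf_cst.
elim=> [|n IH].
  by rewrite (eq_Ex P (g := fun=> 0)) ?Ex_cst ?mul0r// => t; rewrite big_ord0 expr0n.
have E : Ex P (fun t => (\sum_(k < n.+1) (prod_tests l k t - mean)) ^+ 2) =
    Ex P (fun t => (\sum_(k < n) (prod_tests l k t - mean)) ^+ 2) +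
    (2 * (\sum_(j < n.+1) b j) - b 0%N).
  have cross k j : Ex P (fun t => (prod_tests l k t - mean) * (prod_tests l (k + j) t - mean))
      = b j.
    rewrite -(cov k j).
    transitivity (Ex P (fun t => prod_tests l k t * prod_tests l (k + j) t
       - (mean * prod_tests l k t + (mean * prod_tests l (k + j) t - mean * mean)))).
      by apply: eq_Ex => t; ring.
    rewrite ExB; [|exact/bmf_intg/bmfM|]; last first.
      apply: intgD; first by apply/intgZ/bmf_intg.
      by apply: intgB; [apply/intgZ/bmf_intg|exact: intg_cst].
    rewrite ExD; [|by apply/intgZ/bmf_intg|]; last first.
      by apply: intgB; [apply/intgZ/bmf_intg|exact: intg_cst].
    rewrite ExB; [|by apply/intgZ/bmf_intg|exact: intg_cst].
    rewrite !ExZ; try exact/bmf_intg; try exact: intg_cst.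
    by rewrite Ex_cst !Ex_path; ring.
  have bX k j : bmf (fun t => (prod_tests l k t - mean) * (prod_tests l j t - mean)).
    by apply: bmfM; apply/bmfB/bmf_cst.
  transitivity (Ex P (fun t => (\sum_(k < n) (prod_tests l k t - mean)) ^+ 2 +
     (2 * (\sum_(k < n) (prod_tests l k t - mean) * (prod_tests l n t - mean)) +
      (prod_tests l n t - mean) * (prod_tests l n t - mean)))).
    by apply: eq_Ex => t; rewrite big_ord_recr/= -mulr_suml; ring.
  have iS : intg P (fun t => \sum_(k < n) (prod_tests l k t - mean) * (prod_tests l n t - mean)).
    by apply: (intg_sum n (F := fun k t => (prod_tests l k t - mean) * (prod_tests l n t - mean)))
      => k; exact: bmf_intg.
  rewrite ExD; [|by apply/bmf_intg; under eq_fun do rewrite expr2; exact: bmfM|]; last first.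
    by apply: intgD; [exact: intgZ|exact: bmf_intg].
  rewrite ExD; [|exact: intgZ|exact: bmf_intg].
  rewrite ExZ// (Ex_sum n (F := fun k t => (prod_tests l k t - mean) * (prod_tests l n t - mean)));
    last by move=> k; exact: bmf_intg.
  congr (_ + _).
  have -> : Ex P (fun t => (prod_tests l n t - mean) * (prod_tests l n t - mean)) = b 0%N.
    by rewrite -(cross n 0%N) addn0.
  have -> : \sum_(j < n.+1) b j = b 0%N + \sum_(k < n) b k.+1.
    by rewrite big_ord_recl; congr (_ + _); apply: eq_bigr => i _; rewrite lift0.
  rewrite (reindex_inj rev_ord_inj)/= (eq_bigr (fun k : 'I_n => b k.+1)) => [|k _]; first by ring.
  by rewrite -(cross (n - k.+1)%N k.+1) subnK.
have := sumb n.+1; rewrite ler_norml => /andP[_ h1].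
have := b1 0%N; rewrite ler_norml => /andP[h2 _].
rewrite E; apply: le_trans (lerD IH (lexx _)) _.
rewrite -[n.+1%:R]natr1 in h1 *; have n0 : 0 <= n%:R :> R by [].
move: h1; set sb := \sum_(_ < _) _ => h1.
rewrite /C; nra.
Qed.

Theorem path_average :
  {ae P, forall t, (fun n => (\sum_(i < n) prod_tests l i t) / n%:R) @ \oo --> mean}.
Proof.
have F01 k t : 0 <= prod_tests l k t <= 1 by exact: prod_tests01.
have bF k : bmf (prod_tests l k) by exact: (bmf_prod_tests M).
rewrite -(Ex_path 0).
pose h m (g : cylT R (nat * bool)%type) :=
  `|(\sum_(i < m) obs_val s (shift_obs i g)) / m%:R - mean|.
have mh m : measurable_fun setT (h m).
  apply: measurableT_comp => //; apply: measurable_funB => //.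
  apply: measurable_funM => //; apply: measurable_sum => i.
  exact: (measurableT_comp (measurable_obs_val gs) (@measurable_shift_obs R i)).
have hE m k : (fun t => `|(\sum_(i < m) prod_tests l (k + i) t) / m%:R
    - Ex P (prod_tests l 0)|) = (fun t => h m (obs k t)).
  apply/funext => t; rewrite /h Ex_path; congr (`|_ / _ - _|).
  by apply: eq_bigr => i _; rewrite obs_valE obsD.
apply: average_upgrade => //.
- by move=> k; exact: (proj1 (bF k)).
- by move=> m k; rewrite !hE; exact: (Ex_obs M).
- move=> m.
  have E : (fun k t => `|(\sum_(i < m) prod_tests l (k + i) t) / m%:R
      - Ex P (prod_tests l 0)|) = (fun k t => h m (obs k t)).
    by apply/funext => k; exact: hE.
  by rewrite E; exact: (obs_exceeds M (mh m)).
- move=> e e0.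
  (* With [C] below [e ^+ 2 / 4 * n], the variance of the average is at most [e ^+ 2 / 2]; the L1
     bound below is then [e / 2 + e / 4]. *)
  have e20 : 0 < e ^+ 2 / 4 by rewrite divr_gt0// exprn_gt0.
  have [C [C0 hC]] := path_variance e20.
  pose n := (Num.truncn (C / (e ^+ 2 / 4))).+1; exists n => //.
  have n0 : 0 < n%:R :> R by [].
  have Cn : C <= e ^+ 2 / 4 * n%:R.
    by rewrite mulrC -ler_pdivrMr// ltW// truncnS_gt.
  have bA : bmf (fun t => (\sum_(i < n) prod_tests l i t) / n%:R - mean).
    apply: bmfB; last exact: bmf_cst.
    by apply: bmfM; [exact: bmf_sum|exact: bmf_cst].
  have sqE : Ex P (fun t => ((\sum_(i < n) prod_tests l i t) / n%:R - mean) ^+ 2) <= e ^+ 2 / 2.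
    have -> : Ex P (fun t => ((\sum_(i < n) prod_tests l i t) / n%:R - mean) ^+ 2) =
       (n%:R ^+ 2)^-1 * Ex P (fun t => (\sum_(k < n) (prod_tests l k t - mean)) ^+ 2).
      rewrite -ExZ.
        apply: eq_Ex => t; rewrite sumrB sumr_const card_ord -mulr_natr.
        by field; rewrite pnatr_eq0.
      apply: bmf_intg; under eq_fun do rewrite expr2.
      by apply: bmfM; apply: (bmf_sum n (F := fun k t => prod_tests l k t - mean)) => k;
        exact/bmfB/bmf_cst.
    rewrite mulrC ler_pdivrMr ?exprn_gt0//; apply: le_trans (hC n) _.
    have -> : e ^+ 2 / 2 * n%:R ^+ 2 = n%:R * (e ^+ 2 / 4 * n%:R + e ^+ 2 / 4 * n%:R) by field.
    by rewrite ler_pM2l// lerD2r.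
  have -> : Ex P (fun t => `|(\sum_(i < n) prod_tests l (0 + i) t) / n%:R - Ex P (prod_tests l 0)|)
     = Ex P (fun t => `|(\sum_(i < n) prod_tests l i t) / n%:R - mean|) by rewrite Ex_path.
  have bA2 : bmf (fun t => ((\sum_(i < n) prod_tests l i t) / n%:R - mean) ^+ 2).
    by under eq_fun do rewrite expr2; exact: bmfM.
  (* AM-GM: [`|a| <= a ^+ 2 / e + e / 4] *)
  apply: le_trans (_ : Ex P (fun t => e^-1 *
     ((\sum_(i < n) prod_tests l i t) / n%:R - mean) ^+ 2 + e / 4) <= _).
    apply: Ex_le.
    + exact/bmf_intg/bmf_norm.
    + by apply: intgD; [exact/intgZ/bmf_intg|exact: intg_cst].
    + move=> t; set a := _ - mean; rewrite -(ler_pM2l e0) mulrDr mulrA mulfV ?gt_eqF// mul1r.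
      rewrite -real_normK ?num_real//; set x := `|a|.
      have := sqr_ge0 (x - e / 2); nra.
  rewrite ExD; [|exact/intgZ/bmf_intg|exact: intg_cst].
  rewrite ExZ; [rewrite Ex_cst|exact: bmf_intg].
  have : e^-1 * Ex P (fun t => ((\sum_(i < n) prod_tests l i t) / n%:R - mean) ^+ 2) <= e / 2.
    rewrite mulrC ler_pdivrMr//; apply: le_trans sqE _.
    by rewrite expr2; lra.
  lra.
Qed.

End FixedPath.

End PathAverage.

(** * Holding times *)

Section HoldingTimes.
Context (R : realType) (d : measure_display) (T : measurableType d).
Variable P : probability T R.
Variables (xi : nat -> T -> int) (w : int -> T -> R) (tau : int -> nat -> T -> R -> R).
Variable p : R.
Hypothesis M : rw_model P xi w tau p.
Local Notation hold := (hold xi w tau).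
Local Notation env := (env w).
Local Notation prod_tests := (prod_tests xi w tau).
Local Notation value := (value P tau p).
Local Notation pos := (pos xi).
Local Notation obs := (obs xi w tau).

Lemma step_average (e : int) (phi : R -> R) : test phi ->
  {ae P, forall t, (fun n => (\sum_(i < n) (xi i t == e)%:R * phi (hold i t)) / n%:R) @ \oo
     --> Ex P (fun t => (xi 0 t == e)%:R * phi (hold 0 t))}.
Proof.
move=> tphi; pose s := [:: (e, phi)].
have gs : good (path_tests s).
  by rewrite /=; split => // z; case: (z == e); rewrite ?ler01 ?lexx.
have E k t : (xi k t == e)%:R * phi (hold k t) = prod_tests (path_tests s) k t.
  by rewrite /= mulr1.
have := path_average M gs; rewrite -(Ex_path M gs 0) (eq_Ex P (E 0%N)).
apply: filterS => t h; apply: cvg_trans h; apply: near_eq_cvg; apply: nearW => n.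
by congr (_ / _); apply: eq_bigr => i _; rewrite E.
Qed.

Lemma xi_pm_all : {ae P, forall t, forall k, xi k t = 1 \/ xi k t = -1}.
Proof. by apply: ae_foralln => k; exact: (xi_pm M). Qed.

(** [path_average] needs the step to be prescribed, so the average is recovered as the sum over the
    two possible steps. *)
Lemma test_average (phi : R -> R) : test phi ->
  {ae P, forall t, (fun n => (\sum_(i < n) phi (hold i t)) / n%:R) @ \oo
     --> Ex P (fun t => phi (hold 0 t))}.
Proof.
move=> tphi; have [mphi phi01] := tphi.
have splitE t k : xi k t = 1 \/ xi k t = -1 -> phi (hold k t) =
    (xi k t == 1)%:R * phi (hold k t) + (xi k t == -1)%:R * phi (hold k t).
  by move=> [|] ->; rewrite /= ?mul1r ?mul0r ?addr0 ?add0r.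
have b1 e : bmf (fun t => (xi 0 t == e)%:R * phi (hold 0 t)).
  apply: bmf01 => [|t].
    apply: measurable_funM; first exact: (measurable_fun_xi M 0 (fun z => (z == e)%:R)).
    by apply: (measurableT_comp mphi); exact: (measurable_hold M).
  have := phi01 (hold 0 t).
  by case: (xi 0 t == e); rewrite ?mul1r ?mul0r ?ler01 ?lexx.
have -> : Ex P (fun t => phi (hold 0 t)) =
    Ex P (fun t => (xi 0 t == 1)%:R * phi (hold 0 t)) +
    Ex P (fun t => (xi 0 t == -1)%:R * phi (hold 0 t)).
  rewrite -ExD; [|exact: bmf_intg|exact: bmf_intg].
  apply: Ex_ae.
  - by apply: (measurableT_comp mphi); exact: (measurable_hold M).
  - by apply: measurable_funD; exact: (proj1 (b1 _)).
  - by apply: filterS xi_pm_all => t h; exact: splitE.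
have := step_average 1 tphi; have := step_average (-1) tphi.
apply: filterS3 xi_pm_all => t h h1 h2.
have h3 : (fun n => (\sum_(i < n) (xi i t == 1)%:R * phi (hold i t)) / n%:R +
   (\sum_(i < n) (xi i t == -1)%:R * phi (hold i t)) / n%:R) @ \oo -->
   Ex P (fun t => (xi 0 t == 1)%:R * phi (hold 0 t)) +
   Ex P (fun t => (xi 0 t == -1)%:R * phi (hold 0 t)) by exact: cvgD.
apply: cvg_trans h3; apply: near_eq_cvg; apply: nearW => n /=.
rewrite -mulrDl -big_split/=; congr (_ / _).
by apply: eq_bigr => i _; rewrite [RHS]splitE.
Qed.

Lemma pos_average :
  {ae P, forall t, (fun n => (pos n t)%:~R / n%:R) @ \oo --> 2 * p - 1}.
Proof.
have t1 : test (fun=> 1 : R).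
  by split => [|r]; [exact: measurable_cst|rewrite ler01 lexx].
have := step_average 1 t1.
rewrite (eq_Ex P (g := fun t => (xi 0 t == 1)%:R)) => [|t]; last by rewrite mulr1.
rewrite (Ex_xi M) eqxx; apply: filterS2 xi_pm_all => t h h1.
have h2 : (fun n => 2 * ((\sum_(i < n) (xi i t == 1)%:R * 1) / n%:R) - 1) @ \oo --> 2 * p - 1.
  by apply: cvgB; [apply: cvgMr; exact: h1|exact: cvg_cst].
apply: cvg_trans h2; apply: near_eq_cvg; exists 1%N => // n /= n0.
have n0' : n%:R != 0 :> R by rewrite pnatr_eq0 -lt0n.
apply: (mulIf n0'); rewrite mulfVK// mulrBl mulrA mulfVK// mul1r.
rewrite /pos rmorph_sum/= -[n in X in _ - X]card_ord -sum1_card natr_sum mulr_sumr -sumrB.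
by apply: eq_bigr => i _; case: (h i) => ->; rewrite /= ?mulr1 ?mulr0; [ring|rewrite sub0r].
Qed.

Definition hold_pos k t : R := Num.max (hold k t) 0.

Lemma measurable_hold_pos k : measurable_fun setT (hold_pos k).
Proof.
by apply: measurable_maxr; [exact: (measurable_hold M)|exact: measurable_cst].
Qed.

Lemma hold_pos_ge0 k t : 0 <= hold_pos k t. Proof. exact: max0_ge0. Qed.

(** The walk starts at [0], and [w 0] is independent of [tau 0 0]. The integrals stay extended-real
    because the mean may be infinite. *)
Lemma integral_hold0 (f : R -> R) : measurable_fun setT f -> (forall r, 0 <= f r) ->
  (\int[P]_t (f (hold 0 t))%:E = \int[P]_s \int[P]_t (f (tau 0 0%N t (w 0 s)))%:E)%E /\
  measurable_fun setT (fun r : R => \int[P]_t (f (tau 0 0%N t (Num.max r 0)))%:E)%E.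
Proof.
move=> mf f0.
pose F (z : R * TJ xi w tau [set inr (0, 0%N)]) : \bar R :=
  (f (tau 0 0%N z.2 (Num.max z.1 0)))%:E.
have mF : measurable_fun setT F.
  apply/measurable_EFinP; apply: (measurableT_comp mf); exact: (measurable_joint M).
have F0 z : (0 <= F z)%E by rewrite lee_fin.
have ind (A : set R) (B : set (TJ xi w tau [set inr (0, 0%N)])) :
    measurable A -> measurable B ->
    P (w 0 @^-1` A `&` id @^-1` B) = (P (w 0 @^-1` A) * P (id @^-1` B))%E.
  move=> mA mB.
  have mA' : measurable (w 0 @^-1` A : set (TJ xi w tau [set inl (inr tt)])).
    have := @Jmeas_w _ _ _ xi w tau [set inl (inr tt)] 0 erefl measurableT A mA.
    by rewrite setTI.
  have nJ : ~ [set (inl (inr tt) : idx)] (inr (0, 0%N)) by [].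
  exact: (TJ_indep M nJ mA' mB).
have [E mE] := @integral_indep R d T P _ _ R (TJ xi w tau [set inr (0, 0%N)]) (w 0) id F
  (mw M 0) (id_TJ M (J := [set inr (0, 0%N)])) ind mF F0.
split; last exact: mE.
have wmax t : Num.max (w 0 t) 0 = w 0 t by rewrite max_l//; exact/ltW/(w_gt0 M).
have -> : (\int[P]_t (f (hold 0 t))%:E = \int[P]_t F (w 0 t, t))%E.
  by apply: eq_integral => t _; rewrite /F/= wmax /hold /pos big_ord0.
by rewrite E; apply: eq_integral => s _; apply: eq_integral => t _; rewrite /F/= wmax.
Qed.

(** * Law of large numbers for nonnegative holding times *)

Section Nonnegative.
Hypothesis hold0 : {ae P, forall t, 0 <= hold 0 t}.

Lemma hold_ge0 : {ae P, forall t, forall k, 0 <= hold k t}.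
Proof.
apply: ae_foralln => k.
have mE k' : measurable [set t | hold k' t < 0].
  rewrite -[X in measurable X]setTI; apply: measurable_fun_ltr => //.
  exact: (measurable_hold M).
have mB : measurable [set g : cylT R (nat * bool)%type | g (0%N, true) < 0].
  rewrite -[X in measurable X]setTI; apply: measurable_fun_ltr => //.
  exact: measurable_coord.
have E k' : [set t | hold k' t < 0] = obs k' @^-1` [set g | g (0%N, true) < 0].
  by apply/seteqP; split => t; rewrite /= /obs/= addn0.
exists [set t | hold k t < 0]; split => //.
- transitivity (P [set t | hold 0 t < 0]).
    by rewrite (E k) (E 0%N); exact: (obs_law M k mB).
  case: hold0 => N [mN N0 subN]; apply/eqP; rewrite eq_le measure_ge0 andbT -N0.
  apply: le_measure; rewrite ?inE// => t /= ht; apply: subN => /=.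
  by apply/negP; rewrite -ltNge.
- by move=> t /= /negP; rewrite -ltNge.
Qed.

(** The assumption gives the mean of the signed process only. Tonelli for the negative part shows
    that for almost every environment the time [w 0] leaves no negative mass, so there the positive
    part alone has mean [w 0]; Tonelli for the positive part concludes. *)
Lemma integral_hold_pos0 : (\int[P]_t (hold_pos 0 t)%:E = \int[P]_t (w 0 t)%:E)%E.
Proof.
have mp : measurable_fun setT (fun r : R => Num.max r 0).
  by apply: measurable_maxr => //; exact: measurable_cst.
have mn : measurable_fun setT (fun r : R => Num.max (- r) 0).
  apply: measurable_maxr; last exact: measurable_cst.
  exact: oppr_measurable.
have [E _] := integral_hold0 mp (fun r => max0_ge0 r).
rewrite E; have [En mEn] := integral_hold0 mn (fun r => max0_ge0 (- r)).
have wmax t : Num.max (w 0 t) 0 = w 0 t by rewrite max_l//; exact/ltW/(w_gt0 M).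
have mIn : measurable_fun setT (fun s => \int[P]_t (Num.max (- tau 0 0%N t (w 0 s)) 0)%:E)%E.
  have -> : (fun s => \int[P]_t (Num.max (- tau 0 0%N t (w 0 s)) 0)%:E)%E =
     (fun s => \int[P]_t (Num.max (- tau 0 0%N t (Num.max (w 0 s) 0)) 0)%:E)%E.
    by apply/funext => s; rewrite wmax.
  exact: (measurableT_comp mEn (mw M 0)).
have In0 s : (0 <= \int[P]_t (Num.max (- tau 0 0%N t (w 0 s)) 0)%:E)%E.
  by apply: integral_ge0 => t _; rewrite lee_fin max0_ge0.
have zero : (\int[P]_s \int[P]_t (Num.max (- tau 0 0%N t (w 0 s)) 0)%:E = 0)%E.
  rewrite -En; apply/eqP; rewrite eq_le; apply/andP; split; last first.
    by apply: integral_ge0 => t _; rewrite lee_fin max0_ge0.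
  rewrite (ae_eq_integral (cst 0%E)) ?integral0//.
  - apply/measurable_EFinP; apply: (measurableT_comp mn); exact: (measurable_hold M).
  - by apply: filterS hold0 => t h _ /=; rewrite max_r// oppr_le0.
have ae0 : ae_eq P setT (fun s => \int[P]_t (Num.max (- tau 0 0%N t (w 0 s)) 0)%:E)%E (cst 0%E).
  apply/(ae_eq_integral_abs P measurableT mIn).
  by rewrite -zero; apply: eq_integral => s _; rewrite gee0_abs.
have mIp : measurable_fun setT (fun s => \int[P]_t (Num.max (tau 0 0%N t (w 0 s)) 0)%:E)%E.
  have [_ mE] := integral_hold0 mp (fun r => max0_ge0 r).
  have -> : (fun s => \int[P]_t (Num.max (tau 0 0%N t (w 0 s)) 0)%:E)%E =
     (fun s => \int[P]_t (Num.max (tau 0 0%N t (Num.max (w 0 s) 0)) 0)%:E)%E.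
    by apply/funext => s; rewrite wmax.
  exact: (measurableT_comp mE (mw M 0)).
apply: ae_eq_integral => //; first by apply/measurable_EFinP; exact: (mw M).
apply: filterS ae0 => s /(_ I) hs _.
have w0 : 0 <= w 0 s by exact/ltW/(w_gt0 M).
have [_ <-] := tau_mean M 0 0%N w0.
rewrite [RHS]integralE.
have -> : (\int[P]_t (fun t => (tau 0 0%N t (w 0 s))%:E)^\- t = 0)%E.
  transitivity (\int[P]_t (Num.max (- tau 0 0%N t (w 0 s)) 0)%:E)%E; last exact: hs.
  by apply: eq_integral => t _; rewrite funenegE /= -EFin_max.
by rewrite sube0; apply: eq_integral => t _; rewrite funeposE /= -EFin_max.
Qed.

Definition trunc (K : nat) (r : R) : R := Num.min (Num.max r 0) K%:R.

Lemma trunc_ge0 K r : 0 <= trunc K r.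
Proof. by rewrite /trunc le_min max0_ge0 ler0n. Qed.

Lemma trunc_le K r : trunc K r <= K%:R.
Proof. by rewrite /trunc ge_min lexx orbT. Qed.

Lemma measurable_trunc K : measurable_fun setT (trunc K).
Proof.
by apply: measurable_minr => //; apply: measurable_maxr => //; exact: measurable_cst.
Qed.

Lemma bmf_trunc K k : bmf (fun t => trunc K (hold k t)).
Proof.
split; first by apply: (measurableT_comp (measurable_trunc K)); exact: (measurable_hold M).
by exists K%:R => t; rewrite ger0_norm ?trunc_ge0 ?trunc_le.
Qed.

(** Tests take values in the unit interval, hence the rescaling by [K] and the separate case
    [K = 0]. *)
Lemma trunc_average K :
  {ae P, forall t, (fun n => (\sum_(i < n) trunc K (hold i t)) / n%:R) @ \oo
     --> Ex P (fun t => trunc K (hold 0 t))}.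
Proof.
case: K => [|K].
  have E r : trunc 0 r = 0.
    by apply/eqP; rewrite eq_le trunc_le trunc_ge0.
  apply: aeW => t; rewrite (eq_Ex P (g := fun=> 0)) ?Ex_cst => [|s]; last exact: E.
  under eq_fun do (under eq_bigr do rewrite E; rewrite sumr_const mul0rn mul0r).
  exact: cvg_cst.
have K0 : 0 < K.+1%:R :> R by [].
pose phi r : R := K.+1%:R^-1 * trunc K.+1 r.
have tphi : test phi.
  split; first by apply: measurable_funM => //; exact: measurable_trunc.
  move=> r; rewrite /phi mulr_ge0 ?invr_ge0 ?trunc_ge0//=.
  by rewrite mulrC ler_pdivrMr// mul1r trunc_le.
apply: filterS (test_average tphi) => t h.
have E r : trunc K.+1 r = K.+1%:R * phi r by rewrite /phi mulrA mulfV ?gt_eqF// mul1r.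
have -> : Ex P (fun t => trunc K.+1 (hold 0 t)) = K.+1%:R * Ex P (fun t => phi (hold 0 t)).
  rewrite -ExZ; first by apply: eq_Ex => s; exact: E.
  by apply/intgZ/bmf_intg/bmf_trunc.
have -> : (fun n => (\sum_(i < n) trunc K.+1 (hold i t)) / n%:R) =
    (fun n => K.+1%:R * ((\sum_(i < n) phi (hold i t)) / n%:R)).
  apply/funext => n; rewrite mulrA mulr_sumr; congr (_ / _).
  by apply: eq_bigr => i _; exact: E.
by apply: cvgMr; exact: h.
Qed.

Lemma trunc_cvg : (Ex P (fun t => trunc K (hold 0 t)))%:E @[K --> \oo] -->
  (\int[P]_t (w 0 t)%:E)%E.
Proof.
rewrite -integral_hold_pos0.
have -> : (fun K => (Ex P (fun t => trunc K (hold 0 t)))%:E) =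
    (fun K => \int[P]_t (trunc K (hold 0 t))%:E)%E.
  by apply/funext => K; rewrite Ex_fin//; exact/bmf_intg/bmf_trunc.
have -> : (\int[P]_t (hold_pos 0 t)%:E =
    \int[P]_t limn (fun K => (trunc K (hold 0 t))%:E))%E.
  apply: eq_integral => t _; apply/esym/cvg_lim => //.
  apply: cvg_EFin; first exact: nearW.
  apply: cvg_near_cst.
  exists (Num.truncn (hold_pos 0 t)).+1 => // K /= hK.
  rewrite /trunc -/(hold_pos 0 t) min_l//; apply/ltW/(lt_le_trans (truncnS_gt _)).
  by rewrite ler_nat.
apply: cvg_monotone_convergence => //.
- by move=> K; apply/measurable_EFinP; exact: (proj1 (bmf_trunc K 0)).
- by move=> K t _; rewrite lee_fin trunc_ge0.
- by move=> t _ a b ab; rewrite lee_fin /trunc le_min !ge_min lexx/= orbC ler_nat ab.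
Qed.

Lemma hold_average_inf : (\int[P]_t (w 0 t)%:E = +oo)%E ->
  {ae P, forall t, forall A : R, exists N, forall n, (N <= n)%N ->
     A * n%:R <= \sum_(i < n) hold i t}.
Proof.
move=> wy; have := trunc_cvg; rewrite wy => cK.
have : {ae P, forall t, forall K, (fun n => (\sum_(i < n) trunc K (hold i t)) / n%:R)
   @ \oo --> Ex P (fun t => trunc K (hold 0 t))}.
  by apply: ae_foralln => K; exact: trunc_average.
apply: filterS2 hold_ge0 => t h0 hK A.
(* The extra one is spent on the error allowed to the truncated average. *)
have /cvgeyPgt /(_ (A + 1)) [K _ /(_ K (leqnn K))] := cK.
rewrite lte_fin => hA.
have /cvgrPdist_le /(_ 1 ltr01) [N _ hN] := hK K.
exists N.+1 => n nN; have := hN n (ltnW nN) => /=; rewrite ler_norml => /andP[_ h1].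
have n0 : 0 < n%:R :> R by rewrite ltr0n (leq_trans _ nN).
apply: le_trans (_ : \sum_(i < n) trunc K (hold i t) <= _).
  by rewrite -ler_pdivlMr//; lra.
by apply: ler_sum => i _; rewrite /trunc ge_min max_l ?lexx.
Qed.

(** Truncations bound the averages from below. From above, the excess [D K] over the truncation has
    mean tending to zero, and the maximal inequality keeps all its averages below [a] outside a rare
    event. *)
Lemma hold_average_fin (mu : R) : (\int[P]_t (w 0 t)%:E = mu%:E)%E ->
  {ae P, forall t, (fun n => (\sum_(i < n) hold i t) / n%:R) @ \oo --> mu}.
Proof.
move=> wmu; have cK := trunc_cvg; rewrite wmu in cK.
have ip : intg P (hold_pos 0).
  apply/integrableP; split; first by apply/measurable_EFinP; exact: measurable_hold_pos.
  under eq_integral do rewrite /= ger0_norm ?hold_pos_ge0//.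
  by rewrite integral_hold_pos0 wmu ltry.
have Ep : Ex P (hold_pos 0) = mu.
  by apply: EFin_inj; rewrite Ex_fin// integral_hold_pos0.
pose D K k t := hold_pos k t - trunc K (hold k t).
pose h K (g : cylT R (nat * bool)%type) : R := Num.max (g (0%N, true)) 0 - trunc K (g (0%N, true)).
have mh K : measurable_fun setT (h K).
  have mc := @measurable_coord R _ (0%N, true).
  apply: measurable_funB; last exact: (measurableT_comp (measurable_trunc K) mc).
  by apply: measurable_maxr => //; exact: measurable_cst.
have DE K : D K = (fun k t => h K (obs k t)).
  by apply/funext => k; apply/funext => t; rewrite /D /h /obs/= addn0.
have D0 K k t : 0 <= D K k t by rewrite subr_ge0 /trunc ge_min lexx.
have iD0 K : intg P (D K 0%N) by apply: intgB => //; exact/bmf_intg/bmf_trunc.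
(* Integrability at time [k] is carried over from time [0] by equality of laws. *)
have iD K k : intg P (D K k).
  have [mD _] := integrableP _ _ _ (iD0 K).
  apply/integrableP; split.
    apply/measurable_EFinP; apply: measurable_funB; first exact: measurable_hold_pos.
    exact: (proj1 (bmf_trunc K k)).
  have [_] := integrableP _ _ _ (iD0 K).
  rewrite !DE.
  have mabs : measurable_fun setT (fun g => `|(h K g)%:E|%E).
    by apply: measurableT_comp => //; exact/measurable_EFinP.
  have := ge0_integral_eq_law (measurable_obs M k) (measurable_obs M 0)
    (fun B => obs_law M k (B := B)) mabs (fun g => abse_ge0 _).
  by move=> /= ->.
have ED K k : Ex P (D K k) = Ex P (D K 0%N) by rewrite DE; exact: (Ex_obs M).
have ED0 K : Ex P (D K 0%N) = mu - Ex P (fun t => trunc K (hold 0 t)).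
  by rewrite ExB ?Ep//; exact/bmf_intg/bmf_trunc.
have sD K : exceeds_stationary P (D K) by rewrite DE; exact: (obs_exceeds M).
have /fine_cvgP[_ cK'] := cK.
have tr_le K : Ex P (fun t => trunc K (hold 0 t)) <= mu.
  by rewrite -subr_ge0 -ED0; apply: Ex_ge0.
have upper (a : R) : 0 < a -> {ae P, forall t, exists N, forall n, (N <= n)%N ->
    \sum_(i < n) hold_pos i t <= (mu + 2 * a) * n%:R}.
  move=> a0.
  have trav : {ae P, forall t, forall K, (fun n => (\sum_(i < n) trunc K (hold i t)) / n%:R)
       @ \oo --> Ex P (fun t => trunc K (hold 0 t))}.
    by apply: ae_foralln => K; exact: trunc_average.
  have excess : {ae P, forall t, exists K, forall n, \sum_(i < n) D K i t <= a * n%:R}.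
    apply: ae_small => e e0.
    have /cvgrPdist_le /(_ (e * a) (mulr_gt0 e0 a0)) [K _ /(_ K (leqnn K))/=] := cK'.
    rewrite -ED0 ger0_norm => [hK|]; last exact: Ex_ge0.
    have [mM hM] := maximal_inequality (D0 K) (iD K) (ED K) (sD K) a0.
    exists [set t | exists n, exceeds (D K ^~ t) a n 0]; split => //.
      by apply: le_trans hM _; rewrite lee_fin ler_pdivrMr.
    move=> t nt; exists K => -[|n]; first by rewrite big_ord0 mulr0.
    rewrite leNgt; apply/negP => hn; apply: nt; exists n.+1.
    by apply/exceedsP; exists n.+1.
  apply: filterS2 trav excess => t hK [K hD].
  have /cvgrPdist_le /(_ a a0) [N _ hN] := hK K.
  exists N.+1 => n nN; have := hN n (ltnW nN) => /=; rewrite ler_norml => /andP[h1 _].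
  have n0 : 0 < n%:R :> R by rewrite ltr0n (leq_trans _ nN).
  have h2 : \sum_(i < n) trunc K (hold i t) <= (mu + a) * n%:R.
    by rewrite -ler_pdivrMr//; have := tr_le K; lra.
  have := hD n; rewrite /D sumrB; lra.
have {upper} : {ae P, forall t, forall j : nat, exists N, forall n, (N <= n)%N ->
    \sum_(i < n) hold_pos i t <= (mu + 2 * j.+1%:R^-1) * n%:R}.
  by apply: ae_foralln => j; apply: upper; rewrite invr_gt0.
have : {ae P, forall t, forall K, (fun n => (\sum_(i < n) trunc K (hold i t)) / n%:R)
     @ \oo --> Ex P (fun t => trunc K (hold 0 t))}.
  by apply: ae_foralln => K; exact: trunc_average.
apply: filterS3 hold_ge0 => t h0 hK up; apply: average_cvg => e e0.
have e2 : 0 < e / 2 by rewrite divr_gt0.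
have [j je] : exists m : nat, m.+1%:R^-1 < e / 2.
  exists (Num.truncn (e / 2)^-1); rewrite -[ltRHS]invrK ltf_pV2 ?posrE ?invr_gt0//.
  by rewrite truncnS_gt.
have [N1 hN1] := up j.
have /cvgrPdist_le /(_ _ e2) [K _ /(_ K (leqnn K))/= kK] := cK'.
have /cvgrPdist_le /(_ _ e2) [N2 _ hN2] := hK K.
have holdE n : \sum_(i < n) hold_pos i t = \sum_(i < n) hold i t.
  by apply: eq_bigr => i _; rewrite /hold_pos max_l.
exists (maxn N1 N2.+1) => n; rewrite geq_max => /andP[n1 n2].
have n0 : 0 < n%:R :> R by rewrite ltr0n (leq_trans _ n2).
have := hN1 n n1; rewrite holdE => u1.
have := hN2 n (ltnW n2) => /=; rewrite ler_norml => /andP[_ h1].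
have l1 : \sum_(i < n) trunc K (hold i t) <= \sum_(i < n) hold i t.
  by apply: ler_sum => i _; rewrite /trunc ge_min max_l ?lexx.
have l2 : (mu - e) * n%:R <= \sum_(i < n) trunc K (hold i t).
  by rewrite -ler_pdivlMr//; move: kK; rewrite ler_norml => /andP[_ ?]; lra.
have l3 : 2 * j.+1%:R^-1 * n%:R <= e * n%:R by apply: ler_wpM2r => //; move: je; set x := j.+1%:R^-1 => je; lra.
move: u1 l3; set x := j.+1%:R^-1 => u1 l3.
by rewrite ler_norml; apply/andP; split; lra.
Qed.

End Nonnegative.

End HoldingTimes.

(** * Clocks that run backwards *)

Section NegativeHolding.
Context (R : realType) (d : measure_display) (T : measurableType d).
Variable P : probability T R.
Variables (xi : nat -> T -> int) (w : int -> T -> R) (tau : int -> nat -> T -> R -> R).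
Variable p : R.
Hypothesis M : rw_model P xi w tau p.
Local Notation hold := (hold xi w tau).
Local Notation env := (env w).
Local Notation prod_tests := (prod_tests xi w tau).
Local Notation value := (value P tau p).
Local Notation pos := (pos xi).

Definition clock (n : nat) t : R := \sum_(k < n) hold k t.

Lemma clockS n t : clock n.+1 t = clock n t + hold n t.
Proof. by rewrite /clock big_ord_recr. Qed.

Lemma Ex0_ae (f : T -> R) : bmf f -> (forall t, 0 <= f t) -> Ex P f = 0 ->
  {ae P, forall t, f t = 0}.
Proof.
move=> bf f0 Ef; have mf : measurable_fun setT (EFin \o f).
  by apply/measurable_EFinP; exact: (proj1 bf).
have : ae_eq P setT (EFin \o f) (cst 0%E).
  apply/(ae_eq_integral_abs P measurableT mf).
  rewrite -[RHS](_ : (Ex P f)%:E = 0%E); last by rewrite Ef.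
  rewrite Ex_fin; last exact: bmf_intg.
  by apply: eq_integral => t _; rewrite gee0_abs// lee_fin.
by apply: filterS => t /(_ I) [].
Qed.

Definition ind (A : set R) (r : R) : R := `[< A r >]%:R.

Lemma test_ind (A : set R) : measurable A -> test (ind A).
Proof.
move=> mA; split; last by move=> r; rewrite /ind; case: asboolP; rewrite ?ler01 ?lexx.
rewrite (_ : ind A = \1_A); first exact: measurable_indic.
by apply/funext => r; rewrite indicE /ind; congr (_%:R); congr nat_of_bool;
  apply/asboolP/idP => [h|]; rewrite inE.
Qed.

Definition above (e : R) : set R := [set r | e < r].
Definition between (a b : R) : set R := [set r | a < r /\ r < b].
Definition below (b : R) : set R := [set r | r < b].

Lemma measurable_above e : measurable (above e).
Proof.
rewrite -[X in measurable X]setTI.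
by apply: measurable_fun_ltr => //; exact: measurable_cst.
Qed.

Lemma measurable_below e : measurable (below e).
Proof.
rewrite -[X in measurable X]setTI.
by apply: measurable_fun_ltr => //; exact: measurable_cst.
Qed.

Lemma measurable_between a b : measurable (between a b).
Proof. exact: (measurableI _ _ (measurable_above a) (measurable_below b)). Qed.

Lemma psi_ind0 (A : set R) r : measurable A -> psi P tau (ind A) r <= 0 ->
  {ae P, forall t, ~ A (tau 0 0%N t (Num.max r 0))}.
Proof.
move=> mA psi0; have tA := test_ind mA; have [mi i01] := tA.
have b : bmf (fun t => ind A (tau 0 0%N t (Num.max r 0))).
  by apply: bmf01 => //; apply: (measurableT_comp mi); exact: (mtau M) (max0_ge0 r).
have h : psi P tau (ind A) r = 0.
  by apply/eqP; rewrite eq_le psi0/=; have /andP[] := psi01 M r tA.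
have := Ex0_ae b (fun t => proj1 (andP (i01 _))) h.
by apply: filterS => t /eqP; rewrite /ind pnatr_eq0 eqb0 => /asboolP.
Qed.

Lemma ae_false : ~ {ae P, forall t, False}.
Proof.
move=> [N [mN N0 sub]]; have : (P setT <= P N)%E.
  by apply: le_measure; rewrite ?inE// => t _; apply: sub.
by rewrite N0 probability_setT lee_fin ler10.
Qed.

(** An almost surely nonpositive variable cannot have the positive mean [r]. *)
Lemma psi_above_gt0 r : 0 < r -> 0 < psi P tau (ind (above 0)) r.
Proof.
move=> r0; rewrite ltNge; apply/negP => /(psi_ind0 (measurable_above 0)).
rewrite max_l ?(ltW r0)// => h.
have [it Et] := tau_mean M 0 0%N (ltW r0).
have it' : intg P (fun t => tau 0 0%N t r) by [].
have Er : Ex P (fun t => tau 0 0%N t r) = r by apply: EFin_inj; rewrite Ex_fin.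
have ia : intg P (fun t => `|tau 0 0%N t r|) by exact: (integrable_norm it').
have : Ex P (fun t => tau 0 0%N t r) = Ex P (fun t => -1 * `|tau 0 0%N t r|).
  have mt := mtau M 0 0%N (ltW r0).
  apply: Ex_ae => //; first by apply: measurable_funM => //; exact: measurableT_comp.
  apply: filterS h => t /negP; rewrite -leNgt => h.
  by rewrite ler0_norm// mulN1r opprK.
rewrite ExZ// Er => E.
have : 0 <= Ex P (fun t => `|tau 0 0%N t r|) by apply: Ex_ge0.
by move: E; lra.
Qed.

Lemma psi_above_inv r : 0 < r ->
  exists n : nat, 0 < psi P tau (ind (above n.+1%:R^-1)) r.
Proof.
move=> r0; apply: contrapT => /forallNP h.
have := psi_above_gt0 r0; rewrite lt0r => /andP[/eqP + _]; apply.
have : {ae P, forall t, forall n : nat, ~ above n.+1%:R^-1 (tau 0 0%N t (Num.max r 0))}.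
  apply: ae_foralln => n; apply: psi_ind0; first exact: measurable_above.
  by rewrite leNgt; apply/negP; exact: h.
move=> ae; rewrite -[RHS](Ex_cst P); apply: Ex_ae.
- apply: (measurableT_comp (proj1 (test_ind (measurable_above 0)))).
  exact: (mtau M) (max0_ge0 r).
- exact: measurable_cst.
- apply: filterS ae => t ht; rewrite /ind asboolF//= => /= t0.
  apply: (ht (Num.truncn (tau 0 0%N t (Num.max r 0))^-1)).
  by rewrite /above/= -[ltRHS]invrK ltf_pV2 ?posrE ?invr_gt0// truncnS_gt.
Qed.

Lemma psi_between r : 0 < psi P tau (ind (below 0)) r ->
  exists n : nat, 0 < psi P tau (ind (between (- n.+1%:R) 0)) r.
Proof.
move=> psi0; apply: contrapT => /forallNP h.
move: psi0; rewrite lt0r => /andP[/eqP + _]; apply.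
have : {ae P, forall t, forall n : nat, ~ between (- n.+1%:R) 0 (tau 0 0%N t (Num.max r 0))}.
  apply: ae_foralln => n; apply: psi_ind0; first exact: measurable_between.
  by rewrite leNgt; apply/negP; exact: h.
move=> ae; rewrite -[RHS](Ex_cst P); apply: Ex_ae.
- apply: (measurableT_comp (proj1 (test_ind (measurable_below 0)))).
  exact: (mtau M) (max0_ge0 r).
- exact: measurable_cst.
- apply: filterS ae => t ht; rewrite /ind asboolF//= => /= t0.
  apply: (ht (Num.truncn (- tau 0 0%N t (Num.max r 0)))); split => //.
  by rewrite ltrNl truncnS_gt.
Qed.

(* The walk oscillates [m] times between a site and its right neighbour, then
   moves two sites to the right; the clock advances by more than [e] at each
   visit of the first site, jumps back by less than [b] at the last visit of
   the second one, and advances again at the third site. *)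
Fixpoint backward_path (e b : R) (m : nat) : seq (int * (R -> R)) :=
  if m is m'.+1 then [:: (1, ind (above e)), (-1, ind (above 0)) & backward_path e b m']
  else [:: (1, ind (above e)); (1, ind (between (- b) 0)); (1, ind (above 0))].

Lemma good_backward_path e b m : good (path_tests (backward_path e b m)).
Proof.
have z01 (e' z : int) : 0 <= ((z == e')%:R : R) <= 1.
  by case: (z == e'); rewrite ?ler01 ?lexx.
have ta e' := test_ind (measurable_above e').
have tb := test_ind (measurable_between (- b) 0).
elim: m => [|m IH].
  split; [exact: z01|exact: ta|split; [exact: z01|exact: tb|]].
  by split; [exact: z01|exact: ta|].
by split; [exact: z01|exact: ta|split; [exact: z01|exact: ta|exact: IH]].
Qed.

(** The oscillation always returns to [x], so conditions at three sites make every factor along the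
    path positive, whatever [m] is. *)
Lemma value_backward_path e b m x g :
  0 < psi P tau (ind (above e)) (g x) ->
  0 < psi P tau (ind (above 0)) (g (x + 1)) ->
  0 < psi P tau (ind (between (- b) 0)) (g (x + 1)) ->
  0 < psi P tau (ind (above 0)) (g (x + 1 + 1)) ->
  0 < value (path_tests (backward_path e b m)) x g.
Proof.
have /andP[pl pr] := p01 M; have p0 : 0 < p by lra.
have q0 : 0 < 1 - p by lra.
move=> h0 h1 h2 h3.
elim: m => [|m IH] /=.
  by rewrite !mulr0 !mul0r !addr0 !mulr1 !mulr_gt0.
by rewrite !mulr0 !mul0r !addr0 !add0r !mulr1 addrK !mulr_gt0.
Qed.

(** [K] is the last visit to the second site. Up to [K] the clock only moves forward, by more than
    [e] at each visit of the first site, and every instant it covers is assigned to one of the first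
    two sites. *)
Lemma backward_pathP e b m k t : 0 <= e ->
  prod_tests (path_tests (backward_path e b m)) k t != 0 ->
  exists K, [/\ pos K.+1 t = pos k t + 2, m%:R * e <= clock K t - clock k t,
    (forall u, clock k t <= u < clock K t -> exists2 j,
       pos j t = pos k t \/ pos j t = pos k t + 1 & clock j t <= u < clock j.+1 t),
    e < clock K t - clock k t - m%:R * e & - b < hold K t < 0 /\ 0 < hold K.+1 t].
Proof.
move=> e0; elim: m k => [|m IH] k.
  rewrite /= !mulf_eq0 !negb_or !pnatr_eq0 !eqb0 !negbK /ind.
  move=> /andP[/andP[/eqP x1 /asboolP h1] /andP[/andP[/eqP x2 /asboolP[h2 h2']]
    /andP[/andP[/eqP x3 /asboolP h3] _]]].
  exists k.+1; rewrite !posS x1 x2 clockS; split.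
  - by rewrite -addrA.
  - by rewrite mul0r; move: h1; rewrite /above/=; lra.
  - by move=> u hu; exists k; [left|rewrite clockS].
  - by rewrite mul0r; move: h1; rewrite /above/=; lra.
  - by rewrite h2 h2'.
rewrite /= !mulf_eq0 !negb_or !pnatr_eq0 !eqb0 !negbK /ind.
move=> /andP[/andP[/eqP x1 /asboolP h1] /andP[/andP[/eqP x2 /asboolP h2] /IH]].
have p1 : pos k.+1 t = pos k t + 1 by rewrite posS x1.
have p2 : pos k.+2 t = pos k t by rewrite posS x2 p1 addrK.
have c1 := clockS k t; have c2 := clockS k.+1 t.
move: h1 h2; rewrite /above/= => h1 h2.
move=> [K [q1 q2 q3 q4 q5]]; exists K; rewrite p2 in q1 q3.
split => //.
- by rewrite -[m.+1%:R]natr1 mulrDl mul1r; lra.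
- move=> u /andP[u1 u2].
  have [uk|ku] := ltP u (clock k.+1 t); first by exists k; [left|rewrite u1].
  have [uk2|ku2] := ltP u (clock k.+2 t).
    by exists k.+1; [right|rewrite ku].
  by apply: q3; rewrite ku2.
- by rewrite -[m.+1%:R]natr1 mulrDl mul1r; lra.
Qed.

Theorem negative_inconsistent : ~ {ae P, forall t, 0 <= hold 0 t} ->
  {ae P, forall t, forall X : R -> int,
    ~ (forall (k : nat) s, clock k t <= s < clock k.+1 t -> X s = pos k t)}.
Proof.
move=> nh.
(* With [e = 1 / (n0 + 1)] and [b = n1 + 1] this gives [m * e = b], so the clock has gained more
   than the jump back can undo. *)
pose m (n0 n1 : nat) := ((n0.+1 * n1.+1)%N).
pose l n0 n1 := path_tests (backward_path n0.+1%:R^-1 n1.+1%:R (m n0 n1)).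
have gl n0 n1 : good (l n0 n1) by exact: good_backward_path.
have tb := test_ind (measurable_below 0).
have bv n0 n1 : bmf (fun t => value (l n0 n1) 0 (env t)) by exact: (bmf_value M).
have v0 n0 n1 t : 0 <= value (l n0 n1) 0 (env t) by have /andP[] := value01 M 0 (env t) (gl n0 n1).
(* Otherwise negative times would almost surely have probability zero at site [1], the site where
   the jump back occurs; by stationarity the same holds at site [0], and [hold 0] would be almost
   surely nonnegative. *)
have [n0 [n1 mean0]] : exists n0 n1, Ex P (fun t => value (l n0 n1) 0 (env t)) <> 0.
  apply: contrapT => /forallNP h; apply: nh.
  have vae : {ae P, forall t, forall n0 n1 : nat, value (l n0 n1) 0 (env t) = 0}.
    apply: ae_foralln => n0; apply: ae_foralln => n1.
    apply: Ex0_ae => //.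
    by apply: contrapT => h'; apply: (h n0); exists n1.
  have bpsi x : bmf (fun t => psi P tau (ind (below 0)) (w x t)).
    apply: bmf01 => [|t]; last exact: (psi01 M).
    exact: (measurableT_comp (measurable_psi M tb) (mw M x)).
  have psi0 : {ae P, forall t, psi P tau (ind (below 0)) (w 1 t) = 0}.
    apply: filterS vae => t ht; apply/eqP; rewrite eq_le; apply/andP; split; last first.
      by have /andP[] := psi01 M (w 1 t) tb.
    rewrite leNgt; apply/negP => /psi_between [n1 h1].
    have [n0 h0] := psi_above_inv (w_gt0 M 0 t).
    have := value_backward_path (e := n0.+1%:R^-1) (b := n1.+1%:R) (m n0 n1) (x := 0) (g := env t) h0.
    rewrite -/(l n0 n1) ht ltxx add0r => /(_ (psi_above_gt0 (w_gt0 M 1 t)) h1).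
    by move=> /(_ (psi_above_gt0 (w_gt0 M (1 + 1) t))).
  have E1 : Ex P (fun t => psi P tau (ind (below 0)) (w 1 t)) = 0.
    rewrite -[RHS](Ex_cst P); apply: Ex_ae; [|exact: measurable_cst|exact: psi0].
    exact: (proj1 (bpsi 1)).
  have E0 : Ex P (fun t => psi P tau (ind (below 0)) (w 0 t)) = 0.
    have mh : measurable_fun setT (fun g : cylT R int => psi P tau (ind (below 0)) (g 0)).
      exact: (measurableT_comp (measurable_psi M tb) (@measurable_coord R _ (0 : int))).
    transitivity (Ex P (fun t => psi P tau (ind (below 0)) (w 1 t))); last exact: E1.
    exact: (esym (Ex_shift_env M 1 mh)).
  have bh : bmf (fun t => ind (below 0) (hold 0 t)).
    apply: bmf01 => [|t]; last exact: (proj2 tb).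
    by apply: (measurableT_comp (proj1 tb)); exact: (measurable_hold M).
  have : Ex P (fun t => ind (below 0) (hold 0 t)) = 0.
    pose l0 := [:: ((fun=> 1) : int -> R, ind (below 0))].
    have gl0 : good l0 by split => // z; rewrite ler01 lexx.
    rewrite (eq_Ex P (g := prod_tests l0 0)) => [|t]; last by rewrite /= mul1r mulr1.
    rewrite (Ex_prod_tests0 M gl0) -[RHS]E0.
    by apply: eq_Ex => t /=; rewrite /env; ring.
  move=> /(Ex0_ae bh) ha; apply: filterS (ha _) => [t|t]; last first.
    by have /andP[] := proj2 tb (hold 0 t).
  move=> /eqP; rewrite /ind pnatr_eq0 eqb0 => /asboolP /= /negP.
  by rewrite -leNgt.
have := path_average M (good_backward_path n0.+1%:R^-1 n1.+1%:R (m n0 n1)).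
apply: filterS => t cv X cons.
(* If the pattern never occurred, all averages would be zero, against their nonzero limit. *)
have [k hk] : exists k, prod_tests (l n0 n1) k t != 0.
  apply: contrapT => /forallNP h; apply: mean0.
  have E : (fun n => (\sum_(i < n) prod_tests (l n0 n1) i t) / n%:R) = (fun=> 0).
    apply/funext => n; rewrite big1 ?mul0r// => i _.
    by apply/eqP; have /negP := h i; rewrite negbK.
  move: cv; rewrite E => cv.
  by rewrite -(cvg_lim (@Rhausdorff R) cv) lim_cst.
have e0 : 0 <= n0.+1%:R^-1 :> R by rewrite invr_ge0.
have [K [q1 q2 q3 q4 [/andP[q5 q6] q7]]] := backward_pathP e0 hk.
have me : (m n0 n1)%:R * n0.+1%:R^-1 = n1.+1%:R :> R.
  by rewrite /m natrM mulrAC mulfV ?mul1r// pnatr_eq0.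
rewrite me in q2 q4.
have cK := clockS K t; have cK1 := clockS K.+1 t.
(* The instant [clock K.+1] falls back into the interval assigned to the first two sites, whereas
   [hold K.+1 > 0] assigns it to the third. *)
have [|j yj cj] := q3 (clock K.+1 t); first by apply/andP; split; lra.
have := cons j _ cj; rewrite (cons K.+1); last by rewrite cK1 lexx/=; lra.
by rewrite q1; case: yj => ->; lia.
Qed.

End NegativeHolding.

(** * Escape probability *)

Section BoundedHarmonic.
Context (R : realType).

Lemma harmonic_increments (a : nat -> R) (alpha : R) : 0 < alpha ->
  a 0%N = 0 -> (forall x, a x.+1 = alpha * a x.+2 + (1 - alpha) * a x) ->
  forall x, a x.+1 - a x = ((1 - alpha) / alpha) ^+ x * a 1%N.
Proof.
move=> al0 a0 ha; elim=> [|x IH]; first by rewrite a0 expr0 mul1r subr0.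
rewrite exprS -mulrA -IH; have := ha x => E.
apply: (mulfI (lt0r_neq0 al0)).
rewrite [RHS](_ : _ = (1 - alpha) * (a x.+1 - a x)); first by lra.
by field; rewrite gt_eqF.
Qed.

(** Summing the geometric increments gives [(1 - rho) * a x = a 1 * (1 - rho ^+ x)]; bound [a x] by
    one and let [x] grow. *)
Lemma harmonic_transient (a : nat -> R) (alpha : R) : 2^-1 < alpha < 1 ->
  a 0%N = 0 -> (forall x, a x.+1 = alpha * a x.+2 + (1 - alpha) * a x) ->
  (forall x, a x <= 1) -> a 1%N <= 1 - (1 - alpha) / alpha.
Proof.
move=> /andP[al1 al2] a0 ha a1; have al0 : 0 < alpha by lra.
have inc := harmonic_increments al0 a0 ha.
have [rho rhoE] : {rho : R | rho = (1 - alpha) / alpha} by exists ((1 - alpha) / alpha).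
rewrite -rhoE in inc *.
have rho0 : 0 < rho by rewrite rhoE divr_gt0//; lra.
have rho1 : rho < 1 by rewrite rhoE ltr_pdivrMr//; lra.
have aE x : (1 - rho) * a x = a 1%N * (1 - rho ^+ x).
  elim: x => [|x IH]; first by rewrite a0 expr0; ring.
  rewrite -[a x.+1](subrK (a x)) mulrDr IH inc exprS; ring.
have lim : (fun x => a 1%N * (1 - rho ^+ x)) @ \oo --> a 1%N * (1 - 0).
  apply: cvgMr; apply: cvgB; first exact: cvg_cst.
  by apply: cvg_expr; rewrite ger0_norm ?ltW.
rewrite subr0 mulr1 in lim.
rewrite -(cvg_lim (@Rhausdorff R) lim); apply: limr_le; first exact: cvgP lim.
by apply: nearW => x; rewrite -aE -[leRHS]mulr1 ler_pM2l ?subr_gt0.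
Qed.

(** The increments are nondecreasing here, so [a x >= x * a 1], which boundedness allows only for
    [a 1 = 0]. *)
Lemma harmonic_recurrent (a : nat -> R) (alpha : R) : 0 < alpha < 2^-1 ->
  a 0%N = 0 -> (forall x, a x.+1 = alpha * a x.+2 + (1 - alpha) * a x) ->
  (forall x, 0 <= a x <= 1) -> a 1%N = 0.
Proof.
move=> /andP[al0 al2] a0 ha a01.
have inc := harmonic_increments al0 a0 ha.
have rho1 : 1 <= (1 - alpha) / alpha by rewrite ler_pdivlMr//; lra.
have /andP[a10 _] := a01 1%N.
have grow x : x%:R * a 1%N <= a x.
  elim: x => [|x IH]; first by rewrite mul0r a0.
  rewrite -natr1 mulrDl mul1r -[leRHS](subrK (a x)) addrC lerD// inc.
  by rewrite ler_peMl// exprn_ege1.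
apply/eqP; rewrite eq_le a10 andbT leNgt; apply/negP => a1p.
have := grow (Num.truncn (a 1%N)^-1).+1; have /andP[_] := a01 (Num.truncn (a 1%N)^-1).+1.
move=> h1 h2; have := le_trans h2 h1; rewrite leNgt => /negP; apply.
by rewrite -ltr_pdivrMr// mul1r truncnS_gt.
Qed.

End BoundedHarmonic.

Section Escape.
Context (R : realType) (d : measure_display) (T : measurableType d).
Variable P : probability T R.
Variables (xi : nat -> T -> int) (w : int -> T -> R) (tau : int -> nat -> T -> R -> R).
Variable p : R.
Hypothesis M : rw_model P xi w tau p.
Local Notation pos := (pos xi).
Local Notation Jm := (Jmeas xi w tau).

(** The probability that the walk started at [x] stays off [0] at all times from [0] to [n]. *)
Fixpoint avoid (n : nat) (x : int) : R :=
  if n is n'.+1 then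
    if x == 0 then 0 else p * avoid n' (x + 1) + (1 - p) * avoid n' (x - 1)
  else (x != 0)%:R.

Definition avoids (n j : nat) t : bool := [forall k : 'I_n.+1, pos (j + k)%N t != 0].

Lemma avoidsS n j t : avoids n.+1 j t = (pos j t != 0) && avoids n j.+1 t.
Proof.
apply/forallP/andP => [h|[h0 /forallP h] k].
  split; first by have := h ord0; rewrite addn0.
  by apply/forallP => k; have := h (lift ord0 k); rewrite lift0 addnS.
case: (unliftP ord0 k) => [k' ->|->]; last by rewrite addn0.
by rewrite lift0 addnS; exact: h.
Qed.

Lemma avoids0 j t : avoids 0 j t = (pos j t != 0).
Proof.
apply/forallP/idP => [/(_ ord0)|h k]; first by rewrite addn0.
by rewrite (ord1 k) addn0.
Qed.

Lemma measurable_avoids n j : measurable_fun setT (fun t => (avoids n j t)%:R : R).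
Proof.
elim: n j => [|n IH] j.
  under eq_fun do rewrite avoids0.
  apply: (measurable_count_case (f := pos j) (g := fun z _ => (z != 0)%:R)).
    exact: (measurable_pos M).
  by move=> z; exact: measurable_cst.
rewrite (_ : (fun t => _) = (fun t => (pos j t != 0)%:R * (avoids n j.+1 t)%:R)).
  apply: measurable_funM => //.
  apply: (measurable_count_case (f := pos j) (g := fun z _ => (z != 0)%:R)).
    exact: (measurable_pos M).
  by move=> z; exact: measurable_cst.
by apply/funext => t; rewrite avoidsS -natrM mulnb.
Qed.

(** The same one-step scheme as in [markov], without holding times: [U] carries the past and pins
    the position. *)
Lemma Ex_avoids n j x (U : T -> R) : Jm (past j) U -> (forall t, 0 <= U t <= 1) ->
  (forall t, U t != 0 -> pos j t = x) ->
  Ex P (fun t => U t * (avoids n j t)%:R) = Ex P U * avoid n x.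
Proof.
have bJ J f : Jm J f -> (forall t, 0 <= f t <= 1) -> bmf f.
  by move=> mf f01; apply: bmf01 => //; exact: (Jmeas_measurable M mf).
elim: n j x U => [|n IH] j x U mU U01 Ux.
  rewrite mulrC -ExZ; last by apply: bmf_intg; exact: bJ mU U01.
  apply: eq_Ex => t; rewrite mulrC.
  have [->|/Ux <-] := eqVneq (U t) 0; first by rewrite !mulr0.
  by rewrite avoids0.
have [x0|x0] := eqVneq x 0.
  rewrite /= x0 eqxx mulr0 -[RHS](Ex_cst P); apply: eq_Ex => t; rewrite avoidsS.
  have [->|/Ux ->] := eqVneq (U t) 0; first by rewrite mul0r.
  by rewrite x0 eqxx mulr0.
pose Ue (e : int) t := U t * (xi j t == e)%:R.
have mUe e : Jm (past j.+1) (Ue e).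
  apply: measurable_funM; first by apply: (Jmeas_sub _ mU); exact: past_sub.
  by apply: (@Jmeas_xi R d T xi w tau (past j.+1) j (fun z => (z == e)%:R)) => /=.
have Ue01 e t : 0 <= Ue e t <= 1.
  have := U01 t; rewrite /Ue.
  by case: (xi j t == e); rewrite ?mulr1 ?mulr0 ?ler01 ?lexx.
have Uex e t : Ue e t != 0 -> pos j.+1 t = x + e.
  rewrite /Ue mulf_eq0 negb_or => /andP[/Ux <-].
  by case: (xi j t =P e) => [<-|]; rewrite ?posS// eqxx.
have EUe e : Ex P (Ue e) = Ex P (fun t => (xi j t == e)%:R) * Ex P U.
  apply: (peel_xi M (J := past j) (h := fun z => (z == e)%:R)) => //.
  - by rewrite /= ltnn.
  - by apply: bmf_intg; exact: bJ mU U01.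
  - by move=> t; have /andP[] := U01 t.
  - by move=> z; case: (z == e); rewrite ?ler01 ?lexx.
have bA : bmf (fun t => (avoids n j.+1 t)%:R : R).
  apply: bmf01 => [|t]; first exact: measurable_avoids.
  by case: (avoids _ _ _); rewrite ?ler01 ?lexx.
have bUA e : bmf (fun t => Ue e t * (avoids n j.+1 t)%:R).
  by apply: bmfM => //; exact: bJ (mUe e) (Ue01 e).
transitivity (Ex P (fun t => Ue 1 t * (avoids n j.+1 t)%:R + Ue (-1) t * (avoids n j.+1 t)%:R)).
  apply: Ex_ae.
  - apply: measurable_funM; last exact: measurable_avoids.
    exact: (Jmeas_measurable M mU).
  - by apply: measurable_funD; exact: (proj1 (bUA _)).
  - apply: filterS (xi_pm M j) => t xit; rewrite avoidsS /Ue.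
    have [->|/Ux ->] := eqVneq (U t) 0; first by rewrite !mul0r addr0.
    by rewrite x0; case: xit => -> /=; ring.
rewrite ExD; [|exact: bmf_intg|exact: bmf_intg].
rewrite !(IH _ _ _ (mUe _) (Ue01 _) (Uex _)) !EUe !(Ex_xi M) /= (negbTE x0).
by ring.
Qed.

Lemma avoid01 n x : 0 <= avoid n x <= 1.
Proof.
have /andP[pl pr] := p01 M.
elim: n x => [|n IH] x /=; first by case: (x != 0); rewrite ?ler01 ?lexx.
case: (x == 0); first by rewrite lexx ler01.
have /andP[a0 a1] := IH (x + 1); have /andP[b0 b1] := IH (x - 1).
by apply/andP; split; nra.
Qed.

Lemma avoid_le n x : avoid n.+1 x <= avoid n x.
Proof.
have /andP[pl pr] := p01 M.
elim: n x => [|n IH] x.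
  rewrite /=; case: (x == 0) => //=.
  by case: (_ != 0); case: (_ != 0) => /=; lra.
rewrite [avoid n.+2 x]/=; rewrite [avoid n.+1 x]/=.
case: (x == 0) => //; have := IH (x + 1); have := IH (x - 1).
by rewrite /= => h1 h2; rewrite lerD// ler_wpM2l//; lra.
Qed.

Let escape x : R := limn (fun n => avoid n x).

Lemma is_cvg_avoid x : cvgn (fun n => avoid n x).
Proof.
apply: nonincreasing_is_cvgn.
  by apply/nonincreasing_seqP => n; exact: avoid_le.
by exists 0 => _ [n _ <-]; have /andP[] := avoid01 n x.
Qed.

Lemma cvg_avoid x : (fun n => avoid n x) @ \oo --> escape x.
Proof. exact: is_cvg_avoid. Qed.

Lemma escape01 x : 0 <= escape x <= 1.
Proof.
apply/andP; split.
  by apply: limr_ge; [exact: is_cvg_avoid|apply: nearW => n; have /andP[] := avoid01 n x].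
by apply: limr_le; [exact: is_cvg_avoid|apply: nearW => n; have /andP[] := avoid01 n x].
Qed.

Lemma escape0 : escape 0 = 0.
Proof. by rewrite /escape (_ : (fun n => _) = cst 0) ?lim_cst//; apply/funext => -[|n]. Qed.

Lemma escape_harmonic x : x != 0 -> escape x = p * escape (x + 1) + (1 - p) * escape (x - 1).
Proof.
move=> x0.
have h1 : (fun n => avoid n.+1 x) @ \oo --> escape x.
  by have := @cvg_avoid x; rewrite -cvg_shiftS; exact.
have h2 : (fun n => avoid n.+1 x) @ \oo --> p * escape (x + 1) + (1 - p) * escape (x - 1).
  under eq_fun do rewrite /= (negbTE x0).
  by apply: cvgD; apply: cvgMr; exact: cvg_avoid.
rewrite -[LHS](cvg_lim (@Rhausdorff R) h1); exact: (cvg_lim (@Rhausdorff R) h2).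
Qed.

(** [1 - rho ^+ x] is harmonic, vanishes at [0] and is at most one, so it stays below [avoid n] by
    induction. This shows that the upper bound of [harmonic_transient] is attained. *)
Lemma avoid_ge n (x : nat) : 1 - ((1 - p) / p) ^+ x <= avoid n x%:Z.
Proof.
have /andP[pl pr] := p01 M; have p0 : 0 < p by lra.
have [rho rhoE] : {rho : R | rho = (1 - p) / p} by exists ((1 - p) / p).
have rp : rho * p = 1 - p by rewrite rhoE divfK ?gt_eqF.
rewrite -rhoE; have rho0 : 0 <= rho by rewrite rhoE divr_ge0; lra.
elim: n x => [|n IH] [|x]; rewrite ?expr0 ?subrr//=.
  by rewrite lerBlDr lerDl exprn_ge0.
have h1 := IH x.+2; have h2 := IH x.
rewrite (_ : x.+1%:Z + 1 = x.+2%:Z); last by rewrite -PoszD addn1.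
rewrite (_ : x.+1%:Z - 1 = x%:Z); last by rewrite -addn1 PoszD addrK.
apply: le_trans (_ : p * (1 - rho ^+ x.+2) + (1 - p) * (1 - rho ^+ x) <= _); last first.
  by rewrite lerD// ler_wpM2l//; lra.
rewrite -rp !exprS le_eqVlt; apply/orP; left; apply/eqP.
have -> : p * (1 - rho * (rho * rho ^+ x)) + rho * p * (1 - rho ^+ x) =
  p + rho * p - rho * rho ^+ x * (rho * p + p) by ring.
by rewrite rp; ring.
Qed.

Lemma escape1 : escape 1 = 1 - (1 - p) / p.
Proof.
have pt := p01 M.
apply/eqP; rewrite eq_le; apply/andP; split.
  apply: (@harmonic_transient _ (fun x : nat => escape x%:Z) p) => //.
  - exact: escape0.
  - move=> x; rewrite (@escape_harmonic x.+1%:Z)//.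
    have -> : x.+1%:Z + 1 = x.+2%:Z by rewrite -PoszD addn1.
    by have -> : x.+1%:Z - 1 = x%:Z by rewrite -addn1 PoszD addrK.
  - by move=> x; have /andP[] := escape01 x%:Z.
apply: limr_ge; first exact: is_cvg_avoid.
by apply: nearW => n; have := avoid_ge n 1; rewrite expr1.
Qed.

(** Reflected to the positive side, the walk moves away from [0] with probability [1 - p], below one
    half. *)
Lemma escapeN1 : escape (-1) = 0.
Proof.
have /andP[pl pr] := p01 M.
apply: (@harmonic_recurrent _ (fun x : nat => escape (- x%:Z)) (1 - p)).
- by apply/andP; split; lra.
- exact: escape0.
- move=> x; rewrite (@escape_harmonic (- x.+1%:Z))//.
  rewrite (_ : - x.+1%:Z - 1 = - x.+2%:Z); last by rewrite -opprD -PoszD addn1.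
  rewrite (_ : - x.+1%:Z + 1 = - x%:Z); last by rewrite -addn1 PoszD opprD addrNK.
  by ring.
- by move=> x; exact: escape01.
Qed.

(** Decomposing over the first step gives [p * (1 - (1 - p) / p) + (1 - p) * 0 = 2 * p - 1]. *)
Theorem escape_probability :
  P [set t | forall n : nat, (0 < n)%N -> pos n t != 0] = (2 * p - 1)%:E.
Proof.
have /andP[pl pr] := p01 M.
pose E n := [set t | avoids n 1 t].
have mE n : measurable (E n).
  have mf := @measurable_avoids n 1.
  rewrite (_ : E n = (fun t => (avoids n 1 t)%:R) @^-1` [set (1 : R)]).
    by have := mf measurableT [set 1] (measurable_set1 1); rewrite setTI.
  apply/seteqP; split => t; rewrite /E/=; first by move=> ->.
  by case: (avoids n 1 t) => // /eqP; rewrite eq_sym oner_eq0.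
have -> : [set t | forall n : nat, (0 < n)%N -> pos n t != 0] = \bigcap_n E n.
  apply/seteqP; split => t /= h.
    by move=> n _; apply/forallP => k; exact: h.
  by move=> [//|n] _; have /forallP /(_ ord_max) := h n I; rewrite add1n.
have PE n : P (E n) = (p * avoid n 1 + (1 - p) * avoid n (-1))%:E.
  rewrite -Ex_indic//; congr EFin.
  have indE t : \1_(E n) t = (avoids n 1 t)%:R :> R.
    by rewrite indicE; congr (_%:R); congr nat_of_bool; apply/idP/idP; rewrite inE.
  pose V e t : R := (xi 0 t == e)%:R.
  have bA : bmf (fun t => (avoids n 1 t)%:R : R).
    apply: bmf01 => [|t]; first exact: measurable_avoids.
    by case: (avoids _ _ _); rewrite ?ler01 ?lexx.
  have V01 e t : 0 <= V e t <= 1 by rewrite /V; case: (_ == _); rewrite ?ler01 ?lexx.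
  have mV e : Jm (past 1) (V e).
    by apply: (@Jmeas_xi R d T xi w tau (past 1) 0 (fun z => (z == e)%:R)) => /=.
  have bV e : bmf (V e) by apply: bmf01 => //; exact: (Jmeas_measurable M (mV e)).
  have Vx e t : V e t != 0 -> pos 1 t = e.
    by rewrite /V; case: (xi 0 t =P e) => [<-|]; rewrite ?eqxx// /pos big_ord1.
  transitivity (Ex P (fun t => V 1 t * (avoids n 1 t)%:R + V (-1) t * (avoids n 1 t)%:R)).
    apply: Ex_ae.
    - exact: measurable_indic.
    - by apply: measurable_funD; apply: measurable_funM; [exact: (proj1 (bV _))|exact: (proj1 bA)
        |exact: (proj1 (bV _))|exact: (proj1 bA)].
    - by apply: filterS (xi_pm M 0) => t xit; rewrite indE /V; case: xit => -> /=; ring.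
  rewrite ExD; [|exact/bmf_intg/bmfM|exact/bmf_intg/bmfM].
  by rewrite !(Ex_avoids n (mV _) (V01 _) (Vx _)) !(Ex_xi M).
have niE : nonincreasing_seq E.
  apply/nonincreasing_seqP => n; apply/subsetPset => t /forallP h.
  by apply/forallP => k; have := h (widen_ord (leqnSn _) k).
have := @nonincreasing_cvg_mu _ _ _ P E _ mE (bigcapT_measurable mE) niE.
have -> : P \o E = (fun n => (p * avoid n 1 + (1 - p) * avoid n (-1))%:E).
  by apply/funext => n; rewrite /= PE.
have lim : (fun n => p * avoid n 1 + (1 - p) * avoid n (-1)) @ \oo --> 2 * p - 1.
  rewrite (_ : 2 * p - 1 = p * escape 1 + (1 - p) * escape (-1)).
    by apply: cvgD; apply: cvgMr; exact: cvg_avoid.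
  by rewrite escape1 escapeN1; field; lra.
have lim' : (fun n => (p * avoid n 1 + (1 - p) * avoid n (-1))%:E) @ \oo --> (2 * p - 1)%:E.
  by apply: cvg_EFin; [exact: nearW|exact: lim].
move=> h; have := h (le_lt_trans (probability_le1 _ (mE 0%N)) (ltry 1)) => {}h.
by rewrite -(cvg_lim (@ereal_hausdorff R) h) (cvg_lim (@ereal_hausdorff R) lim').
Qed.

End Escape.

(** * Inversion of the clock *)

Section Inversion.
Context (R : realType).
Variables (c : nat -> R) (y : nat -> int) (X : R -> int) (v : R).
Hypotheses (c_nd : forall k, c k <= c k.+1) (v0 : 0 < v).
Hypothesis y_speed : (fun n => (y n)%:~R / n%:R) @ \oo --> v.
Hypothesis X_inv : forall k s, c k <= s < c k.+1 -> X s = y k.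

Lemma clock_mono m n : (m <= n)%N -> c m <= c n.
Proof.
by elim: n => [|n IH]; [rewrite leqn0 => /eqP ->|rewrite leq_eqVlt ltnS => /predU1P[->//|/IH/le_trans]; apply].
Qed.

(** For [s] between [c k] and [c k.+1], the quotient [X s / s] lies between [y k / c k.+1] and
    [y k / c k], once [y k] is nonnegative and [c k] positive. *)
Lemma inversion (a : R) : (forall A, exists N, A <= c N) ->
  (fun n => (y n)%:~R / c n) @ \oo --> a ->
  (fun n => (y n)%:~R / c n.+1) @ \oo --> a ->
  (fun s => (X s)%:~R / s) x @[x --> +oo] --> a.
Proof.
move=> c_unb ha ha'; apply/cvgrPdist_le => e e0.
have /cvgrPdist_le /(_ e e0) [N1 _ h1] := ha.
have /cvgrPdist_le /(_ e e0) [N2 _ h2] := ha'.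
have /cvgrPdist_lt /(_ v v0) [N3 _ h3] := y_speed.
(* Beyond [N4] the clock is at least [1], hence positive. *)
have [N4 h4] := c_unb 1.
pose N := maxn (maxn N1 N2) (maxn N3 N4).
exists (c N); split; first exact: num_real.
move=> s /= cs.
have exk : exists n, s < c n.
  by have [n hn] := c_unb (s + 1); exists n; apply: lt_le_trans hn; rewrite ltrDl.
case: (ex_minnP exk) => -[|k] sk kmin.
  by move: sk; rewrite ltNge (le_trans (clock_mono (leq0n N)) (ltW cs)).
have ks : c k <= s by rewrite leNgt; apply/negP => /kmin; rewrite ltnn.
have Nk : (N <= k)%N.
  rewrite leqNgt; apply/negP => kN; have := lt_le_trans sk (clock_mono kN).
  by rewrite ltNge (ltW cs).
rewrite (@X_inv k s) ?ks//.
move: Nk; rewrite !geq_max => /andP[/andP[k1 k2] /andP[k3 k4]].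
have ck : 0 < c k by apply: lt_le_trans (le_trans h4 (clock_mono k4)).
have yk : 0 <= (y k)%:~R :> R.
  (* For [k = 0] the quotient is [0] by convention and the bound would read [v < v]. *)
  have := h3 k k3 => /=; case: (posnP k) => [->|kp].
    by rewrite invr0 mulr0 subr0 ger0_norm ?ltxx// ltW.
  rewrite ltr_norml => /andP[_ h].
  have : 0 < (y k)%:~R / k%:R :> R by move: h; rewrite gtrBl.
  by rewrite pmulr_lgt0 ?invr_gt0 ?ltr0n// => /ltW.
have s0 : 0 < s by exact: lt_le_trans ks.
have u1 : (y k)%:~R / s <= (y k)%:~R / c k by apply: ler_wpM2l => //; rewrite lef_pV2 ?posrE.
have u2 : (y k)%:~R / c k.+1 <= (y k)%:~R / s.
  have ck1 := lt_trans s0 sk.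
  by apply: ler_wpM2l => //; rewrite lef_pV2 ?posrE// ltW.
have := h1 k k1; have := h2 k k2 => /=; rewrite !ler_norml.
by move=> /andP[? ?] /andP[? ?]; apply/andP; split; lra.
Qed.

Lemma inversion_fin (mu : R) : 0 < mu -> (fun n => c n / n%:R) @ \oo --> mu ->
  (fun s => (X s)%:~R / s) x @[x --> +oo] --> v / mu.
Proof.
move=> mu0 cmu; have mu_neq0 : mu != 0 by rewrite gt_eqF.
have cmu' : (fun n => c n.+1 / n.+1%:R) @ \oo --> mu.
  by have := cmu; rewrite -cvg_shiftS; exact.
have ratio : (fun n : nat => n%:R / n.+1%:R : R) @ \oo --> (1 : R).
  have -> : (fun n : nat => n%:R / n.+1%:R : R) = (fun n => 1 - harmonic n).
    apply/funext => n; have n1 : n.+1%:R != 0 :> R by rewrite pnatr_eq0.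
    by apply: (mulIf n1); rewrite divfK// mulrBl mul1r mulVf// -natr1 addrK.
  by rewrite -[X in _ --> X]subr0; apply: cvgB; [exact: cvg_cst|exact: cvg_harmonic].
apply: inversion.
- move=> A.
  have /cvgrPdist_lt /(_ _ (divr_gt0 mu0 (ltr0Sn R 1))) [N _ hN] := cmu.
  pose n := maxn N (Num.truncn (`|A| / (mu / 2))).+1.
  exists n; have := hN n (leq_maxl _ _) => /=; rewrite ltr_norml => /andP[_ h].
  have n0 : 0 < n%:R :> R by rewrite ltr0n leq_max orbT.
  have An : `|A| / (mu / 2) < n%:R.
    by apply: lt_le_trans (truncnS_gt _) _; rewrite ler_nat leq_maxr.
  rewrite ltr_pdivrMr ?divr_gt0// in An.
  have h' : mu / 2 < c n / n%:R by lra.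
  rewrite ltr_pdivlMr// in h'.
  by apply: le_trans (ler_norm A) _; move: An; rewrite mulrC; lra.
- have lim : (fun n => (y n)%:~R / n%:R * (c n / n%:R)^-1) @ \oo --> v / mu.
    by apply: cvgM => //; exact: cvgV.
  apply: cvg_trans lim; apply: near_eq_cvg.
  exists 1%N => // n /= n0; have n0' : n%:R != 0 :> R by rewrite pnatr_eq0 -lt0n.
  by rewrite invfM invrK mulrACA [_ * n%:R]mulrC mulfV// mulr1.
- have lim : (fun n => (y n)%:~R / n%:R * (n%:R / n.+1%:R) * (c n.+1 / n.+1%:R)^-1)
      @ \oo --> v / mu.
    by rewrite -[v]mulr1; apply: cvgM; [exact: cvgM|exact: cvgV].
  apply: cvg_trans lim; apply: near_eq_cvg.
  exists 1%N => // n /= n0; have n0' : n%:R != 0 :> R by rewrite pnatr_eq0 -lt0n.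
  have n1' : n.+1%:R != 0 :> R by rewrite pnatr_eq0.
  rewrite invfM invrK /=.
  have -> : (y n)%:~R / n%:R * (n%:R / n.+1%:R) * ((c n.+1)^-1 * n.+1%:R) =
    (y n)%:~R * (c n.+1)^-1 * (n%:R^-1 * n%:R) * (n.+1%:R^-1 * n.+1%:R) by ring.
  by rewrite !mulVf// !mulr1.
Qed.

Lemma inversion_inf :
  (forall A : R, exists N, forall n, (N <= n)%N -> A * n%:R <= c n) ->
  (fun s => (X s)%:~R / s) x @[x --> +oo] --> (0 : R).
Proof.
move=> cinf.
(* Used for [c n] and [c n.+1] alike: eventually [0 < y n < 2 * v * n], while the clock is at least
   [2 * v / e * n]. *)
have small (k : nat -> nat) : (forall n, (n <= k n)%N) ->
    (fun n => (y n)%:~R / c (k n)) @ \oo --> (0 : R).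
  move=> nk; apply/cvgrPdist_le => e e0.
  have /cvgrPdist_lt /(_ v v0) [N1 _ h1] := y_speed.
  have A0 : 0 < 2 * v / e by rewrite divr_gt0// mulr_gt0.
  have [N2 h2] := cinf (2 * v / e).
  exists (maxn N1 N2).+1 => // n /= nN.
  have n1 : (N1 <= n)%N by rewrite (leq_trans _ (ltnW nN))// leq_maxl.
  have n2 : (N2 <= n)%N by rewrite (leq_trans _ (ltnW nN))// leq_maxr.
  have n0 : 0 < n%:R :> R by rewrite ltr0n (leq_trans _ nN).
  have ck : 2 * v / e * n%:R <= c (k n).
    exact: le_trans (h2 n n2) (clock_mono (nk n)).
  have ck0 : 0 < c (k n) by apply: lt_le_trans ck; rewrite mulr_gt0.
  have := h1 n n1 => /=; rewrite ltr_norml => /andP[h3 h4].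
  have y1 : (y n)%:~R / n%:R < 2 * v by lra.
  have y2 : 0 < (y n)%:~R / n%:R :> R by lra.
  rewrite ltr_pdivrMr// in y1; rewrite pmulr_lgt0 ?invr_gt0// in y2.
  rewrite sub0r normrN ger0_norm ?divr_ge0 ?ltW// ltr_pdivrMr//.
  apply: lt_le_trans y1 _; move: ck.
  by rewrite mulrAC ler_pdivrMr// mulrC [c _ * e]mulrC.
apply: inversion; [|exact: (small id)|exact: (small succn)].
move=> A; have [N hN] := cinf `|A|; exists N.+1.
apply: le_trans (hN _ (leqnSn N)).
by apply: le_trans (ler_norm A) _; rewrite ler_peMr// ler1n.
Qed.

End Inversion.

(** * Assembling the velocity *)

Lemma p_lambda_bounds (R : realType) (lam : R) : 0 < lam -> 2^-1 < p_lambda lam < 1.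
Proof.
move=> lam0; rewrite /p_lambda.
have e1 : expR (- lam) < expR lam by rewrite ltr_expR; lra.
have e2 := expR_gt0 (- lam); have e3 := expR_gt0 lam.
have s0 : 0 < expR lam + expR (- lam) by rewrite addr_gt0.
by rewrite ltr_pdivlMr// ltr_pdivrMr//; apply/andP; split; lra.
Qed.

Lemma p_lambda_escape (R : realType) (lam : R) :
  2 * p_lambda lam - 1 = (expR lam - expR (- lam)) / (expR lam + expR (- lam)).
Proof.
have s0 : expR lam + expR (- lam) != 0 by rewrite gt_eqF// addr_gt0 ?expR_gt0.
by rewrite /p_lambda; field.
Qed.

Section Velocity.
Context (R : realType) (d : measure_display) (T : measurableType d).
Variable P : probability T R.
Variables (xi : nat -> T -> int) (w : int -> T -> R) (tau : int -> nat -> T -> R -> R).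
Variable p : R.
Hypothesis M : rw_model P xi w tau p.

Theorem velocity :
  let vbar := if (\int[P]_t (w 0 t)%:E)%E is r%:E then (2 * p - 1) / r else 0 in
  {ae P, forall t, forall X : R -> int,
     (forall (k : nat) (s : R),
        clock xi w tau k t <= s < clock xi w tau k.+1 t -> X s = pos xi k t) ->
     (fun s => (X s)%:~R / s) x @[x --> +oo] --> vbar}.
Proof.
move=> vbar; have /andP[pl pr] := p01 M; have v0 : 0 < 2 * p - 1 by lra.
have [hold0|nh] := pselect {ae P, forall t, 0 <= hold xi w tau 0 t}; last first.
  apply: filterS (negative_inconsistent M nh) => t ht X hX.
  by case: (ht X).
have nd t : (forall k, 0 <= hold xi w tau k t) ->
    forall k, clock xi w tau k t <= clock xi w tau k.+1 t.
  by move=> h k; rewrite clockS lerDl.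
rewrite /vbar; case wE : (\int[P]_t (w 0 t)%:E)%E => [mu||].
(* A zero mean would force the strictly positive [w 0] to vanish almost everywhere. *)
- have mu0 : 0 < mu.
    rewrite lt0r; apply/andP; split; last first.
      rewrite -lee_fin -wE; apply: integral_ge0 => t _.
      by rewrite lee_fin ltW// (w_gt0 M).
    apply/eqP => mu0; rewrite mu0 in wE; apply: (@ae_false _ _ _ P).
    have : ae_eq P setT (EFin \o w 0) (cst 0%E).
      apply/(ae_eq_integral_abs P measurableT).
        by apply/measurable_EFinP; exact: (mw M).
      by rewrite -[RHS]/(0%:E) -wE; apply: eq_integral => t _;
        rewrite gee0_abs// lee_fin ltW// (w_gt0 M).
    apply: filterS => t /(_ I) [w0].
    by have := w_gt0 M 0 t; rewrite w0 ltxx.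
  apply: filterS3 (pos_average M) (hold_ge0 M hold0) (hold_average_fin M hold0 wE).
  move=> t ypos h0 hc X hX.
  exact: (@inversion_fin R (fun n => clock xi w tau n t) (fun n => pos xi n t) X _
    (nd t h0) v0 ypos hX mu mu0 hc).
- apply: filterS3 (pos_average M) (hold_ge0 M hold0) (hold_average_inf M hold0 wE).
  move=> t ypos h0 hc X hX.
  exact: (@inversion_inf R (fun n => clock xi w tau n t) (fun n => pos xi n t) X _
    (nd t h0) v0 ypos hX hc).
- have : (0 <= \int[P]_t (w 0 t)%:E)%E.
    by apply: integral_ge0 => t _; rewrite lee_fin ltW// (w_gt0 M).
  by rewrite wE.
Qed.

End Velocity.

Unset Implicit Arguments.

Theorem theorem2p1 (R : realType) (d : measure_display) (T : measurableType d)
  (P : probability T R) (lam : R)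
  (xi : nat -> T -> int) (w : int -> T -> R) (tau : int -> nat -> T -> R -> R) :
  0 < lam ->
  (* xi_1, xi_2, ... (here indexed xi 0, xi 1, ...) *)
  (forall k (z : int), measurable (xi k @^-1` [set z])) ->
  (forall k, P (xi k @^-1` [set 1%Z]) = (p_lambda lam)%:E) ->
  (forall k, P (xi k @^-1` [set (-1)%Z]) = (1 - p_lambda lam)%:E) ->
  (* the environment *)
  (forall x, measurable_fun setT (w x)) ->
  (forall x t, 0 < w x t) ->
  stationary_ergodic P w ->
  (* the holding-time processes *)
  (forall x k r, 0 <= r -> measurable_fun setT (fun t => tau x k t r)) ->
  (forall x k t, cadlag (tau x k t)) ->
  (forall x k x' k', same_law P (fun t (r : {r : R | 0 <= r}) => tau x k t (sval r))
                                (fun t (r : {r : R | 0 <= r}) => tau x' k' t (sval r))) ->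
  (forall x k r, 0 <= r -> P.-integrable setT (fun t => (tau x k t r)%:E) /\
                  (\int[P]_t (tau x k t r)%:E = r%:E)%E) ->
  (* mutual independence of (xi_k)_k, (w_x)_x and (tau_{.,x,k})_{x,k} *)
  mutually_independent P (fun i : idx => match i with
     | inl (inl k) => gen_sigma_int (xi k)
     | inl (inr _) => gen_sigma setT w
     | inr (x, k) => gen_sigma [set r | 0 <= r] (fun r t => tau x k t r)
     end) ->
  let Y := fun (n : nat) t => (\sum_(k < n) xi k t)%R in
  let Tn := fun (n : nat) t => (\sum_(k < n) tau (Y k t) k t (w (Y k t) t))%R in
  let pesc := (expR lam - expR (- lam)) / (expR lam + expR (- lam)) in
  let Ew0 := (\int[P]_t (w 0 t)%:E)%E in
  let vbar := if Ew0 is r%:E then pesc / r else 0 in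
  P [set t | forall n : nat, (0 < n)%N -> Y n t != 0%Z] = (2 * p_lambda lam - 1)%:E /\
  (2 * p_lambda lam - 1 = pesc) /\
  {ae P, forall t, forall X : R -> int,
     (forall (k : nat) (s : R), Tn k t <= s < Tn k.+1 t -> X s = Y k t) ->
     (fun s => (X s)%:~R / s) x @[x --> +oo] --> vbar}.
Proof.
move=> lam0 Mxi Mxi1 MxiN1 Mw Mw0 Merg Mtau Mcad Mlaw Mmean Mind Y Tn pesc Ew0 vbar.
have M : rw_model P xi w tau (p_lambda lam).
  by split => //; exact: p_lambda_bounds.
have pE := p_lambda_escape lam.
split; first exact: (escape_probability M).
split; first exact: pE.
have := velocity M; rewrite pE; exact.
Qed.
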